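(* Let $Y,H$ be locally compact spaces and $\pi:H\to Y$ a continuous, open, surjective map. Let $\Theta=(\theta,H^{(1)},H^{(-1)})$ be a partial automorphism of $H$ with $\pi\circ\theta=\pi_{|H^{(1)}}$. For $y\in Y$ let $H_y=\pi^{-1}(y)$, $H_y^{(\pm1)}=H^{(\pm1)}\cap\pi^{-1}(y)$, and let $\Theta_y=(\theta_y,H_y^{(1)},H_y^{(-1)})$ be the partial automorphism of $H_y$ obtained by restricting $\theta$. Then the C$^*$-algebra $C_0(H)\rtimes_\Theta\mathbb Z$ is a continuous field of C$^*$-algebras over $Y$ with fibers $C_0(H_y)\rtimes_{\Theta_y}\mathbb Z$.
   Context: All locally compact spaces are Hausdorff and second countable; C$^*$-algebras (except multiplier algebras) are separable. A $C_0(Y)$-algebra is a C$^*$-algebra $A$ with an injective non-degenerate $^*$-homomorphism of $C_0(Y)$ into the center of $M(A)$. The localisation (fiber) $A_y$ is the quotient of $A$ by the closed ideal of all $fa$, $f\in C_0(Y\setminus\{y\})$, $a\in A$; $a_y$ is the image of $a$. $A$ is a continuous field of C$^*$-algebras over $Y$ if $y\mapsto\|a_y\|$ is continuous on $Y$ for all $a\in A$. The $C_0(Y)$-structure on $C_0(H)\rtimes_\Theta\mathbb Z$ comes from pullback along $\pi$. A partial automorphism $\Theta=(\theta,H^{(1)},H^{(-1)})$ of $H$ is a homeomorphism $\theta:H^{(1)}\to H^{(-1)}$ between open subsets of $H$. For $k\in\mathbb Z$ let $H^{(k)}$ be the domain of $\theta^k$ ($H^{(0)}=H$), so $\theta^k:H^{(k)}\to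 H^{(-k)}$ is a homeomorphism, and put $\theta^k(f)=f\circ\theta^k\in C_0(H^{(k)})$ for $f\in C_0(H^{(-k)})$. Let $\mathscr N_k=\{s^kf\mid f\in C_0(H^{(k)})\}$ (formal symbols). $\oplus_{k}\mathscr N_k$ is a $^*$-algebra by $(s^kf)(s^lg)=s^{k+l}\theta^l(f\theta^{-l}(g))$, $(s^kf)^*=s^{-k}\theta^{-k}(f^* )$; $C_0(H)\rtimes_\Theta\mathbb Z$ is its universal C$^*$-envelope. *)

(* Defs.v *)
From HB Require Import structures.
From mathcomp Require Import all_boot all_order all_algebra complex.
From mathcomp Require Import all_classical all_reals all_analysis.
Set Implicit Arguments.
Unset Strict Implicit.
Unset Printing Implicit Defensive.
Import Order.TTheory GRing.Theory Num.Theory.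
Import numFieldNormedType.Exports.
Local Open Scope classical_set_scope.
Local Open Scope ring_scope.
Local Open Scope quotient_scope.

(* The complex numbers over R; MathComp-Analysis puts the topology and the
   normed module structure of a concrete numeric field K on K^o. *)
Notation Cplx R := ((complex R)^o) (only parsing).

Definition cconj (R : realType) (z : Cplx R) : Cplx R :=
  Num.conj (z : complex R).

(* C*-algebras, not necessarily unital. Norms of a normed module over R[i] take
   values in R[i]. *)

HB.mixin Record isCStarAlgebra (R : realType) A
    of CompleteNormedModule (complex R) A := {
  cmul : A -> A -> A;
  cstar : A -> A;
  cmulA : associative cmul;
  cmulDl : left_distributive cmul +%R;
  cmulDr : right_distributive cmul +%R;
  cmulZl : forall (c : complex R) (a b : A), cmul (c *: a) b = c *: cmul a b;
  cmulZr : forall (c : complex R) (a b : A), cmul a (c *: b) = c *: cmul a b;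
  cstarD : {morph cstar : a b / a + b};
  cstarZ : forall (c : complex R) (a : A),
    cstar (c *: a) = Num.conj c *: cstar a;
  cstarM : forall a b : A, cstar (cmul a b) = cmul (cstar b) (cstar a);
  cstarK : involutive cstar;
  norm_cmul_le : forall a b : A, `|cmul a b| <= `|a| * `|b|;
  norm_cstar_mul : forall a : A, `|cmul (cstar a) a| = `|a| ^+ 2
}.

#[short(type="cstarAlgType")]
HB.structure Definition CStarAlgebra (R : realType) :=
  {A of isCStarAlgebra R A & CompleteNormedModule (complex R) A}.

Definition rnorm (R : realType) (A : cstarAlgType R) (a : A) : R :=
  complex.Re `|a|.

(* phi restricts to a *-homomorphism on the subspace S of V, for the given
   products and involutions. Values outside S are irrelevant. *)
Definition star_hom (R : realType) (V W : lmodType (complex R)) (S : set V)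
    (mulV : V -> V -> V) (starV : V -> V) (mulW : W -> W -> W) (starW : W -> W)
    (phi : V -> W) : Prop :=
  [/\ forall (c : complex R) a b, S a -> S b ->
        phi (c *: a + b) = c *: phi a + phi b,
      forall a b, S a -> S b -> phi (mulV a b) = mulW (phi a) (phi b) &
      forall a, S a -> phi (starV a) = starW (phi a)].

Definition separable (T : topologicalType) : Prop :=
  exists2 D : set T, countable D & dense D.

Definition closed_subspace (R : realType) (A : cstarAlgType R) (S : set A) :=
  [/\ closed S, S 0 & forall (c : complex R) a b, S a -> S b -> S (c *: a + b)].

Definition closed_ideal (R : realType) (A : cstarAlgType R) (J : set A) :=
  closed_subspace J /\
  forall a b, J a -> J (cmul a b) /\ J (cmul b a).

(* The multiplier algebra M(A) as the algebra of double centralizers: pairs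
   (L, M) of maps with a L(b) = M(a) b. Linearity and boundedness of L and M
   are automatic in a C*-algebra (Busby). Addition and scaling are the pointwise
   ones, from the lmodType structure of (A -> A) * (A -> A). *)
Section Multipliers.
Variables (R : realType) (A : cstarAlgType R).
Local Notation maps := ((A -> A) * (A -> A))%type.

Definition multiplier : set maps :=
  [set m | forall a b, cmul a (m.1 b) = cmul (m.2 a) b].

Definition mmul (m n : maps) : maps := (m.1 \o n.1, n.2 \o m.2).

Definition mstar (m : maps) : maps :=
  (fun a => cstar (m.2 (cstar a)), fun a => cstar (m.1 (cstar a))).

Definition mcenter : set maps :=
  [set m | multiplier m /\ forall n, multiplier n -> mmul m n = mmul n m].

End Multipliers.

(* For U open in a locally compact Hausdorff space T, C_0(U) is identified with
   the functions on T obtained by extension by zero. *)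
Definition C0 (R : realType) (T : topologicalType) (U : set T) :
    set (T -> Cplx R) :=
  [set f | continuous f /\
    forall e : complex R, 0 < e ->
      exists2 K : set T, compact K /\ K `<=` U &
        forall x, ~ K x -> `|f x| < e].

Arguments C0 R {T} U.

Section C0Algebra.
Variables (R : realType) (Y : topologicalType) (A : cstarAlgType R).
Variable phi : (Y -> Cplx R) -> (A -> A) * (A -> A).

Definition C0_structure : Prop :=
  [/\ star_hom (C0 R [set: Y]) (fun f g x => f x * g x)
        (fun f x => cconj (f x)) (@mmul R A) (@mstar R A) phi,
      forall f, C0 R [set: Y] f -> mcenter (phi f),
      forall f g, C0 R [set: Y] f -> C0 R [set: Y] g -> phi f = phi g -> f = g &
      smallest (@closed_subspace R A)
        [set (phi f).1 a | f in C0 R [set: Y] & a in [set: A]] = [set: A]].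

(* The closed ideal generated by the f a with f in C_0(Y \ {y}); by Cohen
   factorization these products already form a closed ideal. *)
Definition fiber_ideal (y : Y) : {pred A} := fun a =>
  `[< smallest (@closed_ideal R A)
        [set (phi f).1 b | f in C0 R (~` [set y]) & b in [set: A]] a >].

Lemma fiber_ideal_lin (y : Y) (c : complex R) a b :
  a \in fiber_ideal y -> b \in fiber_ideal y -> c *: a + b \in fiber_ideal y.
Proof.
move=> /asboolP Ia /asboolP Ib; apply/asboolP => J [Jid gJ].
have [[_ _ Jlin] _] := Jid.
by apply: Jlin; [apply: Ia|apply: Ib]; split.
Qed.

Lemma fiber_ideal_zmod_closed (y : Y) : zmod_closed (fiber_ideal y).
Proof.
split; first by apply/asboolP => J [[[_ J0 _] _] _].
by move=> a b Ia Ib; rewrite addrC -scaleN1r; apply: fiber_ideal_lin.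
Qed.

HB.instance Definition _ (y : Y) :=
  GRing.isZmodClosed.Build A (fiber_ideal y) (fiber_ideal_zmod_closed y).

Section Fiber.
Variable y : Y.

Definition fiber := {ideal_quot fiber_ideal y}.

HB.instance Definition _ := GRing.Zmodule.on fiber.

Definition to_fiber (a : A) : fiber := \pi_{ideal_quot fiber_ideal y} a.

(* Operations induced on the quotient, through representatives. They do not
   depend on the choice, since closed two-sided ideals are self-adjoint. *)
Definition fscale (c : complex R) (u : fiber) : fiber :=
  to_fiber (c *: repr u).
Definition fmul (u v : fiber) : fiber := to_fiber (cmul (repr u) (repr v)).
Definition fstar (u : fiber) : fiber := to_fiber (cstar (repr u)).
Definition fnorm (u : fiber) : R :=
  inf [set rnorm a | a in to_fiber @^-1` [set u]].

Lemma to_fiberE (a b : A) :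
  to_fiber a = to_fiber b <-> a - b \in fiber_ideal y.
Proof.
by rewrite Quotient.idealrBE; split=> [/eqP|] // /eqP.
Qed.

Lemma to_fiberD (a b : A) : to_fiber (a + b) = to_fiber a + to_fiber b.
Proof. by rewrite /to_fiber piE. Qed.

Lemma to_fiberZ (c : complex R) (a : A) :
  to_fiber (c *: a) = fscale c (to_fiber a).
Proof.
apply/to_fiberE; rewrite -scalerBr -[_ *: _]addr0.
apply: fiber_ideal_lin; last by case: (fiber_ideal_zmod_closed y).
by apply/to_fiberE; rewrite /to_fiber reprK.
Qed.

Lemma to_fiber_repr (u : fiber) : to_fiber (repr u) = u.
Proof. exact: reprK. Qed.

Lemma fscaleA c d u : fscale c (fscale d u) = fscale (c * d) u.
Proof. by rewrite -[u]to_fiber_repr -!to_fiberZ scalerA. Qed.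

Lemma fscale1 : left_id 1 fscale.
Proof. by move=> u; rewrite -[u]to_fiber_repr -!to_fiberZ scale1r. Qed.

Lemma fscaleDr : right_distributive fscale +%R.
Proof.
move=> c u v; rewrite -[u]to_fiber_repr -[v]to_fiber_repr.
by rewrite -to_fiberD -!to_fiberZ scalerDr to_fiberD.
Qed.

Lemma fscaleDl u : {morph fscale^~ u : c d / c + d}.
Proof.
move=> c d; rewrite /= -[u]to_fiber_repr.
by rewrite -!to_fiberZ scalerDl to_fiberD.
Qed.

HB.instance Definition _ := GRing.Zmodule_isLmodule.Build (complex R) fiber
  fscaleA fscale1 fscaleDr fscaleDl.

Definition fiber_isomorphism (B : cstarAlgType R) (Psi : fiber -> B) : Prop :=
  [/\ bijective Psi,
      star_hom [set: fiber] fmul fstar (@cmul R B) (@cstar R B) Psi &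
      forall u, rnorm (Psi u) = fnorm u].

End Fiber.

Definition continuous_field : Prop :=
  [/\ separable A, C0_structure &
      forall a : A, continuous (fun y => fnorm (to_fiber y a) : R)].

End C0Algebra.

(* Values of pfun outside pdom, and of pinv outside pran, are irrelevant. *)
Record partial_aut (T : topologicalType) := PartialAut {
  pdom : set T;
  pran : set T;
  pfun : T -> T;
  pinv : T -> T;
  open_pdom : open pdom;
  open_pran : open pran;
  pfunS : forall x, pdom x -> pran (pfun x);
  pinvS : forall x, pran x -> pdom (pinv x);
  pfunK : forall x, pdom x -> pinv (pfun x) = x;
  pinvK : forall x, pran x -> pfun (pinv x) = x;
  cts_pfun : {within pdom, continuous pfun};
  cts_pinv : {within pran, continuous pinv} }.

Section CrossedProduct.
Variables (R : realType) (T : topologicalType) (Theta : partial_aut T).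

Definition pstep (D : set T) (f : T -> T) (x : T) : option T :=
  if `[< D x >] then Some (f x) else None.

(* ppow k is theta^k as a partial map: None outside the domain of theta^k. *)
Definition ppow (k : int) (x : T) : option T :=
  match k with
  | Posz n => iter n (obind (pstep (pdom Theta) (pfun Theta))) (Some x)
  | Negz n => iter n.+1 (obind (pstep (pran Theta) (pinv Theta))) (Some x)
  end.

Definition Hdom (k : int) : set T := [set x | ppow k x].

(* theta^k(f) = f o theta^k in C_0(H^(k)), for f in C_0(H^(-k)). *)
Definition pull (k : int) (f : T -> Cplx R) (x : T) : Cplx R :=
  if ppow k x is Some z then f z else 0.

(* The *-algebra of finite sums of the symbols s^k f, encoded as finitely
   supported families: a stands for the sum of the s^k (a k). *)
Definition xalg : set (int -> T -> Cplx R) :=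
  [set a | (forall k, C0 R (Hdom k) (a k)) /\ finite_set [set k | a k <> 0]].

Definition smono (k : int) (f : T -> Cplx R) : int -> T -> Cplx R :=
  fun n => if n == k then f else 0.

(* The bilinear extension of (s^k f)(s^l g) = s^(k+l) theta^l(f theta^-l(g)). *)
Definition xmul (a b : int -> T -> Cplx R) : int -> T -> Cplx R := fun n =>
  \sum_(l \in [set: int]) pull l (fun x => a (n - l) x * pull (- l) (b l) x).

(* The antilinear extension of (s^k f)^* = s^-k theta^-k(f^* ). *)
Definition xstar (a : int -> T -> Cplx R) : int -> T -> Cplx R := fun n =>
  pull n (fun x => cconj (a (- n) x)).

Definition xrep (B : cstarAlgType R) (rho : (int -> T -> Cplx R) -> B) : Prop :=
  star_hom xalg xmul xstar (@cmul R B) (@cstar R B) rho.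

(* (A, iota) is the universal C*-envelope of xalg, that is, the crossed product
   C_0(T) x_Theta Z with its canonical map. *)
Definition is_crossed_product (A : cstarAlgType R)
    (iota : (int -> T -> Cplx R) -> A) : Prop :=
  xrep iota /\
  forall (B : cstarAlgType R) (rho : (int -> T -> Cplx R) -> B), xrep rho ->
    exists2 psi : A -> B,
      star_hom [set: A] (@cmul R A) (@cstar R A) (@cmul R B) (@cstar R B) psi /\
      (forall a, xalg a -> psi (iota a) = rho a) &
      forall psi' : A -> B,
        star_hom [set: A] (@cmul R A) (@cstar R A) (@cmul R B) (@cstar R B) psi' ->
        (forall a, xalg a -> psi' (iota a) = rho a) -> psi' = psi.

End CrossedProduct.

Arguments Hdom {T} Theta k.
Arguments xalg R {T} Theta.

(* The restriction of Theta to a Theta-invariant subset S, a partial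
   automorphism of the space S with its subspace topology. *)
Section Restriction.
Variables (T : topologicalType) (Theta : partial_aut T) (S : set T).
Hypothesis S_inv : forall x, pdom Theta x -> (S (pfun Theta x) <-> S x).

Definition rdom : set S := set_val @^-1` pdom Theta.
Definition rran : set S := set_val @^-1` pran Theta.
(* insubd x z is z seen as a point of S when z lies in S, and x otherwise. *)
Definition rfun (x : S) : S := insubd x (pfun Theta (set_val x)).
Definition rinv (x : S) : S := insubd x (pinv Theta (set_val x)).

Lemma S_val (x : S) : S (set_val x).
Proof. exact: set_valP. Qed.

Lemma rfunE x : rdom x -> set_val (rfun x) = pfun Theta (set_val x).
Proof.
move=> dx; rewrite /rfun set_valE insubdK //.
by apply/mem_set/S_inv => //; exact: S_val.
Qed.

Lemma rinvE x : rran x -> set_val (rinv x) = pinv Theta (set_val x).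
Proof.
move=> dx; rewrite /rinv set_valE insubdK //.
apply/mem_set/S_inv; first exact: pinvS.
by rewrite pinvK //; exact: S_val.
Qed.

Lemma open_rdom : open rdom.
Proof.
by apply: open_comp; [move=> x _; exact: initial_continuous|exact: open_pdom].
Qed.

Lemma open_rran : open rran.
Proof.
by apply: open_comp; [move=> x _; exact: initial_continuous|exact: open_pran].
Qed.

Lemma rfunS x : rdom x -> rran (rfun x).
Proof. by move=> dx; rewrite /rran /= rfunE //; exact: pfunS. Qed.

Lemma rinvS x : rran x -> rdom (rinv x).
Proof. by move=> dx; rewrite /rdom /= rinvE //; exact: pinvS. Qed.

Lemma rfunK x : rdom x -> rinv (rfun x) = x.
Proof.
move=> dx; apply: val_inj; rewrite -!set_valE rinvE; last exact: rfunS.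
by rewrite rfunE // pfunK.
Qed.

Lemma rinvK x : rran x -> rfun (rinv x) = x.
Proof.
move=> dx; apply: val_inj; rewrite -!set_valE rfunE; last exact: rinvS.
by rewrite rinvE // pinvK.
Qed.

Lemma restr_cts (D : set T) (f : T -> T) (g : S -> S) : open D ->
  {within D, continuous f} ->
  (forall x : S, D (set_val x) -> set_val (g x) = f (set_val x)) ->
  {within (set_val @^-1` D : set S), continuous g}.
Proof.
move=> oD cf gE.
have oD' : open (set_val @^-1` D : set S).
  by apply: open_comp => // x _; exact: initial_continuous.
rewrite continuous_open_subspace // => x; rewrite inE => Dx.
have cfx : {for (set_val x : T), continuous f}.
  by move: cf; rewrite continuous_open_subspace //; apply; rewrite inE.
move=> V [/= _ [[W oW <-] /= Wgx WV]].
have Wfx : nbhs (f (set_val x)) W.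
  by rewrite -gE //; exact: open_nbhs_nbhs.
have cv : {for x, continuous (set_val : S -> T)} by exact: initial_continuous.
suff : \forall z \near x, V (g z) by [].
near=> z; apply: WV => /=; rewrite gE; last first.
  by near: z; exact: open_nbhs_nbhs.
by near: z; apply: (cv _ (cfx _ Wfx)).
Unshelve. all: by end_near. Qed.

Definition restriction : partial_aut S :=
  PartialAut open_rdom open_rran rfunS rinvS rfunK rinvK
    (restr_cts (@open_pdom _ Theta) (@cts_pfun _ Theta) rfunE)
    (restr_cts (@open_pran _ Theta) (@cts_pinv _ Theta) rinvE).

End Restriction.

Lemma fiber_invariant (H Y : Type) (p : H -> Y) (D : set H) (f : H -> H)
    (y : Y) : (forall x, D x -> p (f x) = p x) ->
  forall x, D x -> ((p @^-1` [set y]) (f x) <-> (p @^-1` [set y]) x).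
Proof. by move=> pf x Dx; rewrite /preimage /= pf. Qed.

(* Locally compact spaces are Hausdorff and second countable throughout. *)
Definition lc_space (T : topologicalType) : Prop :=
  [/\ hausdorff_space T, locally_compact [set: T] & @second_countable T].

(* Main.v *)
(* For each point x of H, xalg acts on the finitely supported functions on Z by its
   regular representation lambda_x, which gives the reduced norm
   nred(a) = sup_x |lambda_x(a)|.  Any representation rho satisfies
   |rho(a)| <= (2d + 1) sup_k |a_k| for a supported in [-d, d].  Apply this to the
   squares (a^* a)^(2^m): their supports grow linearly in 2^m, whereas their norms are
   powers of that of a.  Hence |rho(a)| <= nred(a), and the norm of the crossed product
   is the reduced one.

   The norm on the fibre at y should be the supremum of |lambda_x(a)| over x in H_y.
   This supremum is upper semicontinuous in y: by the same estimate it is controlled by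
   the sizes over H_y of finitely many coefficients of a high square, and the sets
   where a coefficient is large are compact.  It is lower semicontinuous because
   |lambda_x(a) v| is continuous in x for suitable v and p is open.  Upper
   semicontinuity identifies it with the quotient norm on the fibre, and restriction
   to H_y, which preserves it and has dense range (approximate Tietze extension), then
   identifies the fibre with the crossed product over H_y. *)

Require Import Defs.
From HB Require Import structures.
From mathcomp Require Import all_boot all_order all_algebra complex.
From mathcomp Require Import all_classical all_reals all_analysis.
From mathcomp Require Import ring lra zify.
Import Order.TTheory GRing.Theory Num.Theory.
Import numFieldNormedType.Exports.
Local Open Scope classical_set_scope.
Local Open Scope ring_scope.

Set Implicit Arguments.
Unset Strict Implicit.
Unset Printing Implicit Defensive.

(** * Real-valued norms and limits in C*-algebras *)

(** Two obstacles shape the proof. First, [A] is known only through its universal property, which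
    gives neither the norm of [iota a] nor the density of the image. Both come from completing
    [xalg] in the reduced norm: once every representation is dominated by that norm, the identity of
    [A] factors through the completion, by uniqueness of induced maps. Second, arbitrary
    representations must be bounded by algebraic means. A self-adjoint x of norm below 1 has a
    commuting self-adjoint companion y with x^2 + y^2 = 2y, that is, x^2 + (1 - y)^2 = 1. Written
    without the unit, this relation is preserved by every star-homomorphism between non-unital
    algebras, and it forces the norm of the image of x to be at most 1. The same relation between
    real functions bounds representations of C_0(H) before any continuity is known. Powers of the
    form 2^m are taken because the C*-identity computes the norm of the square of a self-adjoint
    element exactly, for the reduced norm and in any representation. Counting diagonals is harmless
    because Z grows polynomially. *)

Section ComplexModulus.
Variable R : realType.
Implicit Types (z w : complex R) (r : R).
Local Notation "x %:C" := (real_complex R x).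

Definition cn (z : complex R) : R :=
  complex.Re (@Num.norm (complex R) (complex R) z).

Lemma cnE z : @Num.norm (complex R) (complex R) z = (cn z)%:C.
Proof. by rewrite /cn RRe_real // normr_real. Qed.

Lemma cn_ge0 z : 0 <= cn z.
Proof. by have := normr_ge0 z; rewrite cnE ler0c. Qed.

Lemma cnD z w : cn (z + w) <= cn z + cn w.
Proof. by have := ler_normD z w; rewrite !cnE -rmorphD lecR. Qed.

Lemma cnM z w : cn (z * w) = cn z * cn w.
Proof. by apply: (@complexI R); rewrite rmorphM /= -!cnE normrM. Qed.

Lemma cnN z : cn (- z) = cn z.
Proof. by rewrite /cn normrN. Qed.

Lemma cn0 : cn 0 = 0.
Proof. by rewrite /cn normr0. Qed.

Lemma cn1 : cn 1 = 1.
Proof. by rewrite /cn normr1. Qed.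

Lemma cnB z w : cn (z - w) = cn (w - z).
Proof. by rewrite /cn distrC. Qed.

Lemma cn_eq0 z : (cn z == 0) = (z == 0).
Proof. by rewrite -[RHS]normr_eq0 cnE (inj_eq (@complexI R) _ 0). Qed.

Lemma cn_real r : cn r%:C = `|r|.
Proof. by rewrite /cn normc_def /= expr0n /= addr0 sqrtr_sqr. Qed.

Lemma cn_nat n : cn n%:R = n%:R.
Proof. by rewrite -(rmorph_nat (real_complex R)) cn_real ger0_norm. Qed.

Lemma cn_conj z : cn (Num.conj z) = cn z.
Proof. by rewrite /cn norm_conjC. Qed.

Lemma conj_mul z : Num.conj z * z = (cn z ^+ 2)%:C.
Proof. by rewrite mulrC -normCK cnE rmorphXn. Qed.

Lemma cn_sum I (s : seq I) (P : pred I) (F : I -> complex R) :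
  cn (\sum_(i <- s | P i) F i) <= \sum_(i <- s | P i) cn (F i).
Proof.
elim/big_rec2 : _ => [|i x y _ h]; first by rewrite cn0.
by apply: le_trans (cnD _ _) _; rewrite lerD2l.
Qed.

Lemma Re_cn z : complex.Re z <= cn z.
Proof.
by apply: le_trans (ler_norm _) _; rewrite -lecR -cnE normc_ge_Re.
Qed.

Lemma cn_lt z (e : R) : (`|z| < e%:C) = (cn z < e).
Proof. by rewrite cnE ltcR. Qed.

Lemma cplx_gt0 (e : complex R) : 0 < e -> exists2 r : R, 0 < r & e = r%:C.
Proof.
move=> e0; exists (complex.Re e); last by rewrite RRe_real // gtr0_real.
by move: e0; rewrite ltcE /= => /andP[].
Qed.
End ComplexModulus.

Lemma invS_small (R : realType) (e : R) : 0 < e ->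
  exists n0, forall n, (n0 <= n)%N -> n.+1%:R^-1 < e.
Proof.
move=> e0; exists (Num.bound e^-1) => n n0n.
rewrite invf_plt ?posrE //; apply: lt_le_trans (archi_boundP _) _.
  by rewrite invr_ge0 ltW.
by rewrite ler_nat ltnW.
Qed.

Section CStarNorm.
Variables (R : realType) (A : cstarAlgType R).
Implicit Types (a b c d : A).
Local Notation "x %:C" := (real_complex R x).

Lemma rnormE a : @Num.norm (complex R) A a = (rnorm a)%:C.
Proof. by rewrite /rnorm RRe_real // normr_real. Qed.

Lemma rnorm_ge0 a : 0 <= rnorm a.
Proof. by have := normr_ge0 a; rewrite rnormE ler0c. Qed.

Lemma rnormD a b : rnorm (a + b) <= rnorm a + rnorm b.
Proof. by have := ler_normD a b; rewrite !rnormE -rmorphD lecR. Qed.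

Lemma rnormN a : rnorm (- a) = rnorm a.
Proof. by rewrite /rnorm normrN. Qed.

Lemma rnorm0 : rnorm (0 : A) = 0.
Proof. by rewrite /rnorm normr0. Qed.

Lemma rnormBC a b : rnorm (a - b) = rnorm (b - a).
Proof. by rewrite /rnorm distrC. Qed.

Lemma rnormBB a b c : rnorm (a - c) <= rnorm (a - b) + rnorm (b - c).
Proof. by apply: le_trans (rnormD _ _); rewrite addrA subrK. Qed.

Lemma rnorm_le_dist a b : rnorm a <= rnorm b + rnorm (a - b).
Proof. by apply: le_trans (rnormD _ _); rewrite addrC subrK. Qed.

Lemma rnormZ (z : complex R) a : rnorm (z *: a) = cn z * rnorm a.
Proof. by apply: (@complexI R); rewrite rmorphM /= -rnormE -cnE -rnormE normrZ. Qed.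

Lemma rnorm_eq0 a : rnorm a = 0 -> a = 0.
Proof. by move=> a0; apply/eqP; rewrite -normr_eq0 rnormE a0. Qed.

Lemma rnormM a b : rnorm (cmul a b) <= rnorm a * rnorm b.
Proof. by have := norm_cmul_le a b; rewrite !rnormE -rmorphM lecR. Qed.

Lemma rnorm_cstar_mul a : rnorm (cmul (cstar a) a) = rnorm a ^+ 2.
Proof.
by apply: (@complexI R); rewrite -rnormE norm_cstar_mul rnormE rmorphXn.
Qed.

Lemma rnorm_cstar a : rnorm (cstar a) = rnorm a.
Proof.
suff h b : rnorm b <= rnorm (cstar b).
  by apply/eqP; rewrite eq_le h -{2}[a]cstarK h.
have := rnormM (cstar b) b; rewrite rnorm_cstar_mul expr2.
have [->|] := eqVneq (rnorm b) 0; first by rewrite rnorm_ge0.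
rewrite neq_lt ltNge rnorm_ge0 /= => b0; by rewrite ler_pM2r.
Qed.

Lemma cmul0r a : cmul a 0 = 0.
Proof. by rewrite -(scale0r (0 : A)) cmulZr !scale0r. Qed.

Lemma cmul0l a : cmul 0 a = 0.
Proof. by rewrite -(scale0r (0 : A)) cmulZl !scale0r. Qed.

Lemma cmulNr a b : cmul a (- b) = - cmul a b.
Proof. by rewrite -scaleN1r cmulZr scaleN1r. Qed.

Lemma cmulNl a b : cmul (- a) b = - cmul a b.
Proof. by rewrite -scaleN1r cmulZl scaleN1r. Qed.

Lemma cmulBr a b c : cmul a (b - c) = cmul a b - cmul a c.
Proof. by rewrite cmulDr cmulNr. Qed.

Lemma cmulBl a b c : cmul (a - b) c = cmul a c - cmul b c.
Proof. by rewrite cmulDl cmulNl. Qed.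

Lemma cstar0 : cstar 0 = 0 :> A.
Proof. by rewrite -(scale0r (0 : A)) cstarZ conjC0 !scale0r. Qed.

Lemma cstarN a : cstar (- a) = - cstar a.
Proof. by rewrite -scaleN1r cstarZ rmorphN1 scaleN1r. Qed.

Lemma cstarB a b : cstar (a - b) = cstar a - cstar b.
Proof. by rewrite cstarD cstarN. Qed.

Lemma cstar_mul_eq0 a : cmul (cstar a) a = 0 -> a = 0.
Proof.
move=> a0; apply: rnorm_eq0; apply/eqP.
by rewrite -sqrf_eq0 -rnorm_cstar_mul a0 rnorm0.
Qed.

(** The test element c = (a - b)^* and the C*-identity suffice. This is how identities between
    multipliers are checked without a unit. *)
Lemma cmul_nondeg a b : (forall c, cmul c a = cmul c b) -> a = b.
Proof.
move=> ab; apply/eqP; rewrite -subr_eq0; apply/eqP/cstar_mul_eq0.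
by rewrite cmulBr ab subrr.
Qed.

Lemma rnorm_ballE a b (e : R) : ball a (e%:C) b <-> rnorm (a - b) < e.
Proof. by rewrite -ball_normE /ball_ /= rnormE ltcR. Qed.

Lemma rnorm_nbhs a (U : set A) : nbhs a U <->
  exists2 e : R, 0 < e & forall b, rnorm (b - a) < e -> U b.
Proof.
split=> [/nbhs_ballP[e /= /cplx_gt0[r r0 ->] rU]|[e e0 eU]].
  by exists r => // b br; apply: rU; apply/rnorm_ballE; rewrite rnormBC.
apply/nbhs_ballP; exists (e%:C) => /=; first by rewrite ltcR.
by move=> b /rnorm_ballE; rewrite rnormBC; apply: eU.
Qed.

Lemma rnorm_closed (S : set A) : closed S <->
  forall a, (forall e : R, 0 < e -> exists2 s, S s & rnorm (s - a) < e) -> S a.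
Proof.
split=> [cS a aS|h a aS]; [apply: cS => U /rnorm_nbhs[e e0 eU]|apply: h => e e0].
  by have [s Ss sa] := aS _ e0; exists s; split=> //; exact: eU.
have [] := aS [set b | rnorm (b - a) < e].
  by apply/rnorm_nbhs; exists e.
by move=> s [Ss sa]; exists s.
Qed.

Lemma rnorm_dense (D : set A) :
  (forall a (e : R), 0 < e -> exists2 s, D s & rnorm (s - a) < e) -> dense D.
Proof.
move=> h O [a Oa] oO; have [e e0 eO] : exists2 e : R, 0 < e &
    forall b, rnorm (b - a) < e -> O b.
  by apply/rnorm_nbhs; apply: open_nbhs_nbhs.
by have [s Ds sa] := h a e e0; exists s; split => //; apply: eO.
Qed.

End CStarNorm.

(** * Convergence of sequences in the real-valued norm *)

Section Limits.
Variables (R : realType).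

Definition rcvg (A : cstarAlgType R) (u : nat -> A) (a : A) :=
  forall e : R, 0 < e -> exists n0, forall n, (n0 <= n)%N -> rnorm (u n - a) < e.

Variable A : cstarAlgType R.
Implicit Types (u v : nat -> A) (a b : A).

Lemma rcvg_uniq u a b : rcvg u a -> rcvg u b -> a = b.
Proof.
move=> ua ub; apply/eqP; rewrite -subr_eq0; apply/eqP/rnorm_eq0/eqP.
rewrite eq_le rnorm_ge0 andbT; apply/ler_addgt0Pr => e e0; rewrite add0r.
have e2 : 0 < e / 2 by rewrite divr_gt0.
have [n1 h1] := ua _ e2; have [n2 h2] := ub _ e2.
set n := maxn n1 n2; apply: le_trans (rnormBB _ (u n) _) _.
rewrite rnormBC [leRHS]splitr; apply/ltW/ltrD; [apply: h1|apply: h2];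
  by rewrite ?leq_maxl ?leq_maxr.
Qed.

Lemma rcvg_cst a : rcvg (fun=> a) a.
Proof. by move=> e e0; exists 0%N => n _; rewrite subrr rnorm0. Qed.

Lemma rcvg_le u a (f : nat -> R) : (forall n, rnorm (u n - a) <= f n) ->
  (forall e : R, 0 < e -> exists n0, forall n, (n0 <= n)%N -> f n < e) -> rcvg u a.
Proof.
move=> uf f0 e /f0[n0 h]; exists n0 => n /h; apply: le_lt_trans (uf n).
Qed.

Lemma rcvgD u v a b : rcvg u a -> rcvg v b -> rcvg (fun n => u n + v n) (a + b).
Proof.
move=> ua vb e e0; have e2 : 0 < e / 2 by rewrite divr_gt0.
have [n1 h1] := ua _ e2; have [n2 h2] := vb _ e2.
exists (maxn n1 n2) => n; rewrite geq_max => /andP[/h1 k1 /h2 k2].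
rewrite opprD addrACA; apply: le_lt_trans (rnormD _ _) _.
by rewrite [ltRHS]splitr ltrD.
Qed.

Lemma rcvg_lip (B : cstarAlgType R) (f : A -> B) u a (C : R) :
  (forall x y, f (x - y) = f x - f y) -> (forall x, rnorm (f x) <= C * rnorm x) ->
  rcvg u a -> rcvg (fun n => f (u n)) (f a).
Proof.
move=> fB fC ua e e0; have C1 : 0 < `|C| + 1 by rewrite ltr_wpDl.
have [|n0 h] := ua (e / (`|C| + 1)); first by rewrite divr_gt0.
exists n0 => n /h; rewrite ltr_pdivlMr // => hn; rewrite -fB.
apply: le_lt_trans hn; apply: le_trans (fC _) _.
rewrite mulrC ler_wpM2l ?rnorm_ge0 //; apply: le_trans (ler_norm _) _.
by rewrite lerDl.
Qed.

Lemma rcvg_cauchy u : (forall e : R, 0 < e -> exists n0, forall n m,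
    (n0 <= n)%N -> (n0 <= m)%N -> rnorm (u n - u m) < e) -> exists a, rcvg u a.
Proof.
move=> cu.
have : cauchy (u @ \oo).
  apply/cauchy_ballP => e /= /cplx_gt0[r r0 ->].
  have [n0 hn0] := cu _ r0.
  rewrite /= near_map2 /=; exists ([set n | (n0 <= n)%N], [set n | (n0 <= n)%N]).
    by split; exists n0.
  by move=> [n m] /= [n0n n0m]; apply/rnorm_ballE/hn0.
move/cauchy_cvg => cvu; exists (lim (u @ \oo)) => e e0.
have /(_ [set b | rnorm (b - lim (u @ \oo)) < e]) := cvu.
case; first by apply/rnorm_nbhs; exists e.
by move=> n0 _ h; exists n0 => n n0n; apply: h.
Qed.

Lemma rcvg_geometric u (t K : R) : 0 <= t -> t < 1 -> 0 <= K ->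
  (forall n, rnorm (u n.+1 - u n) <= K * t ^+ n) -> exists a, rcvg u a.
Proof.
move=> t0 t1 K0 uK; have t1' : 0 < 1 - t by rewrite subr_gt0.
(* Multiplying by 1 - t avoids quotients; the induction carries the exact factor 1 - t^k of the
   finite geometric sum. *)
have dist n k : rnorm (u (n + k)%N - u n) * (1 - t) <= K * t ^+ n.
  have : rnorm (u (n + k)%N - u n) * (1 - t) <= K * t ^+ n * (1 - t ^+ k).
    elim: k => [|k IH]; first by rewrite addn0 !subrr rnorm0 mul0r mulr0.
    rewrite addnS; apply: le_trans (ler_wpM2r (ltW t1') (rnormBB _ (u (n + k)%N) _)) _.
    rewrite mulrDl; apply: le_trans (lerD (ler_wpM2r (ltW t1') (uK _)) IH) _.
    by rewrite exprD exprS le_eqVlt; apply/orP; left; apply/eqP; ring.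
  move=> /le_trans; apply; rewrite -[leRHS]mulr1 ler_wpM2l ?mulr_ge0 ?exprn_ge0 //.
  by rewrite lerBlDr lerDl exprn_ge0.
apply: rcvg_cauchy => e e0.
have K1 : 0 < K + 1 by rewrite ltr_wpDl.
have e1 : 0 < e / 2 * (1 - t) / (K + 1) by rewrite !(divr_gt0, mulr_gt0).
have [n0 hn] : exists n0, t ^+ n0 < e / 2 * (1 - t) / (K + 1).
  have tl : `|t| < 1 by rewrite ger0_norm.
  have /cvgrPdist_lt := cvg_expr tl.
  move=> /(_ _ e1)[n0 _ /(_ n0 (leqnn _))] /=.
  by rewrite sub0r normrN ger0_norm ?exprn_ge0 // => ?; exists n0.
have small k : rnorm (u (n0 + k)%N - u n0) < e / 2.
  rewrite -(ltr_pM2r t1'); apply: le_lt_trans (dist n0 k) _.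
  move: hn; rewrite ltr_pdivlMr // mulrC; apply: le_lt_trans.
  by rewrite ler_wpM2r ?exprn_ge0 // lerDl.
exists n0 => n m /subnKC <- /subnKC <-.
apply: le_lt_trans (rnormBB _ (u n0) _) _; rewrite [ltRHS]splitr.
by apply: ltrD; [exact: small|rewrite rnormBC; exact: small].
Qed.

Lemma rcvgM u v a b :
  rcvg u a -> rcvg v b -> rcvg (fun n => cmul (u n) (v n)) (cmul a b).
Proof.
move=> ua vb e e0.
pose C := rnorm a + rnorm b + 1.
have C1 : 0 < C by rewrite ltr_wpDl // addr_ge0 ?rnorm_ge0.
pose d := Num.min 1 (e / (C * 2)).
have d0 : 0 < d by rewrite lt_min ltr01 divr_gt0 // mulr_gt0.
have [n1 h1] := ua _ d0; have [n2 h2] := vb _ d0.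
exists (maxn n1 n2) => n; rewrite geq_max => /andP[/h1 k1 /h2 k2].
rewrite -[cmul (u n) (v n)](subrK (cmul (u n) b)) -addrA -cmulBr -cmulBl.
apply: le_lt_trans (rnormD _ _) _.
have un : rnorm (u n) <= C.
  apply: le_trans (rnorm_le_dist _ a) _.
  rewrite /C -addrA lerD2l ler_wpDl ?rnorm_ge0 //; apply: le_trans (ltW k1) _.
  by rewrite ge_min lexx.
have bC : rnorm b <= C by rewrite /C -addrA addrCA lerDl addr_ge0 ?rnorm_ge0.
have dC : d * C <= e / 2.
  apply: le_trans (_ : e / (C * 2) * C <= _).
    by rewrite ler_pM2r // ge_min lexx orbT.
  rewrite invfM mulrA mulrAC mulfVK //; by apply: lt0r_neq0.
rewrite [ltRHS]splitr; apply: ler_ltD.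
  apply: le_trans (rnormM _ _) _; apply: le_trans dC; rewrite [leRHS]mulrC.
  by apply: ler_pM; rewrite ?rnorm_ge0 // ltW.
apply: le_lt_trans (rnormM _ _) _; apply: lt_le_trans dC.
have [b0|b0] := eqVneq (rnorm b) 0; first by rewrite b0 mulr0 mulr_gt0.
apply: (@lt_le_trans _ _ (d * rnorm b)); last by rewrite ler_pM2l.
by rewrite ltr_pM2r // lt_neqAle eq_sym b0 rnorm_ge0.
Qed.

Lemma rcvg_cstar u a : rcvg u a -> rcvg (fun n => cstar (u n)) (cstar a).
Proof.
by move=> ua e /ua[n0 h]; exists n0 => n /h; rewrite -cstarB rnorm_cstar.
Qed.

Lemma rcvgZ (z : complex R) u a : rcvg u a -> rcvg (fun n => z *: u n) (z *: a).
Proof.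
apply: (@rcvg_lip _ _ _ _ (cn z)) => [x y|x]; first by rewrite scalerBr.
by rewrite rnormZ.
Qed.

End Limits.

(** * Contractivity of *-homomorphisms *)

Section Contraction.
Variable R : realType.

(* x = (u + u^* ) / 2 where u = x + i (1 - y) acts isometrically by left
   multiplication. *)
Lemma rnorm_cosine_le1 (A : cstarAlgType R) (x y : A) :
  cstar x = x -> cstar y = y -> cmul x y = cmul y x ->
  cmul x x + cmul y y = y + y -> rnorm x <= 1.
Proof.
move=> xs ys xy e1.
(* In the expansion of u^* u for u = x + s (1 - y) the cross terms cancel because conj s = - s, and
   what remains is x^2 + (1 - y)^2 = 1. The unit is only formal, so u is applied to an element b. *)
have iso (s : complex R) b : Num.conj s = - s -> Num.conj s * s = 1 ->
    rnorm (cmul x b + s *: (b - cmul y b)) = rnorm b.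
  move=> sN s1; apply/eqP; rewrite -(@eqrXn2 _ 2) ?rnorm_ge0 //.
  rewrite -!rnorm_cstar_mul; apply/eqP; congr rnorm.
  set P := cmul x b; set Q := b - cmul y b.
  have PQ : cmul (cstar P) Q = cmul (cstar Q) P.
    rewrite /P /Q cstarB !cstarM xs ys cmulBl cmulBr -!cmulA.
    by rewrite (cmulA x y) xy -cmulA.
  rewrite cstarD cstarZ !cmulDl !cmulDr !cmulZl !cmulZr sN PQ addrA scaleNr.
  rewrite addrK scalerA -sN s1 scale1r.
  pose g z := cmul (cstar b) (cmul z b).
  have -> : cmul (cstar P) P = g (cmul x x).
    by rewrite /P /g cstarM xs -!cmulA.
  have -> : cmul x x = y + y - cmul y y by rewrite -e1 addrK.
  have -> : cmul (cstar Q) Q =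
      cmul (cstar b) b - g y + (g (cmul y y) - g y).
    by rewrite /Q /g cstarB cstarM ys cmulBl !cmulBr -!cmulA opprB.
  have -> : g (y + y - cmul y y) = g y + (g y - g (cmul y y)).
    by rewrite /g cmulBl cmulDl cmulBr cmulDr addrA.
  move: (g (cmul y y)) (g y) (cmul _ b) => q p t.
  by rewrite addrACA [p + (t - p)]addrC subrK -[q - p]opprB subrr addr0.
have i1 : Num.conj ('i : complex R) = - 'i by rewrite conjCi.
have i2 : Num.conj ('i : complex R) * 'i = 1 by rewrite i1 mulNr -expr2 sqrCi opprK.
have h1 := iso _ x i1 i2.
have h2 : rnorm (cmul x x + - 'i *: (x - cmul y x)) = rnorm x.
  by apply: iso; rewrite rmorphN /= i1 ?opprK // mulrN -expr2 sqrCi opprK.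
(* The two vectors obtained from s = i and s = - i with b = x have norm that of x and add up to 2
   x^2. The C*-identity then turns the bound into |x|^2 <= |x|. *)
have h : rnorm (cmul x x) <= rnorm x.
  have := rnormD (cmul x x + 'i *: (x - cmul y x)) (cmul x x + - 'i *: (x - cmul y x)).
  rewrite h1 h2 addrACA scaleNr subrr addr0.
  by rewrite -mulr2n -scaler_nat rnormZ cn_nat -mulr2n -[leRHS]mulr_natl ler_pM2l.
rewrite -{1}xs rnorm_cstar_mul expr2 in h.
have [->|x0] := eqVneq (rnorm x) 0; first exact: ler01.
by rewrite -(@ler_pM2l _ (rnorm x)) ?mulr1 // lt_neqAle eq_sym x0 rnorm_ge0.
Qed.

(* If ||x|| < 1, the contraction y |-> (x^2 + y^2) / 2 has a fixed point, which
   plays the role of 1 - sqrt (1 - x^2). *)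
Lemma cosine_companion (A : cstarAlgType R) (x : A) :
  cstar x = x -> rnorm x < 1 -> exists y : A,
    [/\ cstar y = y, cmul x y = cmul y x & cmul x x + cmul y y = y + y].
Proof.
move=> xs x1; set t := rnorm x in x1 *.
have t0 : 0 <= t by exact: rnorm_ge0.
pose h : complex R := 2^-1.
have cnh : cn h = 2^-1.
  have h2 : h * 2%:R = 1 by rewrite mulVf ?pnatr_eq0.
  have := congr1 (@cn R) h2; rewrite cnM cn1 cn_nat => e.
  by lra.
have conjh : Num.conj h = h by rewrite /h rmorphV ?unitfE ?pnatr_eq0 // rmorph_nat.
pose y := fix y n : A := if n is n'.+1 then h *: (cmul x x + cmul (y n') (y n')) else 0.
have yS n : y n.+1 = h *: (cmul x x + cmul (y n) (y n)) by [].
have yle n : rnorm (y n) <= t.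
  elim: n => [|n IH]; first by rewrite rnorm0.
  rewrite yS rnormZ cnh ler_pdivrMl // mulr2n mulrDl !mul1r.
  apply: le_trans (rnormD _ _) _; apply: lerD; apply: le_trans (rnormM _ _) _.
    by rewrite -[leRHS]mulr1 ler_wpM2l // ltW.
  rewrite -[leRHS]mulr1; apply: ler_pM; rewrite ?rnorm_ge0 //.
  exact: le_trans IH (ltW x1).
(* Iterates stay in the ball of radius t, where squaring is 2t-Lipschitz; the factor 1/2 makes the
   iteration t-Lipschitz. *)
have ystep n : rnorm (y n.+2 - y n.+1) <= t * rnorm (y n.+1 - y n).
  rewrite [y n.+2]yS [y n.+1 in X in rnorm (_ - X)]yS -scalerBr rnormZ cnh.
  rewrite ler_pdivrMl // opprD addrACA subrr add0r.
  have -> : cmul (y n.+1) (y n.+1) - cmul (y n) (y n) =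
      cmul (y n.+1) (y n.+1 - y n) + cmul (y n.+1 - y n) (y n).
    by rewrite cmulBr cmulBl addrA subrK.
  apply: le_trans (rnormD _ _) _; rewrite mulr2n mulrDl mul1r.
  apply: lerD; apply: le_trans (rnormM _ _) _; first by rewrite ler_wpM2r ?rnorm_ge0.
  by rewrite mulrC ler_wpM2r ?rnorm_ge0.
have ygeo n : rnorm (y n.+1 - y n) <= t ^+ n.
  elim: n => [|n IH].
    by rewrite expr0 subr0; apply: le_trans (yle 1%N) (ltW x1).
  by apply: le_trans (ystep n) _; rewrite exprS ler_wpM2l.
have [z yz] : exists z, rcvg y z.
  by apply: (rcvg_geometric t0 x1 ler01) => n; rewrite mul1r.
have yz2 := rcvgZ h (rcvgD (rcvg_cst (cmul x x)) (rcvgM yz yz)).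
have yzS : rcvg (fun n => y n.+1) z.
  by move=> e /yz[n0 hn]; exists n0 => n n0n; apply: hn; apply: leq_trans n0n _.
have ze : z = h *: (cmul x x + cmul z z) := rcvg_uniq yzS yz2.
(* Self-adjointness and commutation with x hold for every iterate, by induction from 0, and pass to
   the limit. *)
exists z; split.
- apply: (rcvg_uniq (rcvg_cstar yz)) => e /yz[n0 hn]; exists n0 => n /hn.
  suff -> : cstar (y n) = y n by [].
  elim: n {hn} => [|n IH]; first exact: cstar0.
  by rewrite yS cstarZ conjh cstarD !cstarM xs IH.
- apply: (rcvg_uniq (rcvgM (rcvg_cst x) yz)) => e e0.
  have [n0 hn] := rcvgM yz (rcvg_cst x) e0; exists n0 => n /hn.
  suff -> : cmul x (y n) = cmul (y n) x by [].
  elim: n {hn} => [|n IH]; first by rewrite cmul0l cmul0r.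
  by rewrite yS cmulZr cmulZl cmulDr cmulDl -(cmulA x x x)
    -(cmulA (y n) (y n) x) -IH (cmulA (y n) x) -IH -cmulA.
- rewrite -mulr2n -scaler_nat [in RHS]ze scalerA mulfV ?pnatr_eq0 //.
  by rewrite scale1r.
Qed.

(** [psi] carries the pair of x and its companion to a pair satisfying the same relations, so the
    image of a self-adjoint element of norm below 1 has norm at most 1. Scaling covers self-adjoint
    elements, and the C*-identity reduces the general case to a^* a. *)
Lemma star_hom_contraction (A B : cstarAlgType R) (psi : A -> B) :
  star_hom [set: A] (@cmul R A) (@cstar R A) (@cmul R B) (@cstar R B) psi ->
  forall a, rnorm (psi a) <= rnorm a.
Proof.
move=> [psiL psiM psiS].
have psiD a b : psi (a + b) = psi a + psi b.
  by have := psiL 1 a b I I; rewrite !scale1r.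
have psi0 : psi 0 = 0 by apply: (@addrI _ (psi 0)); rewrite -psiD !addr0.
have psiZ c a : psi (c *: a) = c *: psi a.
  by have := psiL c a 0 I I; rewrite psi0 !addr0.
have sa1 x : cstar x = x -> rnorm x < 1 -> rnorm (psi x) <= 1.
  move=> xs x1; have [y [ys xy e]] := cosine_companion xs x1.
  apply: (@rnorm_cosine_le1 _ (psi x) (psi y)).
  - by rewrite -psiS // xs.
  - by rewrite -psiS // ys.
  - by rewrite -!psiM // xy.
  - by rewrite -!psiM // -!psiD e.
have sa x : cstar x = x -> rnorm (psi x) <= rnorm x.
  move=> xs; apply/ler_addgt0Pr => e e0.
  set c := rnorm x + e; have c0 : 0 < c by rewrite ltr_wpDl ?rnorm_ge0.
  have cnc : cn (real_complex R c^-1) = c^-1.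
    by rewrite cn_real ger0_norm // invr_ge0 ltW.
  have := sa1 (real_complex R c^-1 *: x).
  rewrite cstarZ xs psiZ !rnormZ cnc ler_pdivrMl // ltr_pdivrMl // !mulr1.
  by apply; [rewrite conj_Creal // complex_real | rewrite ltrDl].
move=> a; rewrite -(@ler_pXn2r _ 2) ?nnegrE ?rnorm_ge0 // -!rnorm_cstar_mul.
by rewrite -psiS // -psiM // sa // cstarM cstarK.
Qed.
End Contraction.

(** * The C*-completion of a *-algebra with a C*-seminorm *)

Section SeminormedStarAlgebra.
Variable R : realType.

(** All laws are relative to [S] because [xalg] is a subset of a function space on which the
    operations misbehave elsewhere. Only one inequality of the C*-identity is required; the other
    follows from submultiplicativity in [ssN_cstar]. *)
Record cstar_seminorm (V : lmodType (complex R)) (S : set V) (mul : V -> V -> V)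
    (star : V -> V) (N : V -> R) : Prop := CStarSeminorm {
  css_S0 : S 0;
  css_Slin : forall (c : complex R) a b, S a -> S b -> S (c *: a + b);
  css_Smul : forall a b, S a -> S b -> S (mul a b);
  css_Sstar : forall a, S a -> S (star a);
  css_mulA : forall a b c, S a -> S b -> S c -> mul a (mul b c) = mul (mul a b) c;
  css_mulDl : forall (k : complex R) a b c, S a -> S b -> S c ->
    mul (k *: a + b) c = k *: mul a c + mul b c;
  css_mulDr : forall (k : complex R) a b c, S a -> S b -> S c ->
    mul c (k *: a + b) = k *: mul c a + mul c b;
  css_starD : forall (k : complex R) a b, S a -> S b ->
    star (k *: a + b) = Num.conj k *: star a + star b;
  css_starM : forall a b, S a -> S b -> star (mul a b) = mul (star b) (star a);
  css_starK : forall a, S a -> star (star a) = a;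
  css_ge0 : forall a, S a -> 0 <= N a;
  css_D : forall a b, S a -> S b -> N (a + b) <= N a + N b;
  css_Z : forall (k : complex R) a, S a -> N (k *: a) = cn k * N a;
  css_M : forall a b, S a -> S b -> N (mul a b) <= N a * N b;
  css_C : forall a, S a -> N a ^+ 2 <= N (mul (star a) a) }.

(** Bundling lets the completion, as a type with canonical instances, depend on a single
    parameter. *)
Structure ssAlg := SsAlg {
  ssV : lmodType (complex R);
  ssS : set ssV;
  ssmul : ssV -> ssV -> ssV;
  ssstar : ssV -> ssV;
  ssN : ssV -> R;
  ssP : cstar_seminorm ssS ssmul ssstar ssN }.
End SeminormedStarAlgebra.

Section SsTheory.
Variables (R : realType) (X : ssAlg R).
Local Notation V := (ssV X).
Local Notation S := (@ssS R X).
Local Notation mul := (@ssmul R X).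
Local Notation star := (@ssstar R X).
Local Notation N := (@ssN R X).
Implicit Types a b c : V.

Lemma ssZ (k : complex R) a : S a -> S (k *: a).
Proof. by move=> Sa; rewrite -[_ *: _]addr0; apply: css_Slin (ssP X) _ _ _ _ (css_S0 (ssP X)). Qed.

Lemma ssD a b : S a -> S b -> S (a + b).
Proof. by move=> Sa Sb; rewrite -[a]scale1r; apply: css_Slin (ssP X) _ _ _ _ _. Qed.

Lemma ssNeg a : S a -> S (- a).
Proof. by move=> Sa; rewrite -scaleN1r; apply: ssZ. Qed.

Lemma ssB a b : S a -> S b -> S (a - b).
Proof. by move=> Sa Sb; apply: ssD => //; apply: ssNeg. Qed.

Lemma ssM a b : S a -> S b -> S (mul a b).
Proof. exact: css_Smul (ssP X) _ _. Qed.

Lemma ssSt a : S a -> S (star a).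
Proof. exact: css_Sstar (ssP X) _. Qed.

Lemma ss0 : S 0. Proof. exact: css_S0 (ssP X). Qed.

Lemma ssN0 : N 0 = 0.
Proof. by rewrite -(scale0r (0 : V)) (css_Z (ssP X)) ?cn0 ?mul0r //; apply: ss0. Qed.

Lemma ssN_ge0 a : S a -> 0 <= N a. Proof. exact: css_ge0 (ssP X) _. Qed.

Lemma ssNN a : S a -> N (- a) = N a.
Proof. by move=> Sa; rewrite -scaleN1r (css_Z (ssP X)) // cnN cn1 mul1r. Qed.

Lemma ssNBC a b : S a -> S b -> N (a - b) = N (b - a).
Proof. by move=> Sa Sb; rewrite -opprB ssNN //; apply: ssB. Qed.

Lemma ssNBB a b c : S a -> S b -> S c -> N (a - c) <= N (a - b) + N (b - c).
Proof.
move=> Sa Sb Sc; have -> : a - c = (a - b) + (b - c) by rewrite addrA subrK.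
by apply: css_D (ssP X) _ _ _ _; apply: ssB.
Qed.

Lemma ssN_dist a b : S a -> S b -> `|N a - N b| <= N (a - b).
Proof.
move=> Sa Sb; have h1 := ssNBB Sb Sa ss0; have h2 := ssNBB Sa Sb ss0.
rewrite (ssNBC Sb Sa) !subr0 in h1 h2.
by rewrite ler_norml lerNl opprB lerBlDr lerBlDr; apply/andP.
Qed.

Lemma ss_mul0l a : S a -> mul 0 a = 0.
Proof.
move=> Sa; have := css_mulDl (ssP X) (-1) (ssM Sa Sa) (ssM Sa Sa) Sa.
have := css_mulDl (ssP X) (-1) ss0 ss0 Sa.
by rewrite scaleN1r addr0 oppr0 scaleN1r addNr.
Qed.

Lemma ss_mul0r a : S a -> mul a 0 = 0.
Proof.
move=> Sa; have := css_mulDr (ssP X) (-1) ss0 ss0 Sa.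
by rewrite scaleN1r addr0 oppr0 scaleN1r addNr.
Qed.

Lemma ss_mulD1l a b c : S a -> S b -> S c -> mul (a + b) c = mul a c + mul b c.
Proof. by move=> *; rewrite -[a]scale1r (css_mulDl (ssP X)) // !scale1r. Qed.

Lemma ss_mulD1r a b c : S a -> S b -> S c -> mul c (a + b) = mul c a + mul c b.
Proof. by move=> *; rewrite -[a]scale1r (css_mulDr (ssP X)) // !scale1r. Qed.

Lemma ss_mulZl k a c : S a -> S c -> mul (k *: a) c = k *: mul a c.
Proof.
by move=> *; rewrite -[_ *: a]addr0 (css_mulDl (ssP X)) // ?ss_mul0l ?addr0 //;
  apply: ss0.
Qed.

Lemma ss_mulZr k a c : S a -> S c -> mul c (k *: a) = k *: mul c a.
Proof.
by move=> *; rewrite -[_ *: a]addr0 (css_mulDr (ssP X)) // ?ss_mul0r ?addr0 //;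
  apply: ss0.
Qed.

Lemma ss_mulBl a b c : S a -> S b -> S c -> mul (a - b) c = mul a c - mul b c.
Proof.
move=> Sa Sb Sc; rewrite ss_mulD1l //; last exact: ssNeg.
by rewrite -scaleN1r ss_mulZl // scaleN1r.
Qed.

Lemma ss_mulBr a b c : S a -> S b -> S c -> mul c (a - b) = mul c a - mul c b.
Proof.
move=> Sa Sb Sc; rewrite ss_mulD1r //; last exact: ssNeg.
by rewrite -scaleN1r ss_mulZr // scaleN1r.
Qed.

Lemma ss_starD1 a b : S a -> S b -> star (a + b) = star a + star b.
Proof. by move=> *; rewrite -[a]scale1r (css_starD (ssP X)) // conjC1 !scale1r. Qed.

Lemma ss_star0 : star 0 = 0.
Proof.
have := css_starD (ssP X) (-1) ss0 ss0.
by rewrite scaleN1r addr0 oppr0 rmorphN1 scaleN1r addNr.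
Qed.

Lemma ss_starZ k a : S a -> star (k *: a) = Num.conj k *: star a.
Proof.
by move=> Sa; rewrite -[_ *: a]addr0 (css_starD (ssP X)) // ?ss_star0 ?addr0 //;
  apply: ss0.
Qed.

Lemma ss_starB a b : S a -> S b -> star (a - b) = star a - star b.
Proof.
move=> Sa Sb; rewrite ss_starD1 //; last exact: ssNeg.
by rewrite -scaleN1r ss_starZ // rmorphN1 scaleN1r.
Qed.

Lemma ssN_star a : S a -> N (star a) = N a.
Proof.
suff h b : S b -> N b <= N (star b).
  move=> Sa; apply/eqP; rewrite eq_le h // andbT.
  by rewrite -{2}[a](css_starK (ssP X)) // h //; apply: ssSt.
move=> Sb; have := le_trans (css_C (ssP X) Sb) (css_M (ssP X) (ssSt Sb) Sb).
rewrite expr2; have [->|b0] := eqVneq (N b) 0.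
  by rewrite ssN_ge0 //; apply: ssSt.
by rewrite ler_pM2r // lt_neqAle eq_sym b0 ssN_ge0.
Qed.

Lemma ssN_cstar a : S a -> N (mul (star a) a) = N a ^+ 2.
Proof.
move=> Sa; apply/eqP; rewrite eq_le (css_C (ssP X)) // andbT.
by rewrite expr2 -{1}(ssN_star Sa); exact: (css_M (ssP X) (ssSt Sa) Sa).
Qed.
End SsTheory.

Section Completion.
Variables (R : realType) (X : ssAlg R).
Local Notation V := (ssV X).
Local Notation S := (@ssS R X).
Local Notation mul := (@ssmul R X).
Local Notation star := (@ssstar R X).
Local Notation N := (@ssN R X).
Local Notation "x %:C" := (real_complex R x).
Local Open Scope quotient_scope.

Definition ss_cauchy : {pred nat -> V} := fun u =>
  `[< (forall n, S (u n)) /\ forall e : R, 0 < e -> exists n0, forall n m,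
      (n0 <= n)%N -> (n0 <= m)%N -> N (u n - u m) < e >].

Lemma ss_cauchy_submod : submod_closed ss_cauchy.
Proof.
split; first by apply/asboolP; split=> [n|e e0]; [exact: ss0|
  exists 0%N => n m _ _; rewrite subr0 ssN0].
move=> k u v /asboolP[Su cu] /asboolP[Sv cv]; apply/asboolP; split=> [n|e e0].
  by apply: css_Slin (ssP X) _ _ _ _ _.
have k0 : 0 < cn k + 1 by rewrite ltr_wpDl ?cn_ge0.
have [|n1 h1] := cu (e / 2 / (cn k + 1)); first by rewrite !divr_gt0.
have [|n2 h2] := cv (e / 2); first by rewrite divr_gt0.
exists (maxn n1 n2) => n m; rewrite !geq_max => /andP[n1n n2n] /andP[n1m n2m].
have -> : (k *: u + v) n - (k *: u + v) m = k *: (u n - u m) + (v n - v m).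
  by rewrite scalerBr addrACA -opprD.
apply: le_lt_trans (css_D (ssP X) _ _) _; [exact/ssZ/ssB|exact: ssB|].
rewrite (css_Z (ssP X)); last exact: ssB.
rewrite [ltRHS]splitr; apply: ler_ltD; last exact: h2.
have := h1 n m n1n n1m; rewrite ltr_pdivlMr // => /ltW; apply: le_trans.
by rewrite mulrC ler_wpM2l ?lerDl //; apply/ssN_ge0/ssB.
Qed.

HB.instance Definition _ := GRing.isSubmodClosed.Build (complex R) (nat -> V)
  ss_cauchy ss_cauchy_submod.

Record cseq := Cseq { cseq_val :> nat -> V; cseqP : cseq_val \in ss_cauchy }.
HB.instance Definition _ := [isSub for cseq_val].
HB.instance Definition _ := [Choice of cseq by <:].
HB.instance Definition _ := [SubChoice_isSubLmodule of cseq by <:].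

Lemma cseqS (u : cseq) n : S (u n).
Proof. by case: u => u /= /asboolP[]. Qed.

Lemma cseq_cauchy (u : cseq) (e : R) : 0 < e -> exists n0, forall n m,
  (n0 <= n)%N -> (n0 <= m)%N -> N (u n - u m) < e.
Proof. by case: u => u /= /asboolP[_]; apply. Qed.

Definition cseq_norm (u : cseq) : R := lim (N (u n) @[n --> \oo]).

Lemma cseq_normP (u : cseq) : N (u n) @[n --> \oo] --> cseq_norm u.
Proof.
apply: R_complete; apply/cauchy_ballP => e /= e0.
have [n0 h] := cseq_cauchy u e0.
rewrite near_map2 /=; exists ([set n | (n0 <= n)%N], [set n | (n0 <= n)%N]).
  by split; exists n0.
move=> [n m] /= [n0n n0m]; rewrite /ball /=.
by apply: le_lt_trans (h n m n0n n0m); apply: ssN_dist; apply: cseqS.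
Qed.

Arguments cseq_normP : clear implicits.

Definition null_seq : {pred cseq} := fun u => `[< cseq_norm u = 0 >].

Lemma cseq_norm_uniq (u : cseq) (r : R) : N (u n) @[n --> \oo] --> r ->
  cseq_norm u = r.
Proof. by move=> h; apply: cvg_lim h. Qed.

Lemma cseq_norm0 : cseq_norm 0 = 0.
Proof.
apply: cseq_norm_uniq; rewrite [X in X @ _](_ : _ = fun=> 0); first exact: cvg_cst.
by apply/funext => n; rewrite /= ssN0.
Qed.

Lemma cseq_norm_ge0 (u : cseq) : 0 <= cseq_norm u.
Proof.
apply: limr_ge; first by apply/cvg_ex; eexists; apply: cseq_normP.
by near=> n; apply/ssN_ge0/cseqS.
Unshelve. all: by end_near. Qed.

Lemma cseq_normD (u v : cseq) : cseq_norm (u + v) <= cseq_norm u + cseq_norm v.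
Proof.
apply: (ler_cvg_to (cseq_normP (u + v)) (cvgD (cseq_normP u) (cseq_normP v))).
by near=> n; apply: css_D (ssP X) _ _ _ _; apply: cseqS.
Unshelve. all: by end_near. Qed.

Lemma cseq_normZ k (u : cseq) : cseq_norm (k *: u) = cn k * cseq_norm u.
Proof.
apply: cseq_norm_uniq.
rewrite [X in X @ _](_ : _ = fun n => cn k * N (u n)).
  by apply: cvgM; [exact: cvg_cst|exact: cseq_normP].
by apply/funext => n; rewrite (css_Z (ssP X)) //; apply: cseqS.
Qed.

Lemma null_seq_zmod : zmod_closed null_seq.
Proof.
split=> [|u v /asboolP u0 /asboolP v0]; first exact/asboolP/cseq_norm0.
apply/asboolP/eqP; rewrite eq_le cseq_norm_ge0 andbT.
apply: le_trans (cseq_normD _ _) _.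
by rewrite -scaleN1r cseq_normZ u0 v0 mulr0 addr0.
Qed.

HB.instance Definition _ :=
  GRing.isZmodClosed.Build cseq null_seq null_seq_zmod.

(** Only the additive quotient is taken here; scaling, norm, product and star are then defined on
    representatives and shown independent of the choice. *)
Definition completion := {ideal_quot null_seq}.
HB.instance Definition _ := GRing.Zmodule.on completion.

Definition to_cpl (u : cseq) : completion := \pi_{ideal_quot null_seq} u.

Lemma to_cplE u v : to_cpl u = to_cpl v <-> cseq_norm (u - v) = 0.
Proof.
split=> [/eqP|h]; first by rewrite /to_cpl -Quotient.idealrBE => /asboolP.
by apply/eqP; rewrite /to_cpl -Quotient.idealrBE; apply/asboolP.
Qed.

Lemma to_cplD u v : to_cpl (u + v) = to_cpl u + to_cpl v.
Proof. by rewrite /to_cpl piE. Qed.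

Lemma to_cplK (p : completion) : to_cpl (repr p) = p.
Proof. exact: reprK. Qed.

Definition cpl_scale k (p : completion) : completion := to_cpl (k *: repr p).

Lemma to_cplZ k u : to_cpl (k *: u) = cpl_scale k (to_cpl u).
Proof.
apply/to_cplE; rewrite -scalerBr cseq_normZ (_ : cseq_norm _ = 0) ?mulr0 //.
by apply/to_cplE; rewrite to_cplK.
Qed.

Lemma cpl_scaleA c d p : cpl_scale c (cpl_scale d p) = cpl_scale (c * d) p.
Proof. by rewrite -[p]to_cplK -!to_cplZ scalerA. Qed.

Lemma cpl_scale1 : left_id 1 cpl_scale.
Proof. by move=> p; rewrite -[p]to_cplK -!to_cplZ scale1r. Qed.

Lemma cpl_scaleDr : right_distributive cpl_scale +%R.
Proof.
move=> c p q; rewrite -[p]to_cplK -[q]to_cplK.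
by rewrite -to_cplD -!to_cplZ scalerDr to_cplD.
Qed.

Lemma cpl_scaleDl p : {morph cpl_scale^~ p : c d / c + d}.
Proof.
by move=> c d; rewrite /= -[p]to_cplK -!to_cplZ scalerDl to_cplD.
Qed.

HB.instance Definition _ := GRing.Zmodule_isLmodule.Build (complex R) completion
  cpl_scaleA cpl_scale1 cpl_scaleDr cpl_scaleDl.

Definition cpl_norm (p : completion) : complex R := (cseq_norm (repr p))%:C.

Lemma cpl_normE u : cpl_norm (to_cpl u) = (cseq_norm u)%:C.
Proof.
rewrite /cpl_norm; congr (_%:C).
have le_norm (v w : cseq) : cseq_norm (v - w) = 0 -> cseq_norm v <= cseq_norm w.
  by move=> vw; rewrite -[v](subrK w); apply: le_trans (cseq_normD _ _) _; rewrite vw add0r.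
have e : cseq_norm (repr (to_cpl u) - u) = 0 by apply/to_cplE; rewrite to_cplK.
apply/eqP; rewrite eq_le !le_norm //.
by rewrite -opprB -scaleN1r cseq_normZ e mulr0.
Qed.

Lemma cpl_normD p q : cpl_norm (p + q) <= cpl_norm p + cpl_norm q.
Proof.
rewrite -[p]to_cplK -[q]to_cplK -to_cplD !cpl_normE -rmorphD lecR.
exact: cseq_normD.
Qed.

Lemma cpl_normZ (l : complex R) p : cpl_norm (l *: p) = `|l| * cpl_norm p.
Proof.
by rewrite -[p]to_cplK -[l *: _]to_cplZ !cpl_normE cseq_normZ cnE rmorphM.
Qed.

Lemma cpl_norm0 p : cpl_norm p = 0 -> p = 0.
Proof.
rewrite -[p]to_cplK cpl_normE => /(@complexI R) p0.
have -> : 0 = to_cpl 0 by rewrite /to_cpl piE.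
by apply/to_cplE; rewrite subr0.
Qed.

HB.instance Definition _ :=
  Lmodule_isNormed.Build (complex R) completion cpl_normD cpl_normZ cpl_norm0.

Lemma cseq_ext (u v : cseq) : (forall n, u n = v n) -> u = v.
Proof. by move=> uv; apply: val_inj; apply/funext. Qed.

Lemma cseq_bound (u : cseq) : exists C n0, 0 < C /\
  forall n, (n0 <= n)%N -> N (u n) <= C.
Proof.
have [n0 h] := cseq_cauchy u ltr01.
have C0 : 0 <= N (u n0) by apply/ssN_ge0/cseqS.
exists (N (u n0) + 1), n0; split=> [|n n0n]; first by rewrite ltr_wpDl.
have := h n n0 n0n (leqnn _); have := ssN_dist (cseqS u n) (cseqS u n0).
by rewrite ler_norml => /andP[_] /le_lt_trans /[apply]; rewrite ltrBlDl => /ltW.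
Qed.

Lemma cseq_mul_subproof (u v : cseq) : (fun n => mul (u n) (v n)) \in ss_cauchy.
Proof.
apply/asboolP; split=> [n|e e0]; first by apply: ssM; apply: cseqS.
have [C [n1 [C0 uC]]] := cseq_bound u; have [D [n2 [D0 vD]]] := cseq_bound v.
have [|n3 h3] := cseq_cauchy u (e := e / 2 / D); first by rewrite !divr_gt0.
have [|n4 h4] := cseq_cauchy v (e := e / 2 / C); first by rewrite !divr_gt0.
exists (maxn (maxn n1 n2) (maxn n3 n4)) => n m; rewrite !geq_max.
move=> /andP[/andP[n1n n2n] /andP[n3n n4n]] /andP[/andP[n1m n2m] /andP[n3m n4m]].
have Su := cseqS u; have Sv := cseqS v.
have -> : mul (u n) (v n) - mul (u m) (v m) =
    mul (u n) (v n - v m) + mul (u n - u m) (v m).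
  by rewrite ss_mulBr // ss_mulBl // addrA subrK.
apply: le_lt_trans (css_D (ssP X) _ _) _; [exact/ssM/ssB|exact/ssM/Sv/ssB|].
rewrite [ltRHS]splitr; apply: ltr_leD.
  apply: le_lt_trans (css_M (ssP X) (Su n) (ssB (Sv n) (Sv m))) _.
  have := h4 n m n4n n4m; rewrite ltr_pdivlMr // mulrC; apply: le_lt_trans.
  by rewrite ler_wpM2r ?uC //; apply/ssN_ge0/ssB.
apply: le_trans (css_M (ssP X) (ssB (Su n) (Su m)) (Sv m)) _.
have := h3 n m n3n n3m; rewrite ltr_pdivlMr // => /ltW; apply: le_trans.
by rewrite ler_wpM2l ?vD //; apply/ssN_ge0/ssB.
Qed.

Definition cseq_mul u v := Cseq (cseq_mul_subproof u v).

Lemma cseq_star_subproof (u : cseq) : (fun n => star (u n)) \in ss_cauchy.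
Proof.
have Su := cseqS u; apply/asboolP; split=> [n|e /(cseq_cauchy u)[n0 h]].
  exact: ssSt.
exists n0 => n m n0n n0m; rewrite -ss_starB // ssN_star; last exact: ssB.
exact: h.
Qed.

Definition cseq_star u := Cseq (cseq_star_subproof u).

Lemma cseq_norm_mul u v : cseq_norm (cseq_mul u v) <= cseq_norm u * cseq_norm v.
Proof.
apply: (ler_cvg_to (cseq_normP (cseq_mul u v)) (cvgM (cseq_normP u) (cseq_normP v))).
by near=> n; apply: (css_M (ssP X)); apply: cseqS.
Unshelve. all: by end_near. Qed.

Lemma cseq_norm_cstar u : cseq_norm (cseq_mul (cseq_star u) u) = cseq_norm u ^+ 2.
Proof.
apply: cseq_norm_uniq; rewrite [X in X @ _](_ : _ = fun n => N (u n) * N (u n)).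
  by apply: cvgM; exact: cseq_normP.
by apply/funext => n; rewrite -expr2 -ssN_cstar //; apply: cseqS.
Qed.

Lemma cseq_norm_star u : cseq_norm (cseq_star u) = cseq_norm u.
Proof.
apply: cseq_norm_uniq; rewrite [X in X @ _](_ : _ = fun n => N (u n)).
  exact: cseq_normP.
by apply/funext => n; rewrite /= ssN_star //; apply: cseqS.
Qed.

Definition cpl_mul (p q : completion) := to_cpl (cseq_mul (repr p) (repr q)).
Definition cpl_star (p : completion) := to_cpl (cseq_star (repr p)).

Lemma repr_to_cpl u : cseq_norm (u - repr (to_cpl u)) = 0.
Proof. by apply/to_cplE; rewrite to_cplK. Qed.

Lemma to_cplM u v : to_cpl (cseq_mul u v) = cpl_mul (to_cpl u) (to_cpl v).
Proof.
apply/to_cplE; set u' := repr (to_cpl u); set v' := repr (to_cpl v).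
have -> : cseq_mul u v - cseq_mul u' v' =
    cseq_mul (u - u') v + cseq_mul u' (v - v').
  apply: cseq_ext => n; change (mul (u n) (v n) - mul (u' n) (v' n) =
    mul (u n - u' n) (v n) + mul (u' n) (v n - v' n)).
  by rewrite ss_mulBl ?ss_mulBr ?addrA ?subrK //; exact: cseqS.
apply/eqP; rewrite eq_le cseq_norm_ge0 andbT.
apply: le_trans (cseq_normD _ _) _; rewrite -[leRHS]addr0.
apply: lerD; apply: le_trans (cseq_norm_mul _ _) _.
  by rewrite repr_to_cpl mul0r.
by rewrite repr_to_cpl mulr0.
Qed.

Lemma to_cpl_star u : to_cpl (cseq_star u) = cpl_star (to_cpl u).
Proof.
apply/to_cplE; set u' := repr (to_cpl u).
have -> : cseq_star u - cseq_star u' = cseq_star (u - u').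
  by apply: cseq_ext => n; apply/esym/ss_starB; apply: cseqS.
by rewrite cseq_norm_star repr_to_cpl.
Qed.

Lemma cpl_mulA : associative cpl_mul.
Proof.
move=> p q r; rewrite -[p]to_cplK -[q]to_cplK -[r]to_cplK -!to_cplM; congr to_cpl.
by apply: cseq_ext => n /=; apply: (css_mulA (ssP X)); apply: cseqS.
Qed.

Lemma cpl_mulDl : left_distributive cpl_mul +%R.
Proof.
move=> p q r; rewrite -[p]to_cplK -[q]to_cplK -[r]to_cplK.
rewrite -to_cplD -!to_cplM -to_cplD; congr to_cpl.
by apply: cseq_ext => n; apply: ss_mulD1l; apply: cseqS.
Qed.

Lemma cpl_mulDr : right_distributive cpl_mul +%R.
Proof.
move=> p q r; rewrite -[p]to_cplK -[q]to_cplK -[r]to_cplK.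
rewrite -to_cplD -!to_cplM -to_cplD; congr to_cpl.
by apply: cseq_ext => n; apply: ss_mulD1r; apply: cseqS.
Qed.

Lemma cpl_mulZl (c : complex R) p q : cpl_mul (c *: p) q = c *: cpl_mul p q.
Proof.
rewrite -[p]to_cplK -[q]to_cplK -[c *: to_cpl _]to_cplZ -!to_cplM.
rewrite -[RHS]to_cplZ; congr to_cpl.
by apply: cseq_ext => n; apply: ss_mulZl; apply: cseqS.
Qed.

Lemma cpl_mulZr (c : complex R) p q : cpl_mul p (c *: q) = c *: cpl_mul p q.
Proof.
rewrite -[p]to_cplK -[q]to_cplK -[c *: to_cpl _]to_cplZ -!to_cplM.
rewrite -[RHS]to_cplZ; congr to_cpl.
by apply: cseq_ext => n; apply: ss_mulZr; apply: cseqS.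
Qed.

Lemma cpl_starD : {morph cpl_star : p q / p + q}.
Proof.
move=> p q; rewrite -[p]to_cplK -[q]to_cplK -to_cplD -!to_cpl_star -to_cplD.
by congr to_cpl; apply: cseq_ext => n; apply: ss_starD1; apply: cseqS.
Qed.

Lemma cpl_starZ (c : complex R) p : cpl_star (c *: p) = Num.conj c *: cpl_star p.
Proof.
rewrite -[p]to_cplK -[c *: to_cpl _]to_cplZ -!to_cpl_star.
rewrite -[RHS]to_cplZ; congr to_cpl.
by apply: cseq_ext => n; apply: ss_starZ; apply: cseqS.
Qed.

Lemma cpl_starM p q : cpl_star (cpl_mul p q) = cpl_mul (cpl_star q) (cpl_star p).
Proof.
rewrite -[p]to_cplK -[q]to_cplK -to_cplM -!to_cpl_star -to_cplM; congr to_cpl.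
by apply: cseq_ext => n /=; apply: (css_starM (ssP X)); apply: cseqS.
Qed.

Lemma cpl_starK : involutive cpl_star.
Proof.
move=> p; rewrite -[p]to_cplK -!to_cpl_star; congr to_cpl.
by apply: cseq_ext => n /=; apply: (css_starK (ssP X)); apply: cseqS.
Qed.

Lemma cpl_norm_mul_le (p q : completion) : `|cpl_mul p q| <= `|p| * `|q|.
Proof.
change (cpl_norm (cpl_mul p q) <= cpl_norm p * cpl_norm q).
rewrite -[p]to_cplK -[q]to_cplK -to_cplM !cpl_normE -rmorphM lecR.
exact: cseq_norm_mul.
Qed.

Lemma cpl_norm_star_mul (p : completion) : `|cpl_mul (cpl_star p) p| = `|p| ^+ 2.
Proof.
change (cpl_norm (cpl_mul (cpl_star p) p) = cpl_norm p ^+ 2).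
rewrite -[p]to_cplK -to_cpl_star -to_cplM !cpl_normE -rmorphXn.
by rewrite cseq_norm_cstar.
Qed.

Lemma cseq_cst_subproof (a : V) : S a -> (fun=> a) \in ss_cauchy.
Proof.
by move=> Sa; apply/asboolP; split=> // e e0; exists 0%N => n m _ _; rewrite subrr ssN0.
Qed.

(** The class of a constant sequence; outside [S] that sequence is not admissible and the default 0
    is taken. *)
Definition cpl_in (a : V) : completion := to_cpl (insubd 0 (fun=> a)).

Lemma cpl_inE a (Sa : S a) : cpl_in a = to_cpl (Cseq (cseq_cst_subproof Sa)).
Proof.
rewrite /cpl_in; congr to_cpl; apply: val_inj; rewrite val_insubd.
by rewrite cseq_cst_subproof.
Qed.

Lemma cpl_norm_in_sub a u : S a ->
  cpl_norm (cpl_in a - to_cpl u) = (lim (N (a - u n) @[n --> \oo]))%:C.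
Proof.
move=> Sa; rewrite (cpl_inE Sa) -[to_cpl u]scale1r -scaleNr -[_ *: to_cpl u]to_cplZ.
rewrite -to_cplD cpl_normE.
suff -> : (fun n => N (a - u n)) =
  (fun n => N ((Cseq (cseq_cst_subproof Sa) + -1 *: u) n)) by [].
by apply/funext => n; rewrite -[- u n]scaleN1r.
Qed.

Lemma cpl_in_approx (u : cseq) (e : R) : 0 < e -> exists n0, forall n,
  (n0 <= n)%N -> cpl_norm (cpl_in (u n) - to_cpl u) <= e%:C.
Proof.
move=> /(cseq_cauchy u)[n0 h]; exists n0 => n n0n.
rewrite cpl_norm_in_sub; last exact: cseqS.
rewrite lecR; apply: limr_le.
  apply/cvg_ex; exists (cseq_norm (Cseq (cseq_cst_subproof (cseqS u n)) - u)).
  exact: (cseq_normP (Cseq (cseq_cst_subproof (cseqS u n)) - u)).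
by exists n0 => // m /= n0m; apply/ltW/h.
Qed.

Lemma cpl_norm_in a : S a -> cpl_norm (cpl_in a) = (N a)%:C.
Proof.
move=> Sa; rewrite (cpl_inE Sa) cpl_normE; congr (_%:C).
apply: cseq_norm_uniq; rewrite [X in X @ _](_ : _ = fun=> N a) //.
exact: cvg_cst.
Qed.

Lemma cpl_in_lin (c : complex R) a b : S a -> S b ->
  cpl_in (c *: a + b) = c *: cpl_in a + cpl_in b.
Proof.
move=> Sa Sb; rewrite (cpl_inE (css_Slin (ssP X) c Sa Sb)) (cpl_inE Sa) (cpl_inE Sb).
rewrite -[c *: to_cpl _]to_cplZ -to_cplD; congr to_cpl.
exact: cseq_ext.
Qed.

Lemma cpl_inM a b : S a -> S b -> cpl_in (mul a b) = cpl_mul (cpl_in a) (cpl_in b).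
Proof.
move=> Sa Sb; rewrite (cpl_inE (ssM Sa Sb)) (cpl_inE Sa) (cpl_inE Sb) -to_cplM.
by congr to_cpl; apply: cseq_ext.
Qed.

Lemma cpl_in_star a : S a -> cpl_in (star a) = cpl_star (cpl_in a).
Proof.
move=> Sa; rewrite (cpl_inE (ssSt Sa)) (cpl_inE Sa) -to_cpl_star.
by congr to_cpl; apply: cseq_ext.
Qed.

(** Completeness is stated for filters. From a Cauchy filter one extracts, for each n, an element of
    [S] within 1/(n + 1) of a whole member of the filter; these elements form a Cauchy sequence
    whose class is the limit. *)
Lemma cpl_complete (F : set_system (completion : normedModType (complex R))) :
  ProperFilter F -> cauchy F -> cvg F.
Proof.
move=> FF /cauchy_ballP cF.
have normE (p : completion) : `|p| = cpl_norm p by [].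
have x_ex n : exists2 a, S a & F [set q | `|cpl_in a - q| < (n.+1%:R^-1)%:C].
  have e0 : 0 < n.+1%:R^-1 :> R by rewrite invr_gt0.
  have e2 : 0 < (n.+1%:R^-1 / 2) :> R by rewrite divr_gt0.
  have e2c : 0 < (n.+1%:R^-1 / 2)%:C :> complex R by rewrite ltcR.
  have [[U W] [/= FU FW UW]] := cF _ e2c.
  have [p [Up Wp]] : exists p, U p /\ W p.
    by have [p] := filter_ex (filterI FU FW); exists p.
  have [m /(_ m (leqnn _))] := cpl_in_approx (repr p) e2.
  rewrite to_cplK => xp; exists (repr p m); first exact: cseqS.
  apply: filterS FW => q Wq /=.
  have /= := UW (p, q) (conj Up Wq); rewrite -ball_normE /= => pq.
  have -> : cpl_in (repr p m) - q = (cpl_in (repr p m) - p) + (p - q).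
    by rewrite addrA subrK.
  apply: le_lt_trans (ler_normD _ _) _.
  have -> : (n.+1%:R^-1)%:C = (n.+1%:R^-1 / 2)%:C + (n.+1%:R^-1 / 2)%:C :> complex R.
    by rewrite -rmorphD -splitr.
  exact: ler_ltD.
have [x xP] := choice (fun n => let: ex_intro2 a Sa Fa := x_ex n in
   ex_intro (fun a => S a /\ F [set q | `|cpl_in a - q| < (n.+1%:R^-1)%:C]) a (conj Sa Fa)).
have xS n : S (x n) := (xP n).1.
have xdist n m : N (x n - x m) < n.+1%:R^-1 + m.+1%:R^-1.
  have [q [qn qm]] := filter_ex (filterI (xP n).2 (xP m).2).
  rewrite -ltcR -(cpl_norm_in (ssB (xS n) (xS m))).
  have -> : cpl_in (x n - x m) = (cpl_in (x n) - q) + (q - cpl_in (x m)).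
    by rewrite addrA subrK [x n - x m]addrC -scaleN1r cpl_in_lin // scaleN1r addrC.
  rewrite rmorphD -normE; apply: le_lt_trans (ler_normD _ _) _.
  by rewrite [X in _ + X < _]distrC; apply: ltrD.
have xC : x \in ss_cauchy.
  apply/asboolP; split=> // e e0.
  have [|n0 h] := invS_small (e := e / 2); first by rewrite divr_gt0.
  exists n0 => n m /h hn /h hm; apply: lt_trans (xdist n m) _.
  by rewrite [ltRHS]splitr ltrD.
apply/cvg_ex; exists (to_cpl (Cseq xC)) => W /nbhs_ballP[_ /= /cplx_gt0[e e0 ->] eW].
have e2 : 0 < e / 2 by rewrite divr_gt0.
have [n1 h1] := invS_small e2.
have [n2 h2] := cpl_in_approx (Cseq xC) e2.
pose n := maxn n1 n2.
apply: filterS (xP n).2 => q /= qn; apply: eW; rewrite -ball_normE /=.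
have -> : to_cpl (Cseq xC) - q =
  (to_cpl (Cseq xC) - cpl_in (x n)) + (cpl_in (x n) - q) by rewrite addrA subrK.
apply: le_lt_trans (ler_normD _ _) _.
have -> : e%:C = (e / 2)%:C + (e / 2)%:C :> complex R by rewrite -rmorphD -splitr.
rewrite distrC; apply: ler_ltD; first exact: (h2 n (leq_maxr _ _)).
by apply: lt_trans qn _; rewrite ltcR; apply: h1; rewrite leq_maxl.
Qed.

HB.instance Definition _ :=
  Uniform_isComplete.Build completion cpl_complete.

HB.instance Definition _ := isCStarAlgebra.Build R completion
  cpl_mulA cpl_mulDl cpl_mulDr cpl_mulZl cpl_mulZr cpl_starD cpl_starZ cpl_starM
  cpl_starK cpl_norm_mul_le cpl_norm_star_mul.

End Completion.

(** [N] may have a kernel, as the reduced norm over a single fibre does, so [k] need not be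
    injective. *)
Theorem cstar_completion (R : realType) (V : lmodType (complex R)) (S : set V)
    (mul : V -> V -> V) (star : V -> V) (N : V -> R) :
  cstar_seminorm S mul star N ->
  exists (B : cstarAlgType R) (k : V -> B),
    [/\ star_hom S mul star (@cmul R B) (@cstar R B) k,
        forall a, S a -> rnorm (k a) = N a &
        forall b (e : R), 0 < e -> exists2 a, S a & rnorm (k a - b) < e].
Proof.
move=> cN; pose X := SsAlg cN; exists (completion X), (@cpl_in R X); split.
- by split=> [c a b|a b|a]; [exact: (@cpl_in_lin R X)|
    exact: (@cpl_inM R X)|exact: (@cpl_in_star R X)].
- by move=> a Sa; apply: (@complexI R); rewrite -rnormE; exact: (@cpl_norm_in R X).
- move=> b e e0; have e2 : 0 < e / 2 by rewrite divr_gt0.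
  have [n /(_ n (leqnn _)) h] := cpl_in_approx (repr b) e2.
  exists (repr b n); first exact: (@cseqS R X).
  rewrite to_cplK in h; rewrite -ltcR -rnormE; apply: le_lt_trans h _.
  by rewrite ltcR gtr_pMr // invf_lt1 // ltr1n.
Qed.

(** * Extension from dense subsets *)

Section DenseExtension.
Variable R : realType.

Definition rdense (A : cstarAlgType R) (D : set A) :=
  forall a (e : R), 0 < e -> exists2 d, D d & rnorm (d - a) < e.

Lemma rdense_seq (A : cstarAlgType R) (D : set A) : rdense D ->
  forall a, exists d : nat -> A, (forall n, D (d n)) /\ rcvg d a.
Proof.
move=> dD a.
have d_ex n : exists d, D d /\ rnorm (d - a) < n.+1%:R^-1.
  have [|d Dd da] := dD a n.+1%:R^-1; first by rewrite invr_gt0.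
  by exists d.
have [d dP] := choice d_ex; exists d; split=> [n|]; first exact: (dP n).1.
by apply: rcvg_le (@invS_small R) => n; apply/ltW/(dP n).2.
Qed.

(** Additivity instead of linearity, so that the antilinear [cstar] is covered by the same density
    arguments. *)
Definition badd (A B : cstarAlgType R) (f : A -> B) :=
  (forall x y, f (x - y) = f x - f y) /\
  exists C : R, forall x, rnorm (f x) <= C * rnorm x.

Lemma badd_cvg (A B : cstarAlgType R) (f : A -> B) u a :
  badd f -> rcvg u a -> rcvg (fun n => f (u n)) (f a).
Proof. by move=> [fB [C fC]]; apply: rcvg_lip fB fC. Qed.

Lemma badd_dense_eq (A B : cstarAlgType R) (D : set A) (f h : A -> B) :
  rdense D -> badd f -> badd h -> (forall d, D d -> f d = h d) -> f = h.
Proof.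
move=> dD bf bh fh; apply/funext => a; have [d [Dd da]] := rdense_seq dD a.
apply: (rcvg_uniq (badd_cvg bf da)) => e e0.
have [n0 hn] := badd_cvg bh da e0; exists n0 => n; rewrite fh //; exact: hn.
Qed.

Lemma badd_comp (A B D : cstarAlgType R) (f : A -> B) (g : D -> A) :
  badd f -> badd g -> badd (f \o g).
Proof.
move=> [fB [C fC]] [gB [E gE]]; split=> [x y|]; first by rewrite /= gB fB.
exists (`|C| * E) => x; apply: le_trans (fC _) _.
apply: le_trans (_ : `|C| * rnorm (g x) <= _).
  by rewrite ler_wpM2r ?rnorm_ge0 ?ler_norm.
by rewrite -mulrA ler_wpM2l.
Qed.

Lemma badd_add (A B : cstarAlgType R) (f g : A -> B) :
  badd f -> badd g -> badd (fun x => f x + g x).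
Proof.
move=> [fB [C fC]] [gB [E gE]]; split=> [x y|]; first by rewrite fB gB opprD addrACA.
by exists (C + E) => x; apply: le_trans (rnormD _ _) _; rewrite mulrDl lerD.
Qed.

Lemma badd_scale (A B : cstarAlgType R) (f : A -> B) (k : complex R) :
  badd f -> badd (fun x => k *: f x).
Proof.
move=> [fB [C fC]]; split=> [x y|]; first by rewrite fB scalerBr.
by exists (cn k * C) => x; rewrite rnormZ -mulrA ler_wpM2l ?cn_ge0.
Qed.

Lemma badd_mull (A : cstarAlgType R) (a : A) : badd (cmul a).
Proof.
split=> [x y|]; first exact: cmulBr.
by exists (rnorm a) => x; apply: rnormM.
Qed.

Lemma badd_mulr (A : cstarAlgType R) (a : A) : badd (fun x => cmul x a).
Proof.
split=> [x y|]; first exact: cmulBl.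
by exists (rnorm a) => x; rewrite mulrC; apply: rnormM.
Qed.

Lemma badd_star (A : cstarAlgType R) : badd (@cstar R A).
Proof.
by split=> [x y|]; [exact: cstarB | exists 1 => x; rewrite rnorm_cstar mul1r].
Qed.

Lemma linear_sub (V W : lmodType (complex R)) (S : set V) (g : V -> W) :
  (forall (c : complex R) a b, S a -> S b -> g (c *: a + b) = c *: g a + g b) ->
  forall a b, S a -> S b -> g (a - b) = g a - g b.
Proof.
by move=> gL a b Sa Sb; rewrite addrC -scaleN1r gL // scaleN1r addrC.
Qed.

Lemma linear_badd (A B : cstarAlgType R) (f : A -> B) (C : R) :
  (forall (c : complex R) a b, f (c *: a + b) = c *: f a + f b) ->
  (forall x, rnorm (f x) <= C * rnorm x) -> badd f.
Proof.
move=> fL fC; split; last by exists C.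
by move=> x y; apply: (@linear_sub A B [set: A]).
Qed.

Lemma star_hom_badd (A B : cstarAlgType R) (psi : A -> B) :
  star_hom [set: A] (@cmul R A) (@cstar R A) (@cmul R B) (@cstar R B) psi ->
  badd psi.
Proof.
move=> hpsi; have [L _ _] := hpsi; apply: (linear_badd (C := 1)).
  by move=> *; apply: L.
by move=> x; rewrite mul1r; apply: star_hom_contraction.
Qed.

(** [g] need not be injective: the bound of [u] by [g] shows both that images of Cauchy sequences
    are Cauchy and that the limit depends only on the point of [A] approximated. *)
Lemma dense_extension (V : lmodType (complex R)) (S : set V) (A B : cstarAlgType R)
    (g : V -> A) (u : V -> B) (C : R) :
  0 <= C -> (forall (c : complex R) a b, S a -> S b -> S (c *: a + b)) ->
  (forall (c : complex R) a b, S a -> S b -> g (c *: a + b) = c *: g a + g b) ->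
  (forall (c : complex R) a b, S a -> S b -> u (c *: a + b) = c *: u a + u b) ->
  rdense (g @` S) -> (forall x, S x -> rnorm (u x) <= C * rnorm (g x)) ->
  exists U : A -> B, [/\ forall x, S x -> U (g x) = u x,
    forall (c : complex R) a b, U (c *: a + b) = c *: U a + U b &
    forall a, rnorm (U a) <= C * rnorm a].
Proof.
move=> C0 SL gL uL dg uC.
have SB a b : S a -> S b -> S (a - b).
  by move=> Sa Sb; rewrite addrC -scaleN1r; apply: SL.
have gB := linear_sub gL; have uB := linear_sub uL.
have cauchy_u a x : (forall n, S (x n)) -> rcvg (fun n => g (x n)) a ->
    exists b, rcvg (fun n => u (x n)) b.
  move=> Sx xa; apply: rcvg_cauchy => e e0.
  have e1 : 0 < e / (C *+ 2 + 1) by rewrite divr_gt0 // ltr_wpDl // mulrn_wge0.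
  have [n0 h] := xa _ e1; exists n0 => n m /h hn /h hm.
  rewrite -uB //; apply: le_lt_trans (uC _ (SB _ _ (Sx n) (Sx m))) _; rewrite gB //.
  apply: le_lt_trans (_ : C * (rnorm (g (x n) - a) + rnorm (g (x m) - a)) < _).
    by rewrite ler_wpM2l // (rnormBC (g (x m)) a) rnormBB.
  move: hn hm; rewrite !ltr_pdivlMr ?ltr_wpDl ?mulrn_wge0 // mulr2n.
  have := rnorm_ge0 (g (x n) - a); have := rnorm_ge0 (g (x m) - a).
  move: C0 e0; nra.
have U_ex a : exists b, exists x, [/\ forall n, S (x n), rcvg (fun n => g (x n)) a &
    rcvg (fun n => u (x n)) b].
  have [d [dS da]] := rdense_seq dg a.
  have [x xP] := choice (fun n => let: ex_intro2 x Sx gx := dS n in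
    ex_intro (fun x => S x /\ g x = d n) x (conj Sx gx)).
  have gx : rcvg (fun n => g (x n)) a.
    by move=> e /da[n0 h]; exists n0 => n /h; rewrite (xP n).2.
  have [b ub] := cauchy_u a x (fun n => (xP n).1) gx.
  by exists b, x; split=> // n; exact: (xP n).1.
have [U UP] := choice U_ex.
(* The value [U a] was chosen with one particular sequence; every other sequence with the same limit
   yields it too. *)
have UE a x : (forall n, S (x n)) -> rcvg (fun n => g (x n)) a ->
    rcvg (fun n => u (x n)) (U a).
  move=> Sx xa; have [z [Sz za uz]] := UP a.
  have [b ub] := cauchy_u a x Sx xa.
  suff -> : U a = b by [].
  apply/eqP; rewrite -subr_eq0; apply/eqP/(@rcvg_uniq _ _ (fun n => u (z n) - u (x n))).
    rewrite -[- b]scaleN1r; apply: rcvgD => //.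
    by under eq_fun do rewrite -scaleN1r; apply: rcvgZ.
  move=> e e0; have e1 : 0 < e / (C + 1) by rewrite divr_gt0 // ltr_wpDl.
  have h0 : rcvg (fun n => g (z n) - g (x n)) 0.
    rewrite -(subrr a) -[- a]scaleN1r; apply: rcvgD => //.
    by under eq_fun do rewrite -scaleN1r; apply: rcvgZ.
  have [n0 h] := h0 _ e1; exists n0 => n /h; rewrite !subr0.
  rewrite ltr_pdivlMr ?ltr_wpDl // mulrC => hn; rewrite -uB //.
  apply: le_lt_trans (uC _ (SB _ _ (Sz n) (Sx n))) _; rewrite gB //.
  by apply: le_lt_trans hn; rewrite ler_wpM2r ?rnorm_ge0 // lerDl.
exists U; split.
- move=> x Sx; apply: (@rcvg_uniq _ _ (fun=> u x)); last exact: rcvg_cst.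
  by apply: (UE (g x) (fun=> x)) => //; apply: rcvg_cst.
- move=> c a b; have [x [Sx xa ux]] := UP a; have [z [Sz zb uz]] := UP b.
  have h := UE (c *: a + b) (fun n => c *: x n + z n).
  apply: (@rcvg_uniq _ _ (fun n => u (c *: x n + z n))).
    apply: h => [n|]; first exact: SL.
    by under eq_fun do rewrite gL //; apply: rcvgD => //; apply: rcvgZ.
  by under eq_fun do rewrite uL //; apply: rcvgD => //; apply: rcvgZ.
- move=> a; have [x [Sx xa ux]] := UP a; apply/ler_addgt0Pr => e e0.
  have e1 : 0 < e / 2 / (C + 1) by rewrite !divr_gt0 // ltr_wpDl.
  have [n1 h1] := xa _ e1; have [n2 h2] := ux _ e1.
  have := h1 _ (leq_maxl n1 n2); have := h2 _ (leq_maxr n1 n2).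
  set n := maxn n1 n2; rewrite !ltr_pdivlMr ?ltr_wpDl // => k2 k1.
  have := rnorm_le_dist (U a) (u (x n)); rewrite rnormBC.
  have := uC _ (Sx n); have := ler_wpM2l C0 (rnorm_le_dist (g (x n)) a).
  have := mulr_ge0 C0 (rnorm_ge0 (u (x n) - U a)).
  have := rnorm_ge0 (g (x n) - a).
  move: k1 k2; rewrite !mulrDr !mulr1 ![_ * C]mulrC; lra.
Qed.
End DenseExtension.

(** * Banded matrices over Z *)

Section Windows.

(** The integers from - d to d as a list. Sums over Z of finitely supported families become sums
    over such a list, whose radius may be enlarged at will. *)
Definition win (d : nat) : seq int := [seq i%:Z - d%:Z | i <- iota 0 (d + d).+1].

Lemma mem_win d (l : int) : (l \in win d) = (`|l| <= d)%N.
Proof.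
apply/mapP/idP => [[i +] | ld]; first by rewrite mem_iota => + ->; lia.
by exists (absz (l + d%:Z)%R); [rewrite mem_iota; lia|lia].
Qed.

Lemma uniq_win d : uniq (win d).
Proof. by rewrite map_inj_uniq ?iota_uniq // => i j; lia. Qed.

Lemma size_win d : size (win d) = (d + d).+1.
Proof. by rewrite size_map size_iota. Qed.

Definition supp (V : nmodType) (d : nat) (F : int -> V) :=
  forall l : int, (d < `|l|)%N -> F l = 0.

Lemma supp_le (V : nmodType) d e (F : int -> V) : (d <= e)%N -> supp d F -> supp e F.
Proof. by move=> de sF l el; apply: sF; apply: leq_ltn_trans de el. Qed.

Lemma win_widen (V : nmodType) d e (F : int -> V) : (d <= e)%N -> supp d F ->
  \sum_(l <- win e) F l = \sum_(l <- win d) F l.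
Proof.
move=> de sF; rewrite (bigID (mem (win d))) /= [X in _ + X]big1 ?addr0; last first.
  by move=> l; rewrite mem_win -ltnNge => /sF.
rewrite -big_filter; apply: perm_big; apply: uniq_perm.
- by rewrite filter_uniq // uniq_win.
- exact: uniq_win.
- move=> l; rewrite mem_filter !mem_win; apply/andb_idr => ld.
  exact: leq_trans ld de.
Qed.

Lemma fsum_win (V : nmodType) d (F : int -> V) : supp d F ->
  \sum_(l \in [set: int]) F l = \sum_(l <- win d) F l.
Proof.
move=> sF; rewrite (@fsbigE _ _ _ _ _ (win d)) //.
- by apply: eq_bigl => l; rewrite in_setT.
- exact: uniq_win.
- by move=> l _; rewrite mem_win -ltnNge => /sF.
Qed.

Lemma finite_suppP (V : nmodType) (F : int -> V) :
  finite_set [set k | F k <> 0] <-> exists d, supp d F.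
Proof.
split=> [/finite_seqP[s sE]|[d sF]].
  exists (\max_(k <- s) `|k|%N) => l ld; apply: contrapT => Fl.
  have ls : l \in s by have : [set k | F k <> 0] l by []; rewrite sE.
  by move: ld; rewrite ltnNge leq_bigmax_seq.
apply: sub_finite_set (finite_seq (win d)) => l /= Fl.
by rewrite mem_win leqNgt; apply/negP => /sF.
Qed.

(** The extra radius |k| ensures that the translated window still contains the support. *)
Lemma win_shift (V : nmodType) d (k : int) (F : int -> V) : supp d F ->
  \sum_(l <- win (d + `|k|)) F (l + k) = \sum_(l <- win d) F l.
Proof.
move: (uniq_win (d + `|k|)) (mem_win (d + `|k|)).
move: (win (d + `|k|)) => W uW mW sF; rewrite -(big_map (fun l => l + k) xpredT F).
rewrite (bigID (mem (win d))) /= [X in _ + X]big1 ?addr0; last first.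
  by move=> l; rewrite mem_win -ltnNge => /sF.
rewrite -big_filter; apply: perm_big; apply: uniq_perm.
- by rewrite filter_uniq // map_inj_uniq // => i j; lia.
- exact: uniq_win.
- move=> l; rewrite mem_filter mem_win; apply/andb_idr => ld.
  by apply/mapP; exists (l - k); [rewrite mW; lia|lia].
Qed.
End Windows.

(** * Banded operators on finitely supported vectors, with adjoints and Cauchy-Schwarz *)

Section BandedMatrices.
Variable R : realType.
Local Notation C := (complex R).
Local Notation "x %:C" := (real_complex R x).
Implicit Types (u v w : int -> C) (M K : int -> int -> C).

Definition vfin v := exists d, supp d v.

Definition band d M := forall n l : int, (d < `|n - l|)%N -> M n l = 0.

Definition vsq v : R := \sum_(l \in [set: int]) cn (v l) ^+ 2.
Definition vip u v : C := \sum_(l \in [set: int]) Num.conj (u l) * v l.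
Definition mact M v : int -> C := fun n => \sum_(l \in [set: int]) M n l * v l.
Definition mmulm M K : int -> int -> C :=
  fun n l => \sum_(i \in [set: int]) M n i * K i l.
Definition madj M : int -> int -> C := fun n l => Num.conj (M l n).

Lemma supp_cn2 d v : supp d v -> supp d (fun l => cn (v l) ^+ 2).
Proof. by move=> sv l /sv ->; rewrite cn0 expr0n. Qed.

Lemma supp_mulr d (f : int -> C) v : supp d v -> supp d (fun l => f l * v l).
Proof. by move=> sv l /sv ->; rewrite mulr0. Qed.

Lemma vsqE d v : supp d v -> vsq v = \sum_(l <- win d) cn (v l) ^+ 2.
Proof. by move=> /supp_cn2; apply: fsum_win. Qed.

Lemma vipE d u v : supp d v -> vip u v = \sum_(l <- win d) Num.conj (u l) * v l.
Proof. by move=> /(supp_mulr (fun l => Num.conj (u l))); apply: fsum_win. Qed.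

Lemma mactE d M v n : supp d v -> mact M v n = \sum_(l <- win d) M n l * v l.
Proof. by move=> /(supp_mulr (M n)); apply: fsum_win. Qed.

Lemma mact_supp d e M v : band d M -> supp e v -> supp (d + e) (mact M v).
Proof.
move=> bM sv n nd; rewrite (mactE _ _ sv) big_seq big1 // => l.
by rewrite mem_win => le; rewrite bM ?mul0r //; lia.
Qed.

Lemma mact_fin d M v : band d M -> vfin v -> vfin (mact M v).
Proof. by move=> bM [e sv]; exists (d + e)%N; apply: mact_supp. Qed.

Lemma mmulmE d M K n l : band d K ->
  mmulm M K n l = \sum_(i <- win (d + `|l|)) M n i * K i l.
Proof.
by move=> bK; apply: fsum_win => i id; rewrite bK ?mulr0 //; lia.
Qed.

Lemma band_mul d e M K : band d M -> band e K -> band (d + e) (mmulm M K).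
Proof.
move=> bM bK n l nl; rewrite (mmulmE _ _ _ bK) big1 // => i _.
have [id|id] := leqP `|i - l| e; last by rewrite bK ?mulr0.
by rewrite bM ?mul0r //; lia.
Qed.

Lemma band_adj d M : band d M -> band d (madj M).
Proof. by move=> bM n l nl; rewrite /madj bM ?conjC0 //; lia. Qed.

Lemma mact_mul d e M K v : band d M -> band e K -> vfin v ->
  mact (mmulm M K) v = mact M (mact K v).
Proof.
move=> bM bK [c sv]; apply/funext => n.
have sKv := mact_supp bK sv.
rewrite (mactE _ _ sv) (mactE _ _ sKv).
under [RHS]eq_bigr do rewrite (mactE _ _ sv) mulr_sumr.
rewrite exchange_big /=; apply: eq_big_seq => l; rewrite mem_win => lc.
rewrite (mmulmE _ _ _ bK) mulr_suml -(@win_widen _ _ (e + c)).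
- by apply: eq_bigr => i _; rewrite mulrA.
- by rewrite leq_add2l.
- by move=> i il; rewrite bK ?mulr0 ?mul0r //; lia.
Qed.

Lemma vip_adj d M u v : band d M -> vfin u -> vfin v ->
  vip u (mact M v) = vip (mact (madj M) u) v.
Proof.
move=> bM [c su] [e sv]; have sMv := mact_supp bM sv.
rewrite (vipE _ (supp_le (leq_addl c _) sMv)) (vipE _ sv).
under eq_bigr do rewrite (mactE _ _ sv) mulr_sumr.
rewrite exchange_big /=; apply: eq_bigr => l _.
rewrite (mactE (d := c + (d + e)) _ _ (supp_le (leq_addr _ _) su)).
rewrite rmorph_sum mulr_suml; apply: eq_bigr => i _.
by rewrite rmorphM /madj /= conjCK mulrA [Num.conj (u i) * _]mulrC.
Qed.

Lemma vsq_ge0 v : vfin v -> 0 <= vsq v.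
Proof. by move=> [d sv]; rewrite (vsqE sv) sumr_ge0 // => l _; rewrite sqr_ge0. Qed.

Lemma vip_vsq v : vfin v -> vip v v = (vsq v)%:C.
Proof.
move=> [d sv]; rewrite (vipE _ sv) (vsqE sv) rmorph_sum.
by apply: eq_bigr => l _; rewrite conj_mul.
Qed.

Lemma vfinD u v : vfin u -> vfin v -> vfin (fun l => u l + v l).
Proof.
move=> [d su] [e sv]; exists (maxn d e) => l; rewrite gtn_max => /andP[/su -> /sv ->].
by rewrite addr0.
Qed.

Lemma vfin2 u v : vfin u -> vfin v -> exists d, supp d u /\ supp d v.
Proof.
move=> [d su] [e sv]; exists (maxn d e); split.
  exact: supp_le (leq_maxl _ _) su.
exact: supp_le (leq_maxr _ _) sv.
Qed.

Lemma vsqZ (c : C) v : vfin v -> vsq (fun l => c * v l) = cn c ^+ 2 * vsq v.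
Proof.
move=> [d sv]; rewrite (vsqE sv) (vsqE (supp_mulr (fun=> c) sv)) mulr_sumr.
by apply: eq_bigr => l _; rewrite cnM exprMn.
Qed.

Lemma weighted_amgm (a b p q : R) : 0 < a -> 0 < b ->
  p * q *+ 2 <= b / a * p ^+ 2 + a / b * q ^+ 2.
Proof.
move=> a0 b0; rewrite -subr_ge0.
have -> : b / a * p ^+ 2 + a / b * q ^+ 2 - p * q *+ 2 =
   (b * p - a * q) ^+ 2 / (a * b) by field; rewrite !lt0r_neq0.
by rewrite divr_ge0 ?sqr_ge0 ?mulr_ge0 // ltW.
Qed.

Lemma vip_cs u v : vfin u -> vfin v ->
  cn (vip u v) <= Num.sqrt (vsq u) * Num.sqrt (vsq v).
Proof.
move=> fu fv; have [d [su sv]] := vfin2 fu fv.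
rewrite (vipE _ sv); apply: le_trans (cn_sum _ _ _) _.
under eq_bigr do rewrite cnM cn_conj.
(* The weights used below are quotients of the two norms, so a vector of norm zero is treated apart:
   all its entries vanish. *)
have [u0|u0] := eqVneq (vsq u) 0.
  rewrite u0 sqrtr0 mul0r big_seq big1 // => l lw; move: u0; rewrite (vsqE su).
  move=> /eqP; rewrite psumr_eq0 => [|i _]; last exact: sqr_ge0.
  by move=> /allP/(_ l lw) /=; rewrite sqrf_eq0 => /eqP ->; rewrite mul0r.
have [v0|v0] := eqVneq (vsq v) 0.
  rewrite v0 sqrtr0 mulr0 big_seq big1 // => l lw; move: v0; rewrite (vsqE sv).
  move=> /eqP; rewrite psumr_eq0 => [|i _]; last exact: sqr_ge0.
  by move=> /allP/(_ l lw) /=; rewrite sqrf_eq0 => /eqP ->; rewrite mulr0.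
have u1 : 0 < vsq u by rewrite lt_neqAle eq_sym u0 vsq_ge0.
have v1 : 0 < vsq v by rewrite lt_neqAle eq_sym v0 vsq_ge0.
set a := Num.sqrt (vsq u); set b := Num.sqrt (vsq v).
have aE : a ^+ 2 = vsq u by rewrite sqr_sqrtr // ltW.
have bE : b ^+ 2 = vsq v by rewrite sqr_sqrtr // ltW.
have a0 : 0 < a by rewrite sqrtr_gt0.
have b0 : 0 < b by rewrite sqrtr_gt0.
(* With a and b the norms of u and v, the right-hand sides of the weighted inequality add up to
   exactly 2ab. *)
have := @ler_sum _ _ (win d) xpredT _ _
  (fun l _ => weighted_amgm (cn (u l)) (cn (v l)) a0 b0).
rewrite sumrMnl big_split /= -!mulr_sumr -(vsqE su) -(vsqE sv) -aE -bE.
have -> : b / a * a ^+ 2 + a / b * b ^+ 2 = (a * b) *+ 2 by field; rewrite !lt0r_neq0.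
by rewrite lerMn2r.
Qed.

(** The triangle inequality: for w = u + v, expand <w, w> as <w, u> + <w, v>, apply Cauchy-Schwarz
    to both and cancel one factor |w|. *)
Lemma vsqD u v : vfin u -> vfin v ->
  vsq (fun l => u l + v l) <= (Num.sqrt (vsq u) + Num.sqrt (vsq v)) ^+ 2.
Proof.
move=> fu fv; have fw := vfinD fu fv.
have [d [su sv]] := vfin2 fu fv.
have sw : supp d (fun l => u l + v l) by move=> l ld; rewrite su ?sv ?addr0.
have vipDr x : vip x (fun l => u l + v l) = vip x u + vip x v.
  rewrite (vipE _ sw) (vipE _ su) (vipE _ sv) -big_split /=.
  by apply: eq_bigr => l _; rewrite mulrDr.
set w := fun l => u l + v l in fw sw vipDr *.
have h : vsq w <= Num.sqrt (vsq w) * (Num.sqrt (vsq u) + Num.sqrt (vsq v)).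
  have e1 : vsq w = complex.Re (vip w w) by rewrite vip_vsq.
  rewrite [leLHS]e1 vipDr; apply: le_trans (Re_cn _) _; apply: le_trans (cnD _ _) _.
  by rewrite mulrDr lerD ?vip_cs.
have w0 := vsq_ge0 fw.
have [->|w1] := eqVneq (vsq w) 0; first exact: sqr_ge0.
have sw0 : 0 < Num.sqrt (vsq w) by rewrite sqrtr_gt0 lt_neqAle eq_sym w1.
have e := sqr_sqrtr w0.
rewrite -{1}e expr2 ler_pM2l // in h.
by rewrite -e ler_pXn2r ?nnegrE ?addr_ge0 ?sqrtr_ge0.
Qed.

(** For b >= 0 this says that M extends to l^2(Z) with operator norm at most b; finitely supported
    vectors suffice to test it. *)
Definition mbound M (b : R) := forall v, vfin v -> vsq (mact M v) <= b ^+ 2 * vsq v.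

Lemma mbound_le M b c : 0 <= b -> b <= c -> mbound M b -> mbound M c.
Proof.
move=> b0 bc bM v fv; apply: le_trans (bM v fv) _.
by rewrite ler_wpM2r ?vsq_ge0 // ler_pXn2r // nnegrE (le_trans b0).
Qed.

Lemma mboundP M b : 0 <= b -> mbound M b <->
  forall v, vfin v -> Num.sqrt (vsq (mact M v)) <= b * Num.sqrt (vsq v).
Proof.
move=> b0; split=> h v fv.
  rewrite -[X in X * _](ger0_norm b0) -sqrtr_sqr -sqrtrM ?sqr_ge0 //.
  by rewrite ler_wsqrtr // h.
have [m0|m0] := leP 0 (vsq (mact M v)); last first.
  by apply: le_trans (ltW m0) _; rewrite mulr_ge0 ?sqr_ge0 ?vsq_ge0.
rewrite -[leLHS]sqr_sqrtr // -[X in _ * X]sqr_sqrtr ?vsq_ge0 // -exprMn.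
by rewrite ler_pXn2r ?nnegrE ?mulr_ge0 ?sqrtr_ge0 // h.
Qed.

Lemma mboundD d M K b c : 0 <= b -> 0 <= c -> band d M -> band d K ->
  mbound M b -> mbound K c -> mbound (fun n l => M n l + K n l) (b + c).
Proof.
move=> b0 c0 dM dK bM cK v fv; have [e sv] := fv.
have -> : mact (fun n l => M n l + K n l) v = fun n => mact M v n + mact K v n.
  apply/funext => n; rewrite !(mactE _ _ sv) -big_split /=.
  by apply: eq_bigr => l _; rewrite mulrDl.
apply: le_trans (vsqD (mact_fin dM fv) (mact_fin dK fv)) _.
rewrite -[X in _ * X]sqr_sqrtr ?vsq_ge0 // -exprMn.
rewrite ler_pXn2r ?nnegrE ?addr_ge0 ?mulr_ge0 ?sqrtr_ge0 ?addr_ge0 // mulrDl.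
by rewrite lerD // (mboundP _ _).1.
Qed.
End BandedMatrices.

Section MatrixBounds.
Variable R : realType.
Local Notation C := (complex R).
Implicit Types (u v w : int -> C) (M K : int -> int -> C).

Lemma mboundZ d M (c : C) b : band d M -> mbound M b ->
  mbound (fun n l => c * M n l) (cn c * b).
Proof.
move=> dM bM v fv; have [e sv] := fv.
have -> : mact (fun n l => c * M n l) v = fun n => c * mact M v n.
  apply/funext => n; rewrite !(mactE _ _ sv) mulr_sumr.
  by apply: eq_bigr => l _; rewrite mulrA.
rewrite vsqZ; last exact: mact_fin dM fv.
by rewrite exprMn -[leRHS]mulrA ler_wpM2l ?sqr_ge0 // bM.
Qed.

Lemma mbound_mul d e M K b c : 0 <= b -> band d M -> band e K ->
  mbound M b -> mbound K c -> mbound (mmulm M K) (b * c).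
Proof.
move=> b0 dM eK bM cK v fv; rewrite (mact_mul dM eK fv).
apply: le_trans (bM _ (mact_fin eK fv)) _.
by rewrite exprMn -[leRHS]mulrA ler_wpM2l ?sqr_ge0 // cK.
Qed.

(** |Mv|^2 = <M^* M v, v> up to order of the factors, which Cauchy-Schwarz bounds by b |v|^2. This
    is the source of the C*-inequality for the reduced norm. *)
Lemma mbound_cstar d M b : 0 <= b -> band d M -> mbound (mmulm (madj M) M) b ->
  mbound M (Num.sqrt b).
Proof.
move=> b0 dM bM v fv; have fMv := mact_fin dM fv.
have -> : vsq (mact M v) = complex.Re (vip (mact M v) (mact M v)).
  by rewrite vip_vsq.
rewrite (vip_adj dM fMv fv) -(mact_mul (band_adj dM) dM fv).
apply: le_trans (Re_cn _) _.
apply: le_trans (vip_cs (mact_fin (band_mul (band_adj dM) dM) fv) fv) _.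
rewrite sqr_sqrtr // -[X in _ <= _ * X]sqr_sqrtr ?vsq_ge0 // expr2 mulrA.
rewrite ler_wpM2r ?sqrtr_ge0 //.
exact: (mboundP _ b0).1.
Qed.

Definition vdelta (k : int) : int -> C := fun l => (l == k)%:R.

Lemma supp_vdelta k : supp `|k| (vdelta k).
Proof. by move=> l; rewrite /vdelta; case: eqP => // ->; rewrite ltnn. Qed.

Lemma big_win_delta d (k : int) (V : nmodType) (F : int -> V) : (`|k| <= d)%N ->
  (forall l, l != k -> F l = 0) -> \sum_(l <- win d) F l = F k.
Proof.
by move=> kd F0; rewrite (bigD1_seq k) ?mem_win ?uniq_win //= big1 ?addr0.
Qed.

(** An entry is a coordinate of the image of a unit basis vector. *)
Lemma mbound_entry d M b n l : 0 <= b -> band d M -> mbound M b -> cn (M n l) <= b.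
Proof.
move=> b0 dM bM; have fv : vfin (vdelta l) by exists `|l|%N; apply: supp_vdelta.
have := bM _ fv.
have -> : mact M (vdelta l) = M^~ l.
  apply/funext => m; rewrite (mactE _ _ (@supp_vdelta l)).
  rewrite (big_win_delta (k := l)) // /vdelta ?eqxx ?mulr1 // => i /negPf ->.
  by rewrite mulr0.
have -> : vsq (vdelta l) = 1.
  rewrite (vsqE (@supp_vdelta l)) (big_win_delta (k := l)) // /vdelta ?eqxx ?cn1 ?expr1n //.
  by move=> i /negPf ->; rewrite cn0 expr0n.
have sM : supp (d + `|l|) (M^~ l) by move=> i il; rewrite dM //; lia.
rewrite mulr1 (vsqE sM) => h; rewrite -(@ler_pXn2r _ 2) ?nnegrE ?cn_ge0 //.
apply: le_trans h; have [nw|nw] := boolP (n \in win (d + `|l|)).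
  by rewrite (bigD1_seq n) ?uniq_win //= lerDl sumr_ge0 // => i _; rewrite sqr_ge0.
rewrite mem_win -ltnNge in nw; rewrite dM; last lia.
by rewrite cn0 expr0n sumr_ge0 // => i _; rewrite sqr_ge0.
Qed.

(** A matrix living on one diagonal is a weighted shift, whose norm is the supremum of the
    weights. *)
Lemma mbound_diag (k : int) M b : 0 <= b -> (forall n l, n - l != k -> M n l = 0) ->
  (forall n l, cn (M n l) <= b) -> mbound M b.
Proof.
move=> b0 M0 Mb v [d sv].
have bM : band `|k| M by move=> n l nl; apply: M0; lia.
have sw := supp_le (eq_leq (addnC _ _)) (mact_supp bM sv).
have E n : mact M v n = M n (n - k) * v (n - k).
  rewrite (mactE _ _ sv); have [nd|nd] := leqP `|n - k| d.
    rewrite (big_win_delta (k := n - k)) // => l lnk; rewrite M0 ?mul0r //; lia.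
  rewrite sv // mulr0 big_seq big1 // => l; rewrite mem_win => ld.
  by rewrite M0 ?mul0r //; lia.
rewrite (vsqE sw) (vsqE sv) mulr_sumr.
have s2 : supp d (fun l => b ^+ 2 * cn (v l) ^+ 2).
  by move=> l /sv ->; rewrite cn0 expr0n mulr0.
have := win_shift (- k) s2; rewrite abszN => <-; apply: ler_sum => n _.
rewrite E cnM exprMn ler_wpM2r ?sqr_ge0 //.
by rewrite ler_pXn2r ?nnegrE ?cn_ge0.
Qed.
End MatrixBounds.

(** * Powers of a partial automorphism *)

Section PartialPowers.
Variables (T : topologicalType) (Theta : partial_aut T).
Local Notation F := (pstep (pdom Theta) (pfun Theta)).
Local Notation G := (pstep (pran Theta) (Defs.pinv Theta)).
Local Notation ppow := (ppow Theta).

Lemma pstepE (D : set T) f x y : pstep D f x = Some y <-> D x /\ f x = y.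
Proof.
rewrite /pstep; case: asboolP => Dx; last by split=> // -[].
by split=> [[]|[_ ->]].
Qed.

Lemma pstepFG x y : F x = Some y <-> G y = Some x.
Proof.
rewrite !pstepE; split=> -[Dx <-].
  by split; [exact: pfunS|exact: pfunK].
by split; [exact: Defs.pinvS|exact: Defs.pinvK].
Qed.

Lemma ppowF k h z : F h = Some z -> ppow k z = ppow (k + 1) h.
Proof.
case: k => [n|n] Fh; first by rewrite -PoszD addn1 /Defs.ppow iterSr /= Fh.
(* [Negz n] stands for - (n + 1), so one step forward leaves n steps backward; n = 0 changes the
   constructor and is settled at the end. *)
rewrite NegzE -addn1 PoszD opprD -addrA addNr addr0.
have Gz : G z = Some h by apply/pstepFG.
have -> : ppow (- n%:Z - 1) z = iter n (obind G) (Some h).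
  by rewrite -opprD -PoszD addn1 -NegzE /Defs.ppow iterSr /= Gz.
by case: n => // n; rewrite -NegzE.
Qed.

Lemma ppowG k h z : G h = Some z -> ppow k z = ppow (k - 1) h.
Proof. by move=> /pstepFG /(ppowF (k - 1)) ->; rewrite subrK. Qed.

(** On the domain of theta^l the partial maps theta^k theta^l and theta^(k+l) agree, undefinedness
    included, even when k and l have opposite signs. Without that domain condition theta^(k+l) may
    be a proper extension. *)
Lemma ppowD l h z : ppow l h = Some z -> forall k, ppow k z = ppow (k + l) h.
Proof.
case: l => [n|n].
  elim: n z => [|n IH] z; first by move=> [<-] k; rewrite addr0.
  rewrite [ppow _ h]/(obind F (iter n (obind F) (Some h))).
  case E: (iter n _ _) => [w|//] Fw k.
  by rewrite (ppowF _ Fw) (IH _ E) -addrA -PoszD add1n.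
suff H : forall m z, iter m (obind G) (Some h) = Some z ->
    forall k, ppow k z = ppow (k - m%:Z) h.
  by move=> /H Hz k; rewrite Hz NegzE.
elim=> [|m IH] w; first by move=> [<-] k; rewrite subr0.
rewrite iterS; case E: (iter m _ _) => [y|//] Gy k.
by rewrite (ppowG _ Gy) (IH _ E) -addrA -opprD -PoszD add1n.
Qed.

Lemma ppowN l h z : ppow l h = Some z -> ppow (- l) z = Some h.
Proof. by move=> e; rewrite (ppowD e) addNr. Qed.

Lemma pstep_near (D : set T) f x y (W : set T) : open D ->
  {within D, continuous f} -> pstep D f x = Some y -> nbhs y W ->
  \forall t \near x, exists2 w, pstep D f t = Some w & W w.
Proof.
move=> oD cf /pstepE[Dx <-] nW.
have cfx : {for x, continuous f}.
  by move: cf; rewrite continuous_open_subspace //; apply; rewrite inE.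
near=> t; exists (f t); last by near: t; exact: cfx.
by apply/pstepE; split=> //; near: t; apply: open_nbhs_nbhs.
Unshelve. all: by end_near. Qed.

Lemma iter_near (f : T -> option T) :
  (forall x y (W : set T), f x = Some y -> nbhs y W ->
     \forall t \near x, exists2 w, f t = Some w & W w) ->
  forall n x y (W : set T), iter n (obind f) (Some x) = Some y -> nbhs y W ->
     \forall t \near x, exists2 w, iter n (obind f) (Some t) = Some w & W w.
Proof.
move=> hf; elim=> [|n IH] x y W; first by move=> [->] yW; near=> t; exists t => //; near: t.
rewrite iterS; case E: (iter n _ _) => [w|] //= fw yW.
have := IH _ _ _ E (hf _ _ _ fw yW).
by apply: filterS => t [v vE [u uE Wu]]; exists u => //; rewrite vE.
Unshelve. all: by end_near. Qed.

Lemma ppow_near l h z (W : set T) : ppow l h = Some z -> nbhs z W ->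
  \forall t \near h, exists2 w, ppow l t = Some w & W w.
Proof.
have nF x y (V : set T) : F x = Some y -> nbhs y V ->
    \forall t \near x, exists2 w, F t = Some w & V w.
  exact: pstep_near (open_pdom _) (@cts_pfun _ Theta).
have nG x y (V : set T) : G x = Some y -> nbhs y V ->
    \forall t \near x, exists2 w, G t = Some w & V w.
  exact: pstep_near (open_pran _) (@cts_pinv _ Theta).
by case: l => n e; [exact: (iter_near nF e)|exact: (iter_near nG (n := n.+1) e)].
Qed.

Lemma HdomP k x : Hdom Theta k x <-> exists z, ppow k x = Some z.
Proof.
rewrite /Hdom /=; case: (ppow k x) => [z|]; split=> //; first by exists z.
by move=> [].
Qed.

Lemma Hdom_near k x : Hdom Theta k x -> \forall t \near x, Hdom Theta k t.
Proof.
move=> /HdomP[z zE]; have zT : nbhs z setT by exact: filterT.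
have := ppow_near zE zT.
by apply: filterS => t [w wE _]; apply/HdomP; exists w.
Qed.

Lemma Hdom_open k : open (Hdom Theta k).
Proof. by rewrite openE => x /Hdom_near. Qed.

Lemma ppow_inv (S : T -> Prop) : (forall x, pdom Theta x -> S x <-> S (pfun Theta x)) ->
  forall k x z, ppow k x = Some z -> S x <-> S z.
Proof.
move=> SI.
have SF x z : F x = Some z -> S x <-> S z by move=> /pstepE[Dx <-]; exact: SI.
have SG x z : G x = Some z -> S x <-> S z by move=> /pstepFG /SF ->.
have SIt f n : (forall x z, f x = Some z -> S x <-> S z) ->
    forall x z, iter n (obind f) (Some x) = Some z -> S x <-> S z.
  move=> Sf; elim: n => [|n IH] x z; first by move=> [->].
  by rewrite iterS; case E: (iter n _ _) => [w|] //= /Sf <-; apply: IH.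
by case=> n x z; [exact: SIt SF _ _|exact: SIt SG _ _].
Qed.
End PartialPowers.

(** * Functions vanishing at infinity *)

Section VanishingAtInfinity.
Variables (R : realType) (T : topologicalType).
Implicit Types (f g : T -> Cplx R) (U : set T) (e : R).

Lemma cplx_nbhs (z : Cplx R) (U : set (Cplx R)) : nbhs z U <->
  exists2 e : R, 0 < e & forall w : Cplx R, cn (w - z) < e -> U w.
Proof.
split=> [/nbhs_ballP[e /= /cplx_gt0[r r0 ->] rU]|[e e0 eU]].
  exists r => // w wz; apply: rU; rewrite -ball_normE /ball_ /= distrC.
  by rewrite cn_lt.
apply/nbhs_ballP; exists (real_complex R e) => /=; first by rewrite ltcR.
move=> w; rewrite -ball_normE /ball_ /= distrC cn_lt; exact: eU.
Qed.

Lemma cts_atP f x : {for x, continuous f} <->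
  forall e, 0 < e -> \forall t \near x, cn (f t - f x) < e.
Proof.
split=> [cf e e0|h U /cplx_nbhs[e e0 eU]].
  by apply: (cf [set w : Cplx R | cn (w - f x) < e]); apply/cplx_nbhs; exists e.
have := h e e0; apply: filterS => t; exact: eU.
Qed.

Lemma cn_dist (z w : complex R) : `|cn z - cn w| <= cn (z - w).
Proof.
rewrite ler_norml lerNl opprB !lerBlDr; apply/andP; split.
  by have := cnD (w - z) z; rewrite subrK cnB.
by have := cnD (z - w) w; rewrite subrK.
Qed.

Lemma closed_cn_ge f e : continuous f -> closed [set x | e <= cn (f x)].
Proof.
move=> cf; rewrite -[X in closed X]setCK; apply: open_closedC.
rewrite openE => x /= /negP; rewrite -ltNge => fx.
have /cts_atP/(_ (e - cn (f x))) := cf x; rewrite subr_gt0 => /(_ fx).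
apply: filterS => t h /=; apply/negP; rewrite -ltNge.
by have := le_lt_trans (le_trans (ler_norm _) (cn_dist _ _)) h; rewrite ltrBlDr subrK.
Qed.

Lemma C0_cts U f : C0 R U f -> continuous f. Proof. by case. Qed.

Lemma C0_small U f e : C0 R U f -> 0 < e -> exists2 K : set T, compact K /\ K `<=` U &
  forall x, ~ K x -> cn (f x) < e.
Proof.
move=> [_ hf] e0; have [|K KU h] := hf (real_complex R e); first by rewrite ltcR.
by exists K => // x /h; rewrite cn_lt.
Qed.

Lemma C0_out U f x : C0 R U f -> ~ U x -> f x = 0.
Proof.
move=> fU Ux; apply/eqP; rewrite -cn_eq0 eq_le cn_ge0 andbT.
apply/ler_addgt0Pr => e e0; rewrite add0r.
by have [K [_ KU] h] := C0_small fU e0; apply/ltW/h => /KU.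
Qed.

Lemma C0_compact U f e : C0 R U f -> 0 < e ->
  compact [set x | e <= cn (f x)] /\ [set x | e <= cn (f x)] `<=` U.
Proof.
move=> fU e0; have [K [cK KU] h] := C0_small fU e0; split.
  apply: (subclosed_compact _ cK); first exact: closed_cn_ge (C0_cts fU).
  move=> x /= ex.
  by apply: contrapT => /h; rewrite ltNge ex.
move=> x /= ex; apply: contrapT => /(C0_out fU) f0.
by move: ex; rewrite f0 cn0 leNgt e0.
Qed.

(** The given compact sets need not lie in [U]: the superlevel sets of |f| are closed in them, and
    lie in [U] because f vanishes elsewhere. *)
Lemma C0_intro U f : continuous f -> (forall x, ~ U x -> f x = 0) ->
  (forall e, 0 < e -> exists2 K : set T, compact K & forall x, ~ K x -> cn (f x) < e) ->
  C0 R U f.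
Proof.
move=> cf f0 hf; split=> // e /cplx_gt0[r r0 ->]; have [K cK h] := hf r r0.
exists [set x | r <= cn (f x)]; first split.
- apply: (subclosed_compact _ cK); first exact: closed_cn_ge cf.
  move=> x /= rx.
  by apply: contrapT => /h; rewrite ltNge rx.
- move=> x /= rx; apply: contrapT => /f0 fx.
  by move: rx; rewrite fx cn0 leNgt r0.
- by move=> x /= /negP; rewrite -ltNge cn_lt.
Qed.

Lemma C0_subset U W f : U `<=` W -> C0 R U f -> C0 R W f.
Proof.
move=> UW fU; split=> [|e e0]; first exact: C0_cts fU.
by have [K [cK KU] h] := fU.2 e e0; exists K => //; split=> // x /KU /UW.
Qed.

Lemma C0_bound U f : C0 R U f -> exists2 M : R, 0 < M & forall x, cn (f x) <= M.
Proof.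
move=> fU; have [cK _] := C0_compact fU ltr01.
(* Near x the function is bounded by |f(x)| + 1; the near-covering form of compactness yields one
   bound for all points of the superlevel set, as the bound M tends to infinity. *)
have /compact_near_coveringP h := cK.
have : \forall M \near +oo, [set x | 1 <= cn (f x)] `<=` (fun x => cn (f x) <= M).
  have cf := C0_cts fU; apply: h => x _; have /cts_atP/(_ 1 ltr01) hx := cf x.
  near=> t M => /=.
  have : cn (f t - f x) < 1 by near: t.
  have : cn (f x) + 1 <= M by near: M; apply: nbhs_pinfty_ge; rewrite num_real.
  by have := cnD (f t - f x) (f x); rewrite subrK; lra.
move=> [N [_ hN]]; set M := Num.max 1 (N + 1).
have M1 : 1 <= M by rewrite le_max lexx.
have MK : [set x | 1 <= cn (f x)] `<=` (fun x => cn (f x) <= M).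
  by apply: hN; rewrite lt_max ltrDl ltr01 orbT.
exists M => [|x]; first exact: lt_le_trans ltr01 M1.
have [f1|f1] := leP 1 (cn (f x)); first exact: MK.
exact: le_trans (ltW f1) M1.
Unshelve. all: by end_near. Qed.

Lemma cts_lin_at f g (c : complex R) h : {for h, continuous f} ->
  {for h, continuous g} -> {for h, continuous (fun x => c * f x + g x : Cplx R)}.
Proof.
move=> cf cg; apply/cts_atP => e e0.
have c0 : 0 < cn c + 1 by rewrite ltr_wpDl ?cn_ge0.
have /cts_atP/(_ (e / 2 / (cn c + 1))) := cf; rewrite !divr_gt0 // => /(_ isT) h1.
have /cts_atP/(_ (e / 2)) := cg; rewrite divr_gt0 // => /(_ isT) h2.
near=> t.
have -> : c * f t + g t - (c * f h + g h) = c * (f t - f h) + (g t - g h).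
  by rewrite mulrBr opprD addrACA.
apply: le_lt_trans (cnD _ _) _; rewrite cnM [ltRHS]splitr; apply: ler_ltD.
  have : cn (f t - f h) < e / 2 / (cn c + 1) by near: t.
  rewrite ltr_pdivlMr // => /ltW; apply: le_trans.
  by rewrite mulrC ler_wpM2l ?cn_ge0 // lerDl.
by near: t.
Unshelve. all: by end_near. Qed.

Lemma cts_lin f g (c : complex R) : continuous f -> continuous g ->
  continuous (fun x => c * f x + g x : Cplx R).
Proof. by move=> cf cg x; apply: cts_lin_at; [exact: cf|exact: cg]. Qed.

Lemma cts_mul_at f g x : {for x, continuous f} -> {for x, continuous g} ->
  {for x, continuous (fun x => f x * g x : Cplx R)}.
Proof.
move=> /cts_atP cf /cts_atP cg; apply/cts_atP => e e0.
set M := cn (f x) + cn (g x) + 1.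
have M0 : 0 < M by rewrite ltr_wpDl // addr_ge0 ?cn_ge0.
have d0 : 0 < Num.min 1 (e / 2 / M) by rewrite lt_min ltr01 !divr_gt0.
have h1 := cf _ d0; have h2 := cg _ d0.
near=> t.
have k1 : cn (f t - f x) < Num.min 1 (e / 2 / M) by near: t.
have k2 : cn (g t - g x) < Num.min 1 (e / 2 / M) by near: t.
have -> : f t * g t - f x * g x = f t * (g t - g x) + (f t - f x) * g x.
  by rewrite mulrBr mulrBl addrA subrK.
apply: le_lt_trans (cnD _ _) _; rewrite !cnM.
move: k1 k2; rewrite !lt_min !ltr_pdivlMr // => /andP[a1 a2] /andP[b1 b2].
have ft : cn (f t) <= cn (f x) + 1.
  have := cnD (f t - f x) (f x); rewrite subrK; lra.
have := cn_ge0 (f x); have := cn_ge0 (g x).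
have := cn_ge0 (f t - f x); have := cn_ge0 (g t - g x).
move: a1 a2 b1 b2 ft; rewrite /M.
move: (cn (f t - f x)) (cn (g t - g x)) (cn (f t)) (cn (f x)) (cn (g x)).
move=> a b c p q a1 a2 b1 b2 ft b0 a0 q0 p0.
have h3 : c * b <= (p + 1) * b by rewrite ler_wpM2r.
nra.
Unshelve. all: by end_near. Qed.

Lemma cts_mul f g : continuous f -> continuous g ->
  continuous (fun x => f x * g x : Cplx R).
Proof. by move=> cf cg x; apply: cts_mul_at; [exact: cf|exact: cg]. Qed.

Lemma cts_conj_at f x : {for x, continuous f} ->
  {for x, continuous (fun x => cconj (f x))}.
Proof.
move=> /cts_atP cf; apply/cts_atP => e /cf.
by apply: filterS => t; rewrite /cconj -rmorphB cn_conj.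
Qed.

Lemma cts_conj f : continuous f -> continuous (fun x => cconj (f x)).
Proof. by move=> cf x; apply: cts_conj_at; exact: cf. Qed.

Lemma cts_real (r : T -> R) : continuous r ->
  continuous (fun x => real_complex R (r x) : Cplx R).
Proof.
move=> cr x; apply/cts_atP => e e0; have /cvgrPdist_lt/(_ e e0) := cr x.
by apply: filterS => t; rewrite -rmorphB cn_real distrC.
Qed.

Lemma cts_cst (c : complex R) : continuous (fun _ : T => c : Cplx R).
Proof. by move=> x; apply/cts_atP => e e0; apply: nearW => t; rewrite subrr cn0. Qed.

Lemma C0_zero U : C0 R U 0.
Proof.
apply: C0_intro => // [|e e0]; first exact: cts_cst.
by exists set0; [exact: compact0|move=> x _; rewrite cn0].
Qed.

Lemma C0_lin U f g (c : complex R) : C0 R U f -> C0 R U g ->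
  C0 R U (fun x => c * f x + g x).
Proof.
move=> fU gU; apply: C0_intro.
- by apply: cts_lin; [exact: C0_cts fU|exact: C0_cts gU].
- by move=> x Ux; rewrite (C0_out fU Ux) (C0_out gU Ux) mulr0 addr0.
move=> e e0; have c0 : 0 < cn c + 1 by rewrite ltr_wpDl ?cn_ge0.
have e1 : 0 < e / 2 / (cn c + 1) by rewrite !divr_gt0.
have e2 : 0 < e / 2 by rewrite divr_gt0.
have [K [cK _] hK] := C0_small fU e1; have [L [cL _] hL] := C0_small gU e2.
exists (K `|` L); first exact: compactU.
move=> x /not_orP[/hK Kx /hL Lx]; apply: le_lt_trans (cnD _ _) _.
rewrite cnM [ltRHS]splitr; apply: ler_ltD => //.
move: Kx; rewrite ltr_pdivlMr // => /ltW; apply: le_trans.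
by rewrite mulrC ler_wpM2l ?cn_ge0 // lerDl.
Qed.

Lemma C0_dom U W f g (M : R) : 0 < M -> C0 R W g -> continuous f ->
  (forall x, ~ U x -> f x = 0) -> (forall x, cn (f x) <= M * cn (g x)) -> C0 R U f.
Proof.
move=> M0 gW cf f0 fg; apply: C0_intro => // e e0.
have [|K [cK _] h] := @C0_small W g (e / M) gW; first by rewrite divr_gt0.
exists K => // x /h; rewrite ltr_pdivlMr // mulrC; exact: le_lt_trans (fg x).
Qed.

Lemma C0_mulb U f g (M : R) : continuous g -> (forall x, cn (g x) <= M) ->
  C0 R U f -> C0 R U (fun x => g x * f x).
Proof.
move=> cg gM fU; apply: (@C0_dom U U _ f (`|M| + 1)).
- by rewrite ltr_wpDl.
- exact: fU.
- exact: cts_mul cg (C0_cts fU).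
- by move=> x Ux; rewrite (C0_out fU Ux) mulr0.
- move=> x; rewrite cnM ler_wpM2r ?cn_ge0 //; apply: le_trans (gM x) _.
  by apply: le_trans (ler_norm _) _; rewrite lerDl.
Qed.

Lemma C0_mul U f g : C0 R U f -> C0 R U g -> C0 R U (fun x => f x * g x).
Proof.
move=> fU gU; have [M _ hM] := C0_bound fU.
by apply: C0_mulb hM gU; exact: C0_cts fU.
Qed.

Lemma C0_conj U f : C0 R U f -> C0 R U (fun x => cconj (f x)).
Proof.
move=> fU; apply: (@C0_dom U U _ f 1).
- exact: ltr01.
- exact: fU.
- exact: cts_conj (C0_cts fU).
- by move=> x Ux; rewrite (C0_out fU Ux) /cconj conjC0.
- by move=> x; rewrite mul1r /cconj cn_conj.
Qed.

Lemma C0_sum U I (s : seq I) (P : pred I) (F : I -> T -> Cplx R) :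
  (forall i, P i -> C0 R U (F i)) -> C0 R U (\sum_(i <- s | P i) F i).
Proof.
move=> hF; elim/big_ind: _ => //; first exact: C0_zero.
move=> f g fU gU; have := C0_lin 1 fU gU.
by under eq_fun do rewrite mul1r.
Qed.
End VanishingAtInfinity.

(** * The *-algebra of finite sums and its regular representations *)

Section CrossedProductAlgebra.
Variables (R : realType) (T : topologicalType) (Theta : partial_aut T).
Local Notation C := (complex R).
Local Notation xel := (int -> T -> Cplx R).
Local Notation ppow := (ppow Theta).
Local Notation Hdom := (Hdom Theta).
Local Notation pull := (@pull R T Theta).
Implicit Types (a b c : xel) (f g : T -> Cplx R) (k l n : int).

Lemma pull_some l f h z : ppow l h = Some z -> pull l f h = f z.
Proof. by rewrite /Defs.pull => ->. Qed.

Lemma pull_none l f h : ppow l h = None -> pull l f h = 0.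
Proof. by rewrite /Defs.pull => ->. Qed.

Lemma pull_cts_at l f h z : continuous f -> ppow l h = Some z ->
  {for h, continuous (pull l f)}.
Proof.
move=> cf hz; apply/cts_atP => e e0; have /cts_atP/(_ e e0) fz := cf z.
have := ppow_near hz fz; apply: filterS => t [w tw].
by rewrite (pull_some _ tw) (pull_some _ hz).
Qed.

(** Turns the defining product theta^l(f theta^-l(g)) into (f o theta^l) g, so that [xmul] becomes a
    convolution. *)
Lemma pull_mul l f g h :
  pull l (fun x => f x * pull (- l) g x) h = pull l f h * g h.
Proof.
case E : (ppow l h) => [z|]; last by rewrite !pull_none // mul0r.
by rewrite !(pull_some _ E) (pull_some _ (ppowN E)).
Qed.

(** [pull l f] may jump at the boundary of the domain of theta^l. There g vanishes, and the product
    is dominated by a multiple of |g|, which restores continuity. *)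
Lemma C0_pull_mul k l f g : C0 R (Hdom k) f -> C0 R (Hdom l) g ->
  C0 R (Hdom (k + l)) (fun h => pull l f h * g h).
Proof.
move=> fk gl; have [M M0 fM] := C0_bound fk.
have bound h : cn (pull l f h * g h) <= M * cn (g h).
  rewrite cnM ler_wpM2r ?cn_ge0 //.
  case E : (ppow l h) => [z|]; first by rewrite (pull_some _ E).
  by rewrite pull_none // cn0 ltW.
apply: (C0_dom M0 gl); last exact: bound.
- move=> h; have [/HdomP[z hz]|hl] := pselect (Hdom l h).
    apply: cts_mul_at; first exact: pull_cts_at (C0_cts fk) hz.
    exact: (C0_cts gl).
  apply/cts_atP => e e0; have cg := C0_cts gl.
  have /cts_atP/(_ (e / M)) := cg h; rewrite divr_gt0 // => /(_ isT).
  apply: filterS => t; rewrite (C0_out gl hl) mulr0 !subr0 ltr_pdivlMr // mulrC.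
  exact: le_lt_trans (bound t).
- move=> h hkl; case E : (ppow l h) => [z|]; last by rewrite pull_none // mul0r.
  rewrite (pull_some _ E) (C0_out fk) ?mul0r // => /HdomP[w zw]; apply: hkl.
  by apply/HdomP; exists w; rewrite -(ppowD E).
Qed.

Hypothesis hT : hausdorff_space T.

(** The superlevel sets of f are compact in the domain of theta^-n, so their images under theta^-n
    are compact, hence closed. Outside such an image the pulled back function is small, which gives
    continuity at points where theta^n is undefined. *)
Lemma C0_pull n f : C0 R (Hdom (- n)) f -> C0 R (Hdom n) (pull n f).
Proof.
move=> fn.
(* A total version of theta^-n, applied only to superlevel sets, on which the default never
   occurs. *)
pose back (z : T) := odflt z (ppow (- n) z).
have key (e : R) : 0 < e -> compact (back @` [set z | e <= cn (f z)]) /\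
    forall t, ~ (back @` [set z | e <= cn (f z)]) t -> cn (pull n f t) < e.
  move=> e0; have [cK KU] := C0_compact fn e0; split.
    apply: continuous_compact cK; apply: continuous_in_subspaceT => z.
    rewrite inE => /KU /HdomP[x zx] W; rewrite /= /nbhs /= {1}/back zx /= => xW.
    have := ppow_near zx xW; apply: filterS => t [w tw Ww].
    by rewrite /= /back tw.
  move=> t tK; case E : (ppow n t) => [z|]; last by rewrite pull_none // cn0.
  rewrite (pull_some _ E) ltNge; apply/negP => ez; apply: tK.
  by exists z => //; rewrite /back (ppowN E).
apply: C0_intro.
- move=> h; have [/HdomP[z hz]|hn] := pselect (Hdom n h).
    exact: pull_cts_at (C0_cts fn) hz.
  have h0 : pull n f h = 0.
    case E : (ppow n h) => [z|]; last exact: pull_none.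
    by case: hn; apply/HdomP; exists z.
  apply/cts_atP => e e0; have [cL hL] := key e e0.
  have : open (~` (back @` [set z | e <= cn (f z)])).
    by apply: closed_openC; apply: compact_closed.
  rewrite openE => /(_ h); rewrite /interior /= => oL.
  have : nbhs h (~` (back @` [set z | e <= cn (f z)])).
    apply: oL => -[z /= ez]; rewrite /back.
    have /HdomP[x zx] : Hdom (- n) z by apply: (C0_compact fn e0).2.
    rewrite zx /= => xh; apply: hn; apply/HdomP; exists z.
    by rewrite -xh -(opprK n); apply: ppowN.
  by apply: filterS => t /hL; rewrite h0 subr0.
- move=> x hx; case E : (ppow n x) => [z|]; last exact: pull_none.
  by case: hx; apply/HdomP; exists z.
- by move=> e /key[cL hL]; exists (back @` [set z | e <= cn (f z)]).
Qed.

(* The matrix, in the basis indexed by Z, of the regular representation of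
   xalg at the point h. *)
Definition regmx (h : T) a : int -> int -> C := fun n l => pull l (a (n - l)) h.

Lemma xalg_supp a : xalg R Theta a -> exists d, supp d a.
Proof. by move=> [_ /finite_suppP]. Qed.

Lemma xalg_C0 a k : xalg R Theta a -> C0 R (Hdom k) (a k).
Proof. by case. Qed.

Lemma xmulE a b d n : supp d b ->
  xmul Theta a b n = \sum_(l <- win d) (fun h => regmx h a n l * b l h : Cplx R).
Proof.
move=> sb; rewrite /xmul.
have E l : pull l (fun x => a (n - l) x * pull (- l) (b l) x) =
    (fun h => regmx h a n l * b l h).
  by apply/funext => h; rewrite pull_mul.
rewrite (eq_fsbigr (fun l h => regmx h a n l * b l h : Cplx R)); last first.
  by move=> l _; exact: E.
by apply: fsum_win => l /sb ->; apply/funext => h; rewrite mulr0.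
Qed.

Lemma sum_pt (I : Type) (s : seq I) (P : pred I) (F : I -> T -> Cplx R) h :
  (\sum_(i <- s | P i) F i) h = \sum_(i <- s | P i) F i h.
Proof. by elim/big_rec2: _ => // i f g _ <-. Qed.

Lemma supp_pt d a h : supp d a -> supp d (fun l => a l h).
Proof. by move=> sa l /sa ->. Qed.

Lemma xmul_mact a b d n h : supp d b ->
  xmul Theta a b n h = mact (regmx h a) (fun l => b l h) n.
Proof. by move=> sb; rewrite (xmulE _ _ sb) sum_pt (mactE _ _ (supp_pt _ sb)). Qed.

Lemma regmx_band d a h : supp d a -> band d (regmx h a).
Proof.
move=> sa n l nl; rewrite /regmx sa // /Defs.pull.
by case: (ppow l h).
Qed.

(** Column 0 of the matrix at h lists the values a k h. Identities in the algebra can therefore be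
    checked on matrices. *)
Lemma regmx_inj a b : (forall h, regmx h a = regmx h b) -> a = b.
Proof.
move=> e; apply/funext => k; apply/funext => h.
by have := congr1 (fun M => M k 0) (e h); rewrite /regmx subr0.
Qed.

Lemma regmx_lin (z : C) a b h n l : regmx h (z *: a + b) n l = z * regmx h a n l + regmx h b n l.
Proof.
rewrite /regmx; case E : (ppow l h) => [x|]; first by rewrite !(pull_some _ E).
by rewrite !pull_none // mulr0 addr0.
Qed.

(** Covariance: if z = theta^l h, the matrix at z is the matrix at h with both indices shifted by l,
    which gives the reindexing i = j + l. If theta^l h is undefined, column l vanishes on both
    sides. *)
Lemma regmx_mul a b d e h : supp d a -> supp e b ->
  regmx h (xmul Theta a b) = mmulm (regmx h a) (regmx h b).
Proof.
move=> sa sb; apply/funext => n; apply/funext => l; rewrite [LHS]/regmx.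
have bB := regmx_band h sb.
case E : (ppow l h) => [z|]; last first.
  rewrite pull_none // (mmulmE _ _ _ bB) big1 // => i _.
  by rewrite [regmx h b i l]/regmx pull_none // mulr0.
rewrite (pull_some _ E) (xmul_mact _ _ _ sb) (mactE _ _ (supp_pt _ sb)).
rewrite (mmulmE _ _ _ bB).
pose G i := regmx h a n i * regmx h b i l.
have sG : supp (e + `|l|) G by move=> i il; rewrite /G bB ?mulr0 //; lia.
have s2 : supp e (fun j => regmx z a (n - l) j * b j z).
  by move=> j /(supp_pt z sb) ->; rewrite mulr0.
rewrite -(win_shift l sG) -(win_widen _ s2 (e := e + `|l| + `|l|)); last first.
  by rewrite -addnA leq_addr.
apply: eq_bigr => j _; rewrite /G /regmx addrK (pull_some _ E); congr (_ * _).
have -> : n - (j + l) = n - l - j by lia.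
by rewrite /Defs.pull (ppowD E).
Qed.

Lemma regmx_star a h : xalg R Theta a -> regmx h (xstar Theta a) = madj (regmx h a).
Proof.
move=> xa; apply/funext => n; apply/funext => l; rewrite /madj /regmx /xstar.
have nl : n - l = - (l - n) by rewrite opprB.
case E : (ppow l h) => [z|].
  rewrite (pull_some _ E) /Defs.pull (ppowD E) subrK.
  by case: (ppow n h) => [w|]; rewrite ?conjC0 // nl opprK.
(* Here theta^l h is undefined while theta^n h may exist. Then theta^n h lies outside the domain of
   theta^(l-n), where the coefficient of degree l - n vanishes. *)
rewrite pull_none //; case E2 : (ppow n h) => [z|]; last by rewrite pull_none // conjC0.
rewrite (pull_some _ E2) (C0_out (xalg_C0 _ xa)) ?conjC0 // => /HdomP[w].
by rewrite (ppowD E2) subrK E.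
Qed.

Lemma regmx_smono k g h n l :
  regmx h (smono k g) n l = if n - l == k then pull l g h else 0.
Proof.
rewrite /regmx /smono; case: ifP => // _.
by rewrite /Defs.pull; case: (ppow l h).
Qed.

Lemma xalg0 : xalg R Theta 0.
Proof.
split=> [k|]; first exact: C0_zero.
by apply/finite_suppP; exists 0%N.
Qed.

Lemma supp_lin (V : lmodType C) d e (z : C) (a b : int -> V) : supp d a -> supp e b ->
  supp (maxn d e) (z *: a + b).
Proof.
move=> sa sb l; rewrite gtn_max => /andP[/sa al /sb bl].
by rewrite -[LHS]/(z *: a l + b l) al bl scaler0 addr0.
Qed.

Lemma xalg_lin (z : C) a b : xalg R Theta a -> xalg R Theta b ->
  xalg R Theta (z *: a + b).
Proof.
move=> xa xb; split=> [k|]; first exact: C0_lin (xalg_C0 k xa) (xalg_C0 k xb).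
have [d sa] := xalg_supp xa; have [e sb] := xalg_supp xb.
by apply/finite_suppP; exists (maxn d e); apply: supp_lin.
Qed.

Lemma supp_xmul d e a b : supp d a -> supp e b -> supp (d + e) (xmul Theta a b).
Proof.
move=> sa sb n nd; apply/funext => h; rewrite (xmul_mact _ _ _ sb).
by rewrite (mact_supp (regmx_band h sa) (supp_pt h sb)).
Qed.

Lemma supp_xstar d a : supp d a -> supp d (xstar Theta a).
Proof.
move=> sa n nd; apply/funext => h; rewrite /xstar sa ?abszN //.
by rewrite /Defs.pull; case: (ppow n h) => // z; rewrite /cconj conjC0.
Qed.

Lemma xalg_mul a b : xalg R Theta a -> xalg R Theta b -> xalg R Theta (xmul Theta a b).
Proof.
move=> xa xb; have [d sa] := xalg_supp xa; have [e sb] := xalg_supp xb; split=> [n|].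
  rewrite (xmulE _ _ sb); apply: C0_sum => l _.
  rewrite -{1}(subrK l n).
  exact: C0_pull_mul (xalg_C0 _ xa) (xalg_C0 _ xb).
by apply/finite_suppP; exists (d + e)%N; apply: supp_xmul.
Qed.

Lemma xalg_star a : xalg R Theta a -> xalg R Theta (xstar Theta a).
Proof.
move=> xa; have [d sa] := xalg_supp xa; split=> [n|].
  exact/C0_pull/C0_conj/xalg_C0.
by apply/finite_suppP; exists d; apply: supp_xstar.
Qed.

Lemma xalg_mono k g : C0 R (Hdom k) g -> xalg R Theta (smono k g).
Proof.
move=> gk; split=> [n|]; first by rewrite /smono; case: eqP => [->|_] //; exact: C0_zero.
apply/finite_suppP; exists `|k|%N => l; rewrite /smono; case: eqP => // ->.
by rewrite ltnn.
Qed.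

Lemma xmulA a b c : xalg R Theta a -> xalg R Theta b -> xalg R Theta c ->
  xmul Theta a (xmul Theta b c) = xmul Theta (xmul Theta a b) c.
Proof.
move=> /xalg_supp[d sa] /xalg_supp[e sb] /xalg_supp[i sc].
apply/funext => n; apply/funext => h.
rewrite (xmul_mact _ _ _ (supp_xmul sb sc)) (xmul_mact _ _ _ sc) (regmx_mul _ sa sb).
rewrite (mact_mul (regmx_band h sa) (regmx_band h sb)); last by exists i; apply: supp_pt.
by congr (mact _ _ _); apply/funext => l; rewrite (xmul_mact _ _ _ sc).
Qed.

Lemma xmul_linl (z : C) a b c : xalg R Theta c ->
  xmul Theta (z *: a + b) c = z *: xmul Theta a c + xmul Theta b c.
Proof.
move=> /xalg_supp[i sc]; apply/funext => n; apply/funext => h.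
rewrite -[RHS]/(z * xmul Theta a c n h + xmul Theta b c n h).
rewrite !(xmul_mact _ _ _ sc) !(mactE _ _ (supp_pt _ sc)) mulr_sumr -big_split /=.
by apply: eq_bigr => l _; rewrite regmx_lin mulrDl mulrA.
Qed.

Lemma xmul_linr (z : C) a b c : xalg R Theta a -> xalg R Theta b ->
  xmul Theta c (z *: a + b) = z *: xmul Theta c a + xmul Theta c b.
Proof.
move=> /xalg_supp[d sa] /xalg_supp[e sb]; apply/funext => n; apply/funext => h.
have sab := supp_lin z sa sb.
rewrite -[RHS]/(z * xmul Theta c a n h + xmul Theta c b n h).
have sa' := supp_le (leq_maxl d e) sa; have sb' := supp_le (leq_maxr d e) sb.
rewrite (xmul_mact _ _ _ sab) (xmul_mact _ _ _ sa') (xmul_mact _ _ _ sb').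
rewrite (mactE _ _ (supp_pt _ sab)) (mactE _ _ (supp_pt _ sa')).
rewrite (mactE _ _ (supp_pt _ sb')) mulr_sumr -big_split /=.
by apply: eq_bigr => l _; rewrite mulrDr mulrCA.
Qed.

Lemma madj_mul d e (M K : int -> int -> C) : band d M -> band e K ->
  madj (mmulm M K) = mmulm (madj K) (madj M).
Proof.
move=> bM bK; apply/funext => n; apply/funext => l.
rewrite /madj (mmulmE _ _ _ bK) (mmulmE _ _ _ (band_adj bM)) rmorph_sum /=.
transitivity (\sum_(i <- win (d + `|l| + (e + `|n|))) Num.conj (M l i * K i n)).
  rewrite (@win_widen _ (e + `|n|) (d + `|l| + (e + `|n|))) ?leq_addl //.
    by move=> i il; rewrite bK ?mulr0 ?conjC0 //; lia.
rewrite (@win_widen _ (d + `|l|) (d + `|l| + (e + `|n|))) ?leq_addr //.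
  by apply: eq_bigr => i _; rewrite rmorphM mulrC.
by move=> i il; rewrite bM ?mul0r ?conjC0 //; lia.
Qed.

Lemma xstar_lin (z : C) a b :
  xstar Theta (z *: a + b) = Num.conj z *: xstar Theta a + xstar Theta b.
Proof.
apply/funext => n; apply/funext => h; rewrite /xstar.
rewrite -[RHS]/(Num.conj z * pull n (fun x => cconj (a (- n) x)) h +
                pull n (fun x => cconj (b (- n) x)) h).
case E : (ppow n h) => [w|]; last by rewrite !pull_none // mulr0 addr0.
by rewrite !(pull_some _ E) /cconj rmorphD rmorphM.
Qed.

Lemma xstarM a b : xalg R Theta a -> xalg R Theta b ->
  xstar Theta (xmul Theta a b) = xmul Theta (xstar Theta b) (xstar Theta a).
Proof.
move=> xa xb; have [d sa] := xalg_supp xa; have [e sb] := xalg_supp xb.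
apply: regmx_inj => h; rewrite regmx_star; last exact: xalg_mul.
rewrite (regmx_mul _ sa sb) (regmx_mul _ (supp_xstar sb) (supp_xstar sa)) !regmx_star //.
by rewrite (madj_mul (regmx_band h sa) (regmx_band h sb)).
Qed.

Lemma xstarK a : xalg R Theta a -> xstar Theta (xstar Theta a) = a.
Proof.
move=> xa; apply: regmx_inj => h; rewrite !regmx_star //; last exact: xalg_star.
by apply/funext => n; apply/funext => l; rewrite /madj conjCK.
Qed.
End CrossedProductAlgebra.

(** * The reduced norm *)

Section ReducedNorm.
Variables (R : realType) (T : topologicalType) (Theta : partial_aut T).
Local Notation C := (complex R).
Local Notation xel := (int -> T -> Cplx R).
Local Notation ppow := (ppow Theta).
Local Notation xalg := (xalg R Theta).
Local Notation rmx := (regmx Theta).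
Local Notation xmul := (xmul Theta).
Local Notation xstar := (xstar Theta).
Implicit Types (a b : xel) (S : set T) (h : T).

Definition opb S a (b : R) := 0 <= b /\ forall h, S h -> mbound (rmx h a) b.

(** The supremum over h in [S] of the operator norms of the regular representations, written as the
    least common bound. *)
Definition nred S a : R := inf [set b | opb S a b].

Definition orbit_closed S := forall l h z, ppow l h = Some z -> S h -> S z.

Lemma mbound0 (b : R) : mbound (fun _ _ => 0 : C) b.
Proof.
move=> v [d sv].
have -> : mact (fun _ _ : int => 0) v = fun=> 0.
  by apply/funext => n; rewrite (mactE _ _ sv) big1 // => l _; rewrite mul0r.
rewrite (@vsqE _ 0 (fun=> 0)) // big1 => [|l _]; last by rewrite cn0 expr0n.
by rewrite mulr_ge0 ?sqr_ge0 ?vsq_ge0 //; exists d.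
Qed.

Lemma mbound_sum D (I : eqType) (s : seq I) (M : I -> int -> int -> C) (e : I -> R) :
  (forall i, i \in s -> band D (M i)) -> (forall i, i \in s -> 0 <= e i) ->
  (forall i, i \in s -> mbound (M i) (e i)) ->
  mbound (fun n l => \sum_(i <- s) M i n l) (\sum_(i <- s) e i).
Proof.
elim: s => [|i s IH] MD e0 Me.
  under eq_fun do under eq_fun do rewrite big_nil.
  by rewrite big_nil; apply: mbound0.
under eq_fun do under eq_fun do rewrite big_cons.
rewrite big_cons.
have is_ k : k \in s -> k \in i :: s by rewrite in_cons orbC => ->.
apply: (mboundD (d := D)).
- by apply: e0; rewrite mem_head.
- by rewrite big_seq; apply: sumr_ge0 => k /is_ /e0.
- by apply: MD; rewrite mem_head.
- by move=> n l nl; rewrite big_seq big1 // => k /is_ ks; apply: MD.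
- by apply: Me; rewrite mem_head.
- by apply: IH => k /is_; [exact: MD|exact: e0|exact: Me].
Qed.

(** The matrix is the sum of its 2d + 1 diagonals. The k-th one consists of values of a k along the
    orbit of h, so e k bounds it as a weighted shift. *)
Lemma opb_supp d S a (e : int -> R) : supp d a -> (forall k, 0 <= e k) ->
  (forall k l h z, S h -> ppow l h = Some z -> cn (a k z) <= e k) ->
  opb S a (\sum_(k <- win d) e k).
Proof.
move=> sa e0 ae; split=> [|h Sh]; first by apply: sumr_ge0.
have -> : rmx h a = fun n l => \sum_(k <- win d) rmx h (smono k (a k)) n l.
  apply/funext => n; apply/funext => l.
  under eq_bigr do rewrite regmx_smono.
  have [nd|nd] := leqP `|n - l| d.
    rewrite (big_win_delta (k := n - l)) ?eqxx // => k; rewrite eq_sym.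
    by move=> /negPf ->.
  rewrite (regmx_band Theta h sa nd) big_seq big1 // => k; rewrite mem_win => kd.
  by case: eqP => // nlk; lia.
apply: (mbound_sum (D := d)) => [k kd n l nl|//|k _].
  rewrite mem_win in kd; rewrite regmx_smono; case: eqP => // nlk; lia.
apply: (mbound_diag (k := k)) => // n l; rewrite regmx_smono.
  by move=> /negPf ->.
case: eqP => _; last by rewrite cn0.
case E : (ppow l h) => [z|]; last by rewrite pull_none // cn0.
by rewrite (pull_some _ E) (ae k _ _ _ Sh E).
Qed.

Lemma opb_ex S a : xalg a -> exists M, opb S a M.
Proof.
move=> xa; have [d sa] := xalg_supp xa.
have M_ex k : exists M : R, 0 <= M /\ forall x, cn (a k x) <= M.
  by have [M M0 h] := C0_bound (xalg_C0 k xa); exists M; split=> //; apply: ltW.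
have [e eP] := choice M_ex.
exists (\sum_(k <- win d) e k); apply: opb_supp sa _ _ => [k|k l h z _ _].
  exact: (eP k).1.
exact: (eP k).2.
Qed.

Lemma nred_le S a (M : R) : opb S a M -> nred S a <= M.
Proof. by move=> hb; apply: ge_inf => //; exists 0 => x []. Qed.

Lemma nred_ge0 S a : 0 <= nred S a.
Proof.
rewrite /nred; have [->|/set0P ne] := eqVneq [set b | opb S a b] set0.
  by rewrite inf0.
by apply: lb_le_inf => // b [].
Qed.

(** The infimum is attained: for a fixed nonzero vector v, being a bound means exceeding the
    quotient |Mv| / |v|, a condition preserved by infima. *)
Lemma nredP S a : xalg a -> opb S a (nred S a).
Proof.
move=> xa; have [b0 hb0] := opb_ex S xa; split=> [|h Sh]; first exact: nred_ge0.
apply/(mboundP _ (nred_ge0 S a)) => v fv.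
have [v0|v0] := eqVneq (Num.sqrt (vsq v)) 0.
  have := (mboundP (rmx h a) hb0.1).1 (hb0.2 h Sh) v fv.
  by rewrite v0 !mulr0.
have v1 : 0 < Num.sqrt (vsq v) by rewrite lt_neqAle eq_sym v0 sqrtr_ge0.
rewrite -ler_pdivrMr //; apply: lb_le_inf; first by exists b0.
move=> b [bb hb]; rewrite ler_pdivrMr //.
exact: (mboundP (rmx h a) bb).1 (hb h Sh) v fv.
Qed.

Lemma nred_D S a b : xalg a -> xalg b -> nred S (a + b) <= nred S a + nred S b.
Proof.
move=> xa xb; have [a0 ha] := nredP S xa; have [b0 hb] := nredP S xb.
apply: nred_le; split=> [|h Sh]; first exact: addr_ge0.
have [d sa] := xalg_supp xa; have [e sb] := xalg_supp xb.
have -> : rmx h (a + b) = fun n l => rmx h a n l + rmx h b n l.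
  apply/funext => n; apply/funext => l.
  by have := regmx_lin Theta 1 a b h n l; rewrite scale1r mul1r.
apply: (mboundD (d := maxn d e)) => //; [| |exact: ha|exact: hb].
  exact: regmx_band (supp_le (leq_maxl _ _) sa).
exact: regmx_band (supp_le (leq_maxr _ _) sb).
Qed.

Lemma nred_Z_le S (c : C) a : xalg a -> nred S (c *: a) <= cn c * nred S a.
Proof.
move=> xa; have [a0 ha] := nredP S xa; have [d sa] := xalg_supp xa.
apply: nred_le; split=> [|h Sh]; first by rewrite mulr_ge0 ?cn_ge0.
have -> : rmx h (c *: a) = fun n l => c * rmx h a n l.
  apply/funext => n; apply/funext => l.
  have := regmx_lin Theta c a 0 h n l; rewrite addr0 => ->.
  by rewrite [rmx h 0 n l]/regmx /pull; case: (ppow l h) => [?|]; rewrite addr0.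
exact: mboundZ (regmx_band Theta h sa) (ha h Sh).
Qed.

Lemma xalgZ (c : C) a : xalg a -> xalg (c *: a).
Proof. by move=> xa; rewrite -[_ *: _]addr0; apply: xalg_lin => //; exact: xalg0. Qed.

Lemma nred_Z S (c : C) a : xalg a -> nred S (c *: a) = cn c * nred S a.
Proof.
move=> xa; apply/eqP; rewrite eq_le nred_Z_le //=.
have [->|c0] := eqVneq c 0; first by rewrite cn0 mul0r nred_ge0.
have := nred_Z_le S c^-1 (xalgZ c xa); rewrite scalerA mulVf // scale1r.
have c1 : 0 < cn c by rewrite lt_neqAle eq_sym cn_eq0 c0 cn_ge0.
have : cn c^-1 * cn c = 1 by rewrite -cnM mulVf // cn1.
move=> e /(ler_wpM2l (ltW c1)) /le_trans; apply.
by rewrite mulrA [cn c * _]mulrC e mul1r.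
Qed.

Lemma nred_M S a b : xalg a -> xalg b -> nred S (xmul a b) <= nred S a * nred S b.
Proof.
move=> xa xb; have [a0 ha] := nredP S xa; have [b0 hb] := nredP S xb.
have [d sa] := xalg_supp xa; have [e sb] := xalg_supp xb.
apply: nred_le; split=> [|h Sh]; first exact: mulr_ge0.
rewrite (regmx_mul _ _ sa sb).
exact: mbound_mul a0 (regmx_band Theta h sa) (regmx_band Theta h sb) (ha h Sh) (hb h Sh).
Qed.

Hypothesis hT : hausdorff_space T.

Lemma nred_C S a : xalg a -> nred S a ^+ 2 <= nred S (xmul (xstar a) a).
Proof.
move=> xa; have [d sa] := xalg_supp xa.
have xaa := xalg_mul (xalg_star hT xa) xa.
have [n0 hn] := nredP S xaa.
rewrite -[leRHS]sqr_sqrtr // ler_pXn2r ?nnegrE ?nred_ge0 ?sqrtr_ge0 //.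
apply: nred_le; split=> [|h Sh]; first exact: sqrtr_ge0.
apply: mbound_cstar n0 (regmx_band Theta h sa) _; rewrite -regmx_star //.
by rewrite -(regmx_mul _ _ (supp_xstar Theta sa) sa); apply: hn.
Qed.

Lemma nred_cstar_seminorm S : cstar_seminorm xalg xmul xstar (nred S).
Proof.
split.
- exact: xalg0.
- by move=> c a b xa xb; apply: xalg_lin.
- by move=> a b xa xb; apply: xalg_mul.
- by move=> a xa; apply: xalg_star.
- by move=> a b c xa xb xc; apply: xmulA.
- by move=> c a b d xa xb xd; apply: xmul_linl.
- by move=> c a b d xa xb xd; apply: xmul_linr.
- by move=> c a b xa xb; apply: xstar_lin.
- by move=> a b xa xb; apply: xstarM.
- by move=> a xa; apply: xstarK.
- by move=> a xa; apply: nred_ge0.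
- by move=> a b xa xb; apply: nred_D.
- by move=> c a xa; apply: nred_Z.
- by move=> a b xa xb; apply: nred_M.
- by move=> a xa; apply: nred_C.
Qed.

Lemma nred_entry S a k h : xalg a -> S h -> cn (a k h) <= nred S a.
Proof.
move=> xa Sh; have [a0 ha] := nredP S xa; have [d sa] := xalg_supp xa.
have := mbound_entry k 0 a0 (regmx_band Theta h sa) (ha h Sh).
by rewrite /regmx subr0.
Qed.

(** With [nred_entry] this compares the reduced norm and the largest coefficient up to the number of
    diagonals. The matrix at h sees the whole orbit of h, hence the condition on [S]. *)
Lemma nred_sup_le d S a (e : R) : supp d a -> 0 <= e -> orbit_closed S ->
  (forall k h, S h -> cn (a k h) <= e) -> nred S a <= (d + d).+1%:R * e.
Proof.
move=> sa e0 Sorb ae; have := opb_supp (S := S) (e := fun=> e) sa (fun=> e0).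
rewrite big_const_seq count_predT size_win iter_addr_0 => h.
rewrite mulr_natl; apply: nred_le; apply: h => k l x z Sx xz; apply: ae; exact: Sorb xz Sx.
Qed.

Lemma nred_sub S S' a : S `<=` S' -> xalg a -> nred S a <= nred S' a.
Proof.
move=> SS xa; have [a0 ha] := nredP S' xa; apply: nred_le; split=> // h /SS.
exact: ha.
Qed.
End ReducedNorm.

(** * The universal norm is the reduced norm *)

Section Growth.
Variable R : realType.

(** The ratio (r/q)^N outgrows c N; N is restricted to powers of 2, the exponents produced by
    repeated squaring. *)
Lemma growth (q r c : R) : 0 <= q -> q < r -> 0 <= c ->
  exists m, c * (2 ^ m.+1)%:R * q ^+ (2 ^ m.+1) < r ^+ (2 ^ m.+1).
Proof.
move=> q0 qr c0; have [->|q1] := eqVneq q 0.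
  by exists 0%N; rewrite expr0n mulr0 exprn_gt0 // (le_lt_trans q0).
have qp : 0 < q by rewrite lt_neqAle eq_sym q1.
set d := r / q - 1.
have d0 : 0 < d by rewrite subr_gt0 ltr_pdivlMr // mul1r.
have bern n : 1 + n%:R * d <= (r / q) ^+ n.
  have -> : r / q = 1 + d by rewrite addrC subrK.
  elim: n => [|n IH]; first by rewrite mul0r addr0 expr0.
  rewrite exprS; apply: le_trans (_ : (1 + d) * (1 + n%:R * d) <= _); last first.
    by rewrite ler_wpM2l // addr_ge0 ?ltW.
  rewrite -[n.+1]addn1 natrD.
  have : 0 <= n%:R * d * d by rewrite !mulr_ge0 // ltW.
  lra.
(* This gives 2c < 2^m d^2. For N = 2 * 2^m, squaring Bernoulli's inequality yields (r/q)^N >= (2^m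
   d)^2 > 2c 2^m = cN. *)
pose m := Num.bound (c * 2 / d ^+ 2).
exists m.
have dd : 0 < d ^+ 2 by rewrite exprn_gt0.
have hm : c * 2 < (2 ^ m)%:R * d ^+ 2.
  rewrite -ltr_pdivrMr //; apply: lt_trans (archi_boundP _) _.
    by rewrite divr_ge0 ?mulr_ge0 // ltW.
  by rewrite ltr_nat ltn_expl.
have rq : r ^+ (2 ^ m.+1) = (r / q) ^+ (2 ^ m.+1) * q ^+ (2 ^ m.+1).
  by rewrite -exprMn mulfVK.
rewrite rq ltr_pM2r ?exprn_gt0 // expnSr exprM natrM.
apply: lt_le_trans (_ : ((2 ^ m)%:R * d) ^+ 2 <= _); last first.
  rewrite ler_pXn2r ?nnegrE ?mulr_ge0 ?(ltW d0) ?exprn_ge0 //.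
    by apply: le_trans (bern _); rewrite lerDr.
  by rewrite divr_ge0 // ltW // (lt_trans qp).
by rewrite exprMn expr2 -!mulrA [c * _]mulrCA ltr_pM2l ?ltr0n ?expn_gt0.
Qed.
End Growth.

Section UniversalNorm.
Variables (R : realType) (T : topologicalType) (Theta : partial_aut T).
Hypothesis hT : hausdorff_space T.
Local Notation C := (complex R).
Local Notation xel := (int -> T -> Cplx R).
Local Notation xalg := (xalg R Theta).
Local Notation rmx := (regmx Theta).
Local Notation xmul := (xmul Theta).
Local Notation xstar := (xstar Theta).
Local Notation Hdom := (Hdom Theta).
Local Notation "x %:C" := (real_complex R x).
Implicit Types (a b : xel) (h : T) (f g : T -> Cplx R).

Lemma smono_decomp d a : supp d a -> a = \sum_(k <- win d) smono k (a k).
Proof.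
move=> sa; apply/funext => n.
have -> : (\sum_(k <- win d) smono k (a k)) n = \sum_(k <- win d) smono k (a k) n.
  by elim/big_rec2: _ => // k f g _ <-.
have [nd|nd] := leqP `|n| d.
  rewrite (big_win_delta (k := n)) // /smono ?eqxx // => k.
  by rewrite eq_sym => /negPf ->.
rewrite sa // big_seq big1 // => k; rewrite mem_win => kd.
by rewrite /smono; case: eqP => // nk; lia.
Qed.

Lemma smono0M f g : xmul (smono 0 f) (smono 0 g) = smono 0 (fun x => f x * g x).
Proof.
have sm (e : T -> Cplx R) : supp 0 (smono 0 e).
  by move=> l l0; rewrite /smono; case: eqP => // l1; lia.
apply: (@regmx_inj _ _ Theta) => h; rewrite (regmx_mul _ _ (sm f) (sm g)).
apply/funext => n; apply/funext => l.
rewrite (mmulmE _ _ _ (regmx_band Theta h (sm g))) add0n.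
rewrite (big_win_delta (k := l)) // => [|i il]; rewrite !regmx_smono.
  rewrite subrr eqxx; case: eqP => _; last by rewrite mul0r.
  rewrite /pull.
  by case: (ppow _ _ _) => // ; rewrite mul0r.
by rewrite [i - l == 0]subr_eq0 (negPf il) mulr0.
Qed.

Lemma smono0_star f : xstar (smono 0 f) = smono 0 (fun x => cconj (f x)).
Proof.
apply/funext => n; rewrite /xstar /smono oppr_eq0; case: eqP => [->|_].
  by apply/funext => x.
by apply/funext => x; rewrite /pull; case: (ppow _ _ _) => // z; rewrite /cconj conjC0.
Qed.

(** Brings a monomial of any degree back to degree 0, where functions act and the companion argument
    is available. *)
Lemma smono_cstar k g : xalg (smono k g) ->
  xmul (xstar (smono k g)) (smono k g) = smono 0 (fun x => cconj (g x) * g x).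
Proof.
move=> xk; have sm : supp `|k| (smono k g).
  by move=> l lk; rewrite /smono; case: eqP => // e; lia.
apply: (@regmx_inj _ _ Theta) => h.
rewrite (regmx_mul _ _ (supp_xstar Theta sm) sm) regmx_star //.
apply/funext => n; apply/funext => l.
rewrite (mmulmE _ _ _ (regmx_band Theta h sm)) (big_win_delta (k := l + k)).
- rewrite /madj !regmx_smono.
  have -> : (l + k - l == k) = true by lia.
  have -> : (l + k - n == k) = (n - l == 0) by lia.
  case: eqP => [e|_]; last by rewrite conjC0 mul0r.
  have -> : n = l by lia.
  by rewrite /pull; case: (ppow _ _ _) => //; rewrite mulr0.
- lia.
- move=> i il; rewrite [rmx h _ i l]regmx_smono.
  by case: eqP => [e|_]; [lia|rewrite mulr0].
Qed.

Section Rep.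
Variables (B : cstarAlgType R) (rho : xel -> B).
Hypothesis hrho : xrep Theta rho.

Lemma rho_lin (c : C) a b : xalg a -> xalg b -> rho (c *: a + b) = c *: rho a + rho b.
Proof. by case: hrho => L _ _; apply: L. Qed.

Lemma rho_mul a b : xalg a -> xalg b -> rho (xmul a b) = cmul (rho a) (rho b).
Proof. by case: hrho => _ L _; apply: L. Qed.

Lemma rho_star a : xalg a -> rho (xstar a) = cstar (rho a).
Proof. by case: hrho => _ _ L; apply: L. Qed.

Lemma rho_D a b : xalg a -> xalg b -> rho (a + b) = rho a + rho b.
Proof. by move=> xa xb; rewrite -[a]scale1r rho_lin // !scale1r. Qed.

Lemma rho_0 : rho 0 = 0.
Proof.
have := rho_lin (-1) (xalg0 R Theta) (xalg0 R Theta).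
by rewrite scaleN1r addr0 oppr0 scaleN1r addNr.
Qed.

Lemma rho_Z (c : C) a : xalg a -> rho (c *: a) = c *: rho a.
Proof.
by move=> xa; rewrite -[_ *: a]addr0 rho_lin ?rho_0 ?addr0 //; exact: xalg0.
Qed.

Lemma rho_sum (I : Type) (s : seq I) (F : I -> xel) : (forall i, xalg (F i)) ->
  xalg (\sum_(i <- s) F i) /\ rho (\sum_(i <- s) F i) = \sum_(i <- s) rho (F i).
Proof.
move=> xF; elim: s => [|i s [xs IH]]; first by rewrite !big_nil rho_0; split=> //; exact: xalg0.
rewrite !big_cons rho_D // IH; split=> //; rewrite -[F i]scale1r.
exact: xalg_lin.
Qed.

Lemma Hdom0 : Hdom 0 = [set: T].
Proof. by apply/seteqP; split. Qed.

(* The companion of f is 1 - sqrt (1 - f^2), which again vanishes at infinity. *)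
Lemma rho_real_le1 (f : T -> R) : C0 R [set: T] (fun x => (f x)%:C) ->
  (forall x, 0 <= f x <= 1) -> rnorm (rho (smono 0 (fun x => (f x)%:C))) <= 1.
Proof.
move=> f0 f01; pose y x := 1 - Num.sqrt (1 - f x ^+ 2).
have f2 x : 0 <= 1 - f x ^+ 2.
  by have /andP[a b] := f01 x; rewrite subr_ge0 expr_le1.
have yf x : `|y x| <= f x.
  have /andP[a b] := f01 x; have e := sqr_sqrtr (f2 x).
  have s0 := sqrtr_ge0 (1 - f x ^+ 2).
  rewrite /y; set s := Num.sqrt _ in e s0 *.
  have s1 : s <= 1 by rewrite -(@ler_pXn2r _ 2) ?nnegrE // e expr1n gerBl sqr_ge0.
  rewrite ger0_norm ?subr_ge0 // lerBlDr -lerBlDl.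
  rewrite -(@ler_pXn2r _ 2) ?nnegrE ?subr_ge0 // e.
  by move: a b; nra.
have cf : continuous f.
  move=> x; apply/cvgrPdist_lt => e e0.
  have cfc := C0_cts f0; have /cts_atP/(_ e e0) := cfc x.
  by apply: filterS => t; rewrite -rmorphB cn_real distrC.
have cy : continuous y.
  move=> x; apply: cvgB; first exact: cvg_cst.
  apply: continuous_comp; last exact: sqrt_continuous.
  by apply: cvgB; [exact: cvg_cst|apply: cvgM; exact: cf].
have y0 : C0 R [set: T] (fun x => (y x)%:C).
  apply: (C0_dom ltr01 f0); first exact: cts_real.
    by move=> x /(_ I).
  move=> x; rewrite mul1r !cn_real; apply: le_trans (yf x) (ler_norm _).
have conjr (z : R) : cconj (z%:C) = z%:C by rewrite /cconj conj_Creal // complex_real.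
have x_ (g : T -> R) : C0 R [set: T] (fun x => (g x)%:C) ->
    xalg (smono 0 (fun x => (g x)%:C)).
  by move=> g0; apply: xalg_mono; rewrite Hdom0.
have xf := x_ f f0; have xy := x_ y y0.
apply: (@rnorm_cosine_le1 _ _ _ (rho (smono 0 (fun x => (y x)%:C)))).
- by rewrite -rho_star // smono0_star; under eq_fun do rewrite conjr.
- by rewrite -rho_star // smono0_star; under eq_fun do rewrite conjr.
- by rewrite -!rho_mul // !smono0M; under eq_fun do rewrite mulrC.
rewrite -!rho_mul //; rewrite -rho_D; [|exact: xalg_mul|exact: xalg_mul].
rewrite -rho_D // !smono0M; congr rho.
apply/funext => n; apply/funext => x.
change (smono 0 (fun x => (f x)%:C * (f x)%:C) n x + smono 0 (fun x => (y x)%:C * (y x)%:C) n x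
  = smono 0 (fun x => (y x)%:C) n x + smono 0 (fun x => (y x)%:C) n x).
rewrite /smono; case: eqP => // _.
rewrite -!rmorphM -!rmorphD; congr (_%:C).
rewrite /y; have := sqr_sqrtr (f2 x); set s := Num.sqrt _; nra.
Qed.

Lemma rho_mono_le k g (e : R) : C0 R (Hdom k) g -> (forall x, cn (g x) <= e) ->
  0 <= e -> rnorm (rho (smono k g)) <= e.
Proof.
move=> gk ge e0; apply/ler_addgt0Pr => t t0.
(* The added t keeps c positive even when e = 0. Then |g|^2 = c^2 f with f between 0 and 1, as
   [rho_real_le1] wants. *)
set c := e + t; have c0 : 0 < c by rewrite ltr_wpDl.
have xk := xalg_mono gk.
pose f x := (cn (g x) / c) ^+ 2.
have fE : (fun x => cconj (g x) * g x) = (fun x => ((c ^+ 2)%:C * (f x)%:C : Cplx R)).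
  apply/funext => x; rewrite /cconj conj_mul -rmorphM; congr (_%:C).
  by rewrite /f -exprMn mulrCA mulfV ?mulr1 ?lt0r_neq0.
have g2 : C0 R (Hdom k) (fun x => cconj (g x) * g x).
  by apply: C0_mul => //; apply: C0_conj.
have f0 : C0 R [set: T] (fun x => (f x)%:C).
  have := C0_lin ((c ^- 2)%:C) (C0_subset (@subsetT _ _) g2) (C0_zero R [set: T]).
  congr C0; apply/funext => x; rewrite /cconj conj_mul -rmorphM /= addr0.
  by congr (_%:C); rewrite /f expr_div_n mulrC.
rewrite -(@ler_pXn2r _ 2) ?nnegrE ?rnorm_ge0 ?(ltW c0) //.
rewrite -rnorm_cstar_mul -rho_star // -rho_mul //; last exact: xalg_star.
rewrite smono_cstar // fE.
have -> : smono 0 (fun x => (c ^+ 2)%:C * (f x)%:C : Cplx R) =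
    (c ^+ 2)%:C *: smono 0 (fun x => (f x)%:C).
  apply/funext => n; rewrite -[RHS]/((c ^+ 2)%:C *: smono 0 (fun x => (f x)%:C) n).
  by rewrite /smono; case: eqP => // _; rewrite scaler0.
rewrite rho_Z; last by apply: xalg_mono; rewrite Hdom0.
rewrite rnormZ cn_real ger0_norm ?sqr_ge0 // ler_piMr ?sqr_ge0 //.
apply: rho_real_le1 => // x; rewrite /f sqr_ge0 /= expr_le1 //.
  by rewrite ler_pdivrMr // mul1r; apply: le_trans (ge x) _; rewrite lerDl ltW.
by rewrite divr_ge0 ?cn_ge0 // ltW.
Qed.

Lemma rho_le d a (e : R) : xalg a -> supp d a -> 0 <= e ->
  (forall k h, cn (a k h) <= e) -> rnorm (rho a) <= (d + d).+1%:R * e.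
Proof.
move=> xa sa e0 ae.
have xm k : xalg (smono k (a k)) by apply: xalg_mono; apply: xalg_C0.
rewrite {1}(smono_decomp sa) (rho_sum _ xm).2 -(size_win d).
elim: (win d) => [|k s IH]; first by rewrite big_nil rnorm0 mul0r.
rewrite big_cons; apply: le_trans (rnormD _ _) _ => /=.
rewrite -natr1 mulrDl mul1r addrC lerD //.
by apply: rho_mono_le => //; apply: xalg_C0.
Qed.
End Rep.

(* Squaring a^* a repeatedly doubles the support only, whereas the norms are
   squared: polynomial growth of Z makes the full norm equal to the reduced one. *)
Fixpoint sqs a m : xel :=
  if m is m'.+1 then xmul (sqs a m') (sqs a m') else xmul (xstar a) a.

Lemma sqs_xalg a m : xalg a -> xalg (sqs a m).
Proof.
by move=> xa; elim: m => [|m IH] /=; apply: xalg_mul => //; apply: xalg_star.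
Qed.

Lemma sqs_supp d a m : supp d a -> supp ((d + d) * 2 ^ m) (sqs a m).
Proof.
move=> sa; elim: m => [|m IH] /=.
  by rewrite expn0 muln1; apply: supp_xmul => //; apply: supp_xstar.
by rewrite expnS mulnCA mul2n -addnn; apply: supp_xmul.
Qed.

Lemma sqs_sa a m : xalg a -> xstar (sqs a m) = sqs a m.
Proof.
move=> xa; elim: m => [|m IH] /=.
  by rewrite xstarM ?xstarK //; apply: xalg_star.
by rewrite xstarM ?IH //; apply: sqs_xalg.
Qed.

Lemma rho_sqs (B : cstarAlgType R) (rho : xel -> B) a m : xrep Theta rho -> xalg a ->
  rnorm (rho (sqs a m)) = rnorm (rho a) ^+ (2 ^ m.+1).
Proof.
move=> hr xa; elim: m => [|m IH].
  by rewrite /= (rho_mul hr) // ?(rho_star hr) // ?rnorm_cstar_mul //; apply: xalg_star.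
have xs := sqs_xalg m xa.
rewrite expnSr exprM -IH -rnorm_cstar_mul -(rho_star hr) // sqs_sa // -(rho_mul hr) //.
Qed.

Lemma nred_sqs S a m : xalg a -> nred Theta S (sqs a m) = nred Theta S a ^+ (2 ^ m.+1).
Proof.
move=> xa; pose X := SsAlg (nred_cstar_seminorm R Theta hT S).
elim: m => [|m IH]; first exact: (@ssN_cstar R X a xa).
have xs := sqs_xalg m xa; rewrite expnSr exprM -IH.
by rewrite -(@ssN_cstar R X _ xs) /= sqs_sa.
Qed.

Lemma rho_le_nred (B : cstarAlgType R) (rho : xel -> B) a : xrep Theta rho -> xalg a ->
  rnorm (rho a) <= nred Theta [set: T] a.
Proof.
move=> hr xa; rewrite leNgt; apply/negP => lt_.
have [d sa] := xalg_supp xa; set D := (d + d)%N.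
(* The support of a^* a has radius D = 2d, so [sqs a m] has 2D 2^m + 1 diagonals, at most (2D + 1)
   2^(m+1). This explains the constant c. *)
have [|m] := growth (nred_ge0 Theta [set: T] a) lt_ (c := (D + D).+1%:R); first by [].
rewrite ltNge => /negP; apply.
rewrite -rho_sqs // -nred_sqs //.
have sm : supp (D * 2 ^ m) (sqs a m) by exact: sqs_supp.
have xm := sqs_xalg m xa.
have := rho_le hr xm sm (nred_ge0 Theta [set: T] (sqs a m)).
move=> /(_ (fun k h => nred_entry k xm (I : [set: T] h))) /le_trans; apply.
rewrite ler_wpM2r ?nred_ge0 // -natrM ler_nat -/D expnS.
have := expn_gt0 2 m; move: (2 ^ m)%N => N; nia.
Qed.
End UniversalNorm.

(** * Norm and density of the canonical image of the star-algebra *)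

Section CrossedProductNorm.
Variable R : realType.

Lemma dense_extension_star (V : lmodType (complex R)) (S : set V)
    (mulV : V -> V -> V) (starV : V -> V) (A B : cstarAlgType R)
    (g : V -> A) (u : V -> B) :
  (forall (c : complex R) a b, S a -> S b -> S (c *: a + b)) ->
  (forall a b, S a -> S b -> S (mulV a b)) -> (forall a, S a -> S (starV a)) ->
  star_hom S mulV starV (@cmul R A) (@cstar R A) g ->
  star_hom S mulV starV (@cmul R B) (@cstar R B) u ->
  rdense (g @` S) -> (forall x, S x -> rnorm (u x) <= rnorm (g x)) ->
  exists2 U : A -> B,
    star_hom [set: A] (@cmul R A) (@cstar R A) (@cmul R B) (@cstar R B) U &
    forall x, S x -> U (g x) = u x.
Proof.
move=> SL SM SS [gL gM gS] [uL uM uS] dg ug.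
have [U [Ug UL UC]] : exists U : A -> B, [/\ forall x, S x -> U (g x) = u x,
    forall (c : complex R) a b, U (c *: a + b) = c *: U a + U b &
    forall a, rnorm (U a) <= 1 * rnorm a].
  by apply: (dense_extension ler01 SL gL uL dg) => x Sx; rewrite mul1r ug.
have bU : badd U := linear_badd UL UC.
exists U => //; split=> [c a b _ _|a b _ _|a _]; first exact: UL.
  (* Multiplicativity is extended from the dense set one variable at a time, each time as an
     equality of two bounded additive maps. *)
  suff E : (fun a => U (cmul a b)) = (fun a => cmul (U a) (U b)).
    by have := congr1 (fun f => f a) E.
  apply: (badd_dense_eq dg).
  - exact: (badd_comp bU (badd_mulr b)).
  - exact: (badd_comp (badd_mulr (U b)) bU).
  move=> _ [x Sx <-].
  suff E : (fun b => U (cmul (g x) b)) = (fun b => cmul (U (g x)) (U b)).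
    by have := congr1 (fun f => f b) E.
  apply: (badd_dense_eq dg).
  - exact: (badd_comp bU (badd_mull (g x))).
  - exact: (badd_comp (badd_mull (U (g x))) bU).
  by move=> _ [y Sy <-]; rewrite -gM // !Ug ?uM //; exact: SM.
suff E : (fun a => U (cstar a)) = (fun a => cstar (U a)).
  by have := congr1 (fun f => f a) E.
apply: (badd_dense_eq dg).
- exact: (badd_comp bU (@badd_star R A)).
- exact: (badd_comp (@badd_star R B) bU).
by move=> _ [x Sx <-]; rewrite -gS // !Ug ?uS //; exact: SS.
Qed.

Variables (T : topologicalType) (Theta : partial_aut T).
Hypothesis hT : hausdorff_space T.
Variables (A : cstarAlgType R) (iota : (int -> T -> Cplx R) -> A).
Hypothesis hA : is_crossed_product Theta iota.
Local Notation xalg := (xalg R Theta).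
Local Notation star_homA B := (star_hom [set: A] (@cmul R A) (@cstar R A)
  (@cmul R B) (@cstar R B)).

(** Realises each reduced seminorm by a homomorphism out of [A]. For [S] everything it gives the
    norm of [A]; for [S] a fibre it will compute the quotient norm. *)
Lemma cp_hom (S : set T) : exists (B : cstarAlgType R) (psi : A -> B),
  star_homA B psi /\ forall x, xalg x -> rnorm (psi (iota x)) = nred Theta S x.
Proof.
have [B [k [hk kn _]]] := cstar_completion (nred_cstar_seminorm R Theta hT S).
have [psi [hpsi psik] _] := hA.2 B k hk.
by exists B, psi; split=> // x xx; rewrite psik // kn.
Qed.

Lemma cp_norm x : xalg x -> rnorm (iota x) = nred Theta [set: T] x.
Proof.
move=> xx; apply/eqP; rewrite eq_le (rho_le_nred hT hA.1) //=.
have [B [psi [hpsi <- //]]] := cp_hom [set: T].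
exact: star_hom_contraction.
Qed.

(** The reduced completion B of [xalg] maps to [A] because [iota] is bounded by the reduced norm.
    Composed with the induced map from [A] to B this extends [iota], so it is the identity by
    uniqueness, and density is inherited from B. *)
Lemma cp_dense : rdense (iota @` xalg).
Proof.
have [B [k [hk kn kd]]] := cstar_completion (nred_cstar_seminorm R Theta hT [set: T]).
have [psi [hpsi psik] _] := hA.2 B k hk.
have dk : rdense (k @` xalg).
  by move=> b e e0; have [x xx kx] := kd b e e0; exists (k x) => //; exists x.
have [U hU Uk] : exists2 U : B -> A, star_hom [set: B] (@cmul R B) (@cstar R B)
    (@cmul R A) (@cstar R A) U & forall x, xalg x -> U (k x) = iota x.
  apply: (dense_extension_star _ _ _ hk hA.1 dk).
  - by move=> c a b xa xb; apply: xalg_lin.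
  - by move=> a b xa xb; apply: xalg_mul.
  - by move=> a xa; apply: xalg_star.
  - by move=> x xx; rewrite cp_norm // kn.
have [psi0 _ psi0_uniq] := hA.2 A iota hA.1.
have idE : (@id A) = psi0 by apply: psi0_uniq.
have UpsiE : (U \o psi) = psi0.
  apply: psi0_uniq => [|x xx]; last by rewrite /= psik // Uk.
  case: hU => [L1 M1 S1]; case: hpsi => [L2 M2 S2]; split=> *.
  - by rewrite /= L2 // L1.
  - by rewrite /= M2 // M1.
  - by rewrite /= S2 // S1.
move=> a e e0; have [x xx kx] := kd (psi a) e e0.
exists (iota x); first by exists x.
have -> : a = U (psi a) by rewrite -[RHS]/((U \o psi) a) UpsiE -idE.
rewrite -Uk // -(star_hom_badd hU).1; apply: le_lt_trans kx.
exact: star_hom_contraction.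
Qed.
End CrossedProductNorm.

(** * Multiplication by functions on the base *)

Section BaseMultiplication.
Variables (R : realType) (Y T : topologicalType) (p : T -> Y).
Variable Theta : partial_aut T.
Hypothesis p_Theta : forall x, pdom Theta x -> p (pfun Theta x) = p x.
Hypothesis p_cts : continuous p.
Local Notation C := (complex R).
Local Notation xel := (int -> T -> Cplx R).
Local Notation xalg := (xalg R Theta).
Local Notation rmx := (regmx Theta).
Implicit Types (a b : xel) (f g : Y -> Cplx R).

Lemma ppow_base l h z : ppow Theta l h = Some z -> p z = p h.
Proof.
move=> hz; suff : p z = p h <-> p h = p h by case=> _; apply.
apply: iff_sym; apply: (@ppow_inv _ Theta (fun z => p z = p h) _ _ _ _ hz).
by move=> x Dx; rewrite p_Theta.
Qed.

Lemma fiber_orbit_closed y : orbit_closed Theta (p @^-1` [set y]).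
Proof. by move=> l h z hz /=; rewrite (ppow_base hz). Qed.

Definition mulf f a : xel := fun k x => f (p x) * a k x.

Definition bcts f := continuous f /\ exists M : R, forall y, cn (f y) <= M.

Lemma C0_bcts (U : set Y) f : C0 R U f -> bcts f.
Proof.
by move=> fU; split; [exact: C0_cts fU|have [M _ fM] := C0_bound fU; exists M].
Qed.

Lemma cts_base f : continuous f -> continuous (fun x => f (p x)).
Proof. by move=> cf x; apply: continuous_comp; [exact: p_cts|exact: cf]. Qed.

Lemma supp_mulf d f a : supp d a -> supp d (mulf f a).
Proof. by move=> sa k kd; apply/funext => x; rewrite /mulf sa // mulr0. Qed.

Lemma xalg_mulf f a : bcts f -> xalg a -> xalg (mulf f a).
Proof.
move=> [cf [M fM]] xa; split=> [k|].
  by apply: (C0_mulb (cts_base cf) _ (xalg_C0 k xa)) => x; apply: fM.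
have [d sa] := xalg_supp xa; apply/finite_suppP; exists d; exact: supp_mulf.
Qed.

(** p is constant on orbits, so f acts on the regular representation at h by a scalar. Centrality
    and all the norm bounds below come from this. *)
Lemma regmx_mulf f a h n l : rmx h (mulf f a) n l = f (p h) * rmx h a n l.
Proof.
rewrite /regmx /mulf; case E : (ppow Theta l h) => [z|].
  by rewrite !(pull_some _ E) (ppow_base E).
by rewrite !pull_none // mulr0.
Qed.

Lemma nred_mulf_le (S : set T) f a (c : R) : 0 <= c -> xalg a ->
  (forall h, S h -> cn (f (p h)) * nred Theta [set h] a <= c) ->
  nred Theta S (mulf f a) <= c.
Proof.
move=> c0 xa hc; apply: nred_le; split=> // h Sh.
have [d sa] := xalg_supp xa; have [n0 hn] := nredP [set h] xa.
apply: (@mbound_le R _ (cn (f (p h)) * nred Theta [set h] a)).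
- by rewrite mulr_ge0 ?cn_ge0.
- exact: hc.
have -> : rmx h (mulf f a) = fun n l => f (p h) * rmx h a n l.
  by apply/funext => n; apply/funext => l; rewrite regmx_mulf.
exact: mboundZ (regmx_band Theta h sa) (hn h erefl).
Qed.

Lemma nred_mulf_bound (S : set T) f a (M : R) : xalg a -> (forall y, cn (f y) <= M) ->
  nred Theta S (mulf f a) <= M * nred Theta S a.
Proof.
move=> xa fM; have [Se|/set0P[h0 Sh0]] := eqVneq S set0.
  have h0 b : nred Theta S b = 0.
    apply/eqP; rewrite eq_le nred_ge0 andbT; apply: nred_le; split=> // h.
    by rewrite Se.
  by rewrite !h0 mulr0.
have M0 : 0 <= M by apply: le_trans (cn_ge0 _) (fM (p h0)).
apply: nred_mulf_le => //; first by rewrite mulr_ge0 ?nred_ge0.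
move=> h Sh; apply: ler_pM; rewrite ?cn_ge0 ?nred_ge0 //.
by apply: nred_sub => // x ->.
Qed.

Lemma xmul_mulfl f a b : xalg b ->
  xmul Theta (mulf f a) b = mulf f (xmul Theta a b).
Proof.
move=> /xalg_supp[d sb]; apply/funext => n; apply/funext => h.
rewrite /mulf !(xmul_mact _ _ _ _ sb) !(mactE _ _ (supp_pt _ sb)) mulr_sumr.
by apply: eq_bigr => l _; rewrite regmx_mulf mulrA.
Qed.

Lemma xmul_mulfr f a b : xalg b ->
  xmul Theta a (mulf f b) = mulf f (xmul Theta a b).
Proof.
move=> /xalg_supp[d sb]; have sfb := supp_mulf f sb.
apply/funext => n; apply/funext => h.
rewrite /mulf (xmul_mact _ _ _ _ sb) (xmul_mact _ _ _ _ sfb).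
rewrite (mactE _ _ (supp_pt _ sb)) (mactE _ _ (supp_pt _ sfb)) mulr_sumr.
by apply: eq_bigr => l _; rewrite mulrCA.
Qed.

Lemma xstar_mulf f a : xstar Theta (mulf f a) =
  mulf (fun y => cconj (f y)) (xstar Theta a).
Proof.
apply/funext => n; apply/funext => h; rewrite /xstar /mulf.
case E : (ppow Theta n h) => [z|]; last by rewrite !pull_none // mulr0.
by rewrite !(pull_some _ E) (ppow_base E) /cconj rmorphM.
Qed.

Lemma mulf_smono f k (g : T -> Cplx R) : mulf f (smono k g) = smono k (fun x => f (p x) * g x).
Proof.
apply/funext => n; rewrite /mulf /smono; case: eqP => // _.
by apply/funext => x; rewrite mulr0.
Qed.

Lemma mulf_lin f (c : C) a b : mulf f (c *: a + b) = c *: mulf f a + mulf f b.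
Proof.
apply/funext => n; apply/funext => h.
by rewrite /mulf -[RHS]/(c * (f (p h) * a n h) + f (p h) * b n h) mulrCA -mulrDr.
Qed.

Variables (A : cstarAlgType R) (iota : xel -> A).
Hypothesis hT : hausdorff_space T.
Hypothesis hA : is_crossed_product Theta iota.

Lemma iota_lin (c : C) a b : xalg a -> xalg b ->
  iota (c *: a + b) = c *: iota a + iota b.
Proof. by case: hA => -[L _ _] _; apply: L. Qed.

(** The condition on f stands under the existential so that choice produces a total function of f,
    as the type of a C_0(Y)-structure demands. *)
Lemma base_mult_ex f : exists U : A -> A, bcts f ->
  [/\ forall x, xalg x -> U (iota x) = iota (mulf f x),
    forall (c : C) (a b : A), U (c *: a + b) = c *: U a + U b &
    badd U].
Proof.
have [[cf [M fM]]|nf] := pselect (bcts f); last by exists id.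
have bf : bcts f by split=> //; exists M.
have [U [UE UL UC]] : exists U : A -> A,
    [/\ forall x, xalg x -> U (iota x) = iota (mulf f x),
    forall (c : C) (a b : A), U (c *: a + b) = c *: U a + U b &
    forall a : A, rnorm (U a) <= `|M| * rnorm a].
  apply: (dense_extension (S := xalg)) => //.
  - by move=> c a b xa xb; apply: xalg_lin.
  - by move=> c a b xa xb; apply: iota_lin.
  - by move=> c a b xa xb; rewrite mulf_lin iota_lin //; apply: xalg_mulf.
  - exact (cp_dense hT hA).
  move=> x xx; rewrite !(cp_norm hT hA) //; last exact: xalg_mulf.
  by apply: nred_mulf_bound => // y; apply: le_trans (fM y) (ler_norm _).
by exists U => _; split=> //; exact: linear_badd UL UC.
Qed.

Definition base_mult f : A -> A := projT1 (cid (base_mult_ex f)).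

Lemma base_multP f : bcts f -> [/\
    forall x, xalg x -> base_mult f (iota x) = iota (mulf f x),
    forall (c : C) (a b : A), base_mult f (c *: a + b) = c *: base_mult f a + base_mult f b &
    badd (base_mult f)].
Proof. by rewrite /base_mult; case: cid => U /=; apply. Qed.

Lemma base_mult_iota f x : bcts f -> xalg x -> base_mult f (iota x) = iota (mulf f x).
Proof. by move=> /base_multP[h _ _] /h. Qed.

Lemma badd_base_mult f : bcts f -> badd (base_mult f).
Proof. by case/base_multP. Qed.

Let dA := cp_dense hT hA.

Lemma iota_mul a b : xalg a -> xalg b -> iota (xmul Theta a b) = cmul (iota a) (iota b).
Proof. by case: hA => -[_ L _] _; apply: L. Qed.

Lemma iota_star a : xalg a -> iota (xstar Theta a) = cstar (iota a).
Proof. by case: hA => -[_ _ L] _; apply: L. Qed.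

Lemma badd_eqP (B D : cstarAlgType R) (P : set B) (F G : B -> D) (b : B) : rdense P ->
  badd F -> badd G -> (forall x, P x -> F x = G x) -> F b = G b.
Proof. by move=> dP bF bG h; rewrite (badd_dense_eq dP bF bG h). Qed.

Lemma base_mult_mull f (a b : A) : bcts f ->
  base_mult f (cmul a b) = cmul (base_mult f a) b.
Proof.
move=> bf; have bm := badd_base_mult bf.
refine (@badd_eqP _ _ _ (fun a : A => base_mult f (cmul a b))
  (fun a : A => cmul (base_mult f a) b) a dA _ _ _).
- exact: (badd_comp bm (badd_mulr b)).
- exact: (badd_comp (badd_mulr b) bm).
move=> _ [x xx <-].
refine (@badd_eqP _ _ _ (fun b : A => base_mult f (cmul (iota x) b))
  (fun b : A => cmul (base_mult f (iota x)) b) b dA _ _ _).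
- exact: (badd_comp bm (badd_mull (iota x))).
- exact: (badd_mull (base_mult f (iota x))).
move=> _ [y xy <-].
rewrite -iota_mul // !base_mult_iota //; last exact: xalg_mul.
by rewrite -iota_mul //; [rewrite xmul_mulfl|exact: xalg_mulf].
Qed.

Lemma base_mult_mulr f (a b : A) : bcts f ->
  base_mult f (cmul a b) = cmul a (base_mult f b).
Proof.
move=> bf; have bm := badd_base_mult bf.
refine (@badd_eqP _ _ _ (fun a : A => base_mult f (cmul a b))
  (fun a : A => cmul a (base_mult f b)) a dA _ _ _).
- exact: (badd_comp bm (badd_mulr b)).
- exact: (badd_mulr (base_mult f b)).
move=> _ [x xx <-].
refine (@badd_eqP _ _ _ (fun b : A => base_mult f (cmul (iota x) b))
  (fun b : A => cmul (iota x) (base_mult f b)) b dA _ _ _).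
- exact: (badd_comp bm (badd_mull (iota x))).
- exact: (badd_comp (badd_mull (iota x)) bm).
move=> _ [y xy <-].
rewrite -iota_mul // !base_mult_iota //; last exact: xalg_mul.
by rewrite -iota_mul //; [rewrite xmul_mulfr|exact: xalg_mulf].
Qed.

Lemma bcts_conj f : bcts f -> bcts (fun y => cconj (f y)).
Proof.
by move=> [cf [M fM]]; split; [exact: cts_conj|exists M => y; rewrite /cconj cn_conj].
Qed.

Lemma base_mult_star f (a : A) : bcts f ->
  cstar (base_mult f a) = base_mult (fun y => cconj (f y)) (cstar a).
Proof.
move=> bf; have bm := badd_base_mult bf; have bm' := badd_base_mult (bcts_conj bf).
refine (@badd_eqP _ _ _ (fun a : A => cstar (base_mult f a))
  (fun a : A => base_mult (fun y => cconj (f y)) (cstar a)) a dA _ _ _).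
- exact: (badd_comp (@badd_star R A) bm).
- exact: (badd_comp bm' (@badd_star R A)).
move=> _ [x xx <-].
rewrite base_mult_iota // -!iota_star //; last exact: xalg_mulf.
by rewrite base_mult_iota ?xstar_mulf //; [exact: bcts_conj|exact: xalg_star].
Qed.

Lemma base_mult_lin (c : C) f g (a : A) : bcts f -> bcts g ->
  bcts (fun y => c * f y + g y) ->
  base_mult (fun y => c * f y + g y) a = c *: base_mult f a + base_mult g a.
Proof.
move=> bf bg bfg; have bmf := badd_base_mult bf; have bmg := badd_base_mult bg.
refine (@badd_eqP _ _ _ (base_mult (fun y => c * f y + g y))
  (fun a : A => c *: base_mult f a + base_mult g a) a dA _ _ _).
- exact: badd_base_mult bfg.
- exact: (badd_add (badd_scale c bmf) bmg).
move=> _ [x xx <-].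
rewrite !base_mult_iota // -iota_lin; [|exact: xalg_mulf|exact: xalg_mulf].
congr iota; apply/funext => n; apply/funext => h.
by rewrite /mulf -[RHS]/(c * (f (p h) * x n h) + g (p h) * x n h) mulrDl mulrA.
Qed.

Lemma base_mult_comp f g (a : A) : bcts f -> bcts g -> bcts (fun y => f y * g y) ->
  base_mult (fun y => f y * g y) a = base_mult f (base_mult g a).
Proof.
move=> bf bg bfg; have bmf := badd_base_mult bf; have bmg := badd_base_mult bg.
refine (@badd_eqP _ _ _ (base_mult (fun y => f y * g y))
  (fun a : A => base_mult f (base_mult g a)) a dA _ _ _).
- exact: badd_base_mult bfg.
- exact: (badd_comp bmf bmg).
move=> _ [x xx <-].
rewrite !base_mult_iota //; last exact: xalg_mulf.
by congr iota; apply/funext => n; apply/funext => h; rewrite /mulf mulrA.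
Qed.
End BaseMultiplication.

(** * Bump functions *)

(** A finite subcover by neighbourhoods that need not be open, obtained from near-covering
    compactness along the filter of ever larger lists of indices. *)
Lemma compact_subcover (T : topologicalType) (I : eqType) (K : set T) (f : I -> set T) :
  compact K -> (forall x, K x -> exists i, nbhs x (f i)) ->
  exists s : seq I, forall x, K x -> exists2 i, i \in s & f i x.
Proof.
move=> /compact_near_coveringP cK Kf.
pose F : set_system (seq I) :=
  [set A | exists s0 : seq I, forall s : seq I, {subset s0 <= s} -> A s].
have FF : Filter F.
  split; first by exists [::].
    move=> A B [s1 h1] [s2 h2]; exists (s1 ++ s2) => s ss; split.
      by apply: h1 => i i1; apply: ss; rewrite mem_cat i1.
    by apply: h2 => i i2; apply: ss; rewrite mem_cat i2 orbT.
  by move=> A B AB [s1 h1]; exists s1 => s /h1 /AB.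
have : \forall s \near F, K `<=` (fun x => exists2 i, i \in (s : seq I) & f i x).
  apply: cK => x /Kf[i xi].
  exists (f i, [set s : seq I | i \in s]) => /=; last by move=> [t s] /= [fit si]; exists i.
  by split=> //; exists [:: i] => s; apply; rewrite mem_head.
by move=> [s0 h]; exists s0; apply: h.
Qed.

Section Bumps.
Variables (R : realType) (T : topologicalType).
Hypotheses (hT : hausdorff_space T) (lcT : locally_compact [set: T]).
Local Notation "x %:C" := (real_complex R x).

Lemma point_bump (U : set T) x : open U -> U x -> exists g : T -> R,
  [/\ continuous g, forall t, 0 <= g t <= 1, g x = 1 & C0 R U (fun t => (g t)%:C)].
Proof.
move=> oU Ux; have [V xV [cV clV]] := lcT (I : [set: T] x).
have nV : nbhs x V.
  by move: xV; rewrite /within /=; apply: filterS => t; apply.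
(* Complete regularity gives a function that vanishes off W; lying inside the compact V makes it
   vanish at infinity as well. *)
pose W := U `&` V°.
have oW : open W by apply: openI => //; exact: open_interior.
have Wx : W x by split.
have [f [cf f01 f0 f1]] : exists f : T -> R, [/\ continuous f, range f `<=` `[0, 1]%classic,
    f @` [set x] `<=` [set 0] & f @` (~` W) `<=` [set 1]].
  apply/uniform_separatorP; apply: (@locally_compact_completely_regular _ R) => //.
  exact: open_closedC.
have g01 t : 0 <= 1 - f t <= 1.
  have := f01 (f t); rewrite /= in_itv /= => /(_ _)/andP[]; first by exists t.
  by move=> a b; rewrite subr_ge0 b gerBl a.
have cg : continuous (fun t => 1 - f t).
  by move=> t; apply: cvgB; [exact: cvg_cst|exact: cf].
have gW t : ~ W t -> 1 - f t = 0.
  by move=> nW; rewrite (f1 (f t)) ?subrr //; exists t.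
exists (fun t => 1 - f t); split=> //; first by rewrite (f0 (f x)) ?subr0 //; exists x.
apply: C0_intro; first exact: cts_real.
  by move=> t nU; rewrite gW // => -[].
move=> e e0; exists V => // t nV'; rewrite gW ?cn0 // => -[_].
by move=> /interior_subset.
Qed.

Lemma cts_sum_real (I : eqType) (s : seq I) (F : I -> T -> R) :
  (forall i, i \in s -> continuous (F i)) -> continuous (fun x => \sum_(i <- s) F i x).
Proof.
elim: s => [|i s IH] cF x.
  by under eq_fun do rewrite big_nil; exact: cvg_cst.
under eq_fun do rewrite big_cons; apply: cvgD; first by apply: cF; rewrite mem_head.
by apply: IH => j js; apply: cF; rewrite in_cons js orbT.
Qed.

Lemma bump (K U : set T) : compact K -> open U -> K `<=` U -> exists f : T -> R,
  [/\ continuous f, forall t, 0 <= f t <= 1, forall t, K t -> f t = 1 &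
      C0 R U (fun t => (f t)%:C)].
Proof.
move=> cK oU KU.
have g_ex x : exists g : T -> R, U x ->
   [/\ continuous g, forall t, 0 <= g t <= 1, g x = 1 & C0 R U (fun t => (g t)%:C)].
  have [Ux|nU] := pselect (U x); last by exists (fun=> 0).
  by have [g hg] := point_bump oU Ux; exists g.
have [g gP] := choice g_ex.
have [s0 Ks0] : exists s : seq T, forall x, K x ->
    exists2 i, i \in s & (fun i t => U i /\ 2^-1 < g i t) i x.
  apply: compact_subcover cK _ => x Kx; exists x.
  have [cg _ gx _] := gP x (KU x Kx).
  have h : \forall t \near x, 2^-1 < g x t.
    by apply: (cvgr_gt (g x x) (cg x)); rewrite gx invf_lt1 // ltr1n.
  by apply: filterS h => t ht; split=> //; exact: KU.
pose s := undup [seq x <- s0 | `[< U x >]].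
have sU x : x \in s -> U x by rewrite mem_undup mem_filter => /andP[/asboolP].
have Ks t : K t -> exists2 x, x \in s & 2^-1 < g x t.
  move=> /Ks0[x xs [Ux gxt]]; exists x => //.
  by rewrite mem_undup mem_filter xs andbT; apply/asboolP.
(* At each point of K some g x exceeds 1/2, so the doubled sum is at least 1 there and its
   truncation at 1 equals 1. *)
pose F t := \sum_(x <- s) g x t *+ 2.
have F0 t : 0 <= F t.
  rewrite /F big_seq; apply: sumr_ge0 => x /sU Ux.
  by have [_ /(_ t)/andP[a _] _ _] := gP x Ux; rewrite mulrn_wge0.
have cF : continuous F.
  apply: cts_sum_real => x /sU Ux; have [cg _ _ _] := gP x Ux.
  by move=> t; under eq_fun do rewrite mulr2n; apply: cvgD; exact: cg.
(* The minimum of 1 and F in a form whose continuity is immediate. *)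
pose f t := (1 + F t - `|1 - F t|) / 2.
have fmin t : f t = Num.min 1 (F t).
  rewrite /f; have [h|h] := leP 1 (F t).
    by rewrite ler0_norm ?subr_le0 //; lra.
  by rewrite gtr0_norm ?subr_gt0 //; lra.
have cf : continuous f.
  move=> t; apply: cvgM; last exact: cvg_cst.
  apply: cvgB; first by apply: cvgD; [exact: cvg_cst|exact: cF].
  by apply: cvg_norm; apply: cvgB; [exact: cvg_cst|exact: cF].
exists f; split=> // [t|t Kt|].
- by rewrite fmin le_min ler01 F0 ge_min lexx.
- have [x xs gx] := Ks t Kt.
  rewrite fmin; apply/min_idPl; rewrite /F (bigD1_seq x) ?undup_uniq //=.
  have r0 : 0 <= \sum_(i <- s | i != x) g i t *+ 2.
    rewrite big_seq_cond; apply: sumr_ge0 => z /andP[/sU Uz _].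
    by have [_ /(_ t)/andP[a _] _ _] := gP z Uz; rewrite mulrn_wge0.
  by rewrite mulr2n; lra.
have FC : C0 R U (fun t => (F t)%:C).
  have FE : (fun t => (F t)%:C) = \sum_(x <- s) (fun t => (g x t *+ 2)%:C : Cplx R).
    by apply/funext => t; rewrite sum_pt /F rmorph_sum.
  rewrite FE big_seq; apply: C0_sum => x /sU Ux.
  have [_ _ _ gC] := gP x Ux; have := C0_lin 1 gC gC.
  by congr C0; apply/funext => t; rewrite mul1r mulr2n rmorphD.
apply: (C0_dom ltr01 FC); first exact: cts_real.
  move=> t nU; have := C0_out FC nU => /(@complexI R) Ft.
  by rewrite fmin Ft; congr (_%:C); apply/min_idPr.
move=> t; rewrite mul1r !cn_real fmin ger0_norm ?le_min ?ler01 ?F0 //.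
by rewrite ge_min ler_norm orbT.
Qed.
End Bumps.

(** * Continuity of the fibre norms *)

Section Semicontinuity.
Variables (R : realType) (Y T : topologicalType) (p : T -> Y).
Variable Theta : partial_aut T.
Hypothesis p_Theta : forall x, pdom Theta x -> p (pfun Theta x) = p x.
Hypothesis p_cts : continuous p.
Hypotheses (hT : hausdorff_space T) (hY : hausdorff_space Y).
Local Notation C := (complex R).
Local Notation xel := (int -> T -> Cplx R).
Local Notation xalg := (xalg R Theta).
Local Notation rmx := (regmx Theta).
Local Notation "x %:C" := (real_complex R x).
Implicit Types (a : xel).

Definition fnred y a : R := nred Theta (p @^-1` [set y]) a.

Lemma near_seq (X : topologicalType) (I : eqType) (s : seq I) (x : X) (P : I -> X -> Prop) :
  (forall i, i \in s -> \forall z \near x, P i z) ->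
  \forall z \near x, forall i, i \in s -> P i z.
Proof.
elim: s => [|i s IH] h; first by near=> z.
have h1 : \forall z \near x, P i z by apply: h; rewrite mem_head.
have h2 : \forall z \near x, forall j, j \in s -> P j z.
  by apply: IH => j js; apply: h; rewrite in_cons js orbT.
near=> z => j; rewrite in_cons => /orP[/eqP ->|js]; first by near: z.
by move: j js; near: z.
Unshelve. all: by end_near. Qed.

(** p is not assumed proper; but the image of a compact set is compact, hence closed in Y, so a
    fibre missing [K] has neighbouring fibres missing it. *)
Lemma near_avoid_compact (K : set T) y : compact K ->
  (forall h, p h = y -> ~ K h) ->
  \forall z \near y, forall h, p h = z -> ~ K h.
Proof.
move=> cK yK.
have cpK : compact (p @` K).
  by apply: continuous_compact cK; apply: continuous_subspaceT.
have : open (~` (p @` K)) by apply: closed_openC; apply: compact_closed.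
rewrite openE => /(_ y); rewrite /interior /= => o.
have : nbhs y (~` (p @` K)) by apply: o => -[h Kh /yK].
by apply: filterS => z nz h hz Kh; apply: nz; exists h.
Qed.

(** Pick q strictly between [fnred y a] and r and m by [growth]. Over y the finitely many
    coefficients of [sqs a m] stay below q^(2^(m+1)), hence also over nearby z. There the norm of
    [sqs a m], a power of [fnred z a], is below the same power of r. *)
Lemma fnred_usc a y (r : R) : xalg a -> fnred y a < r ->
  \forall z \near y, fnred z a < r.
Proof.
move=> xa yr.
have n0 : 0 <= fnred y a by exact: nred_ge0.
have r0 := le_lt_trans n0 yr.
pose q := (fnred y a + r) / 2.
have q1 : fnred y a < q by rewrite /q; lra.
have q0 : 0 < q by apply: le_lt_trans q1.
have q2 : q < r by rewrite /q; lra.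
have [d sa] := xalg_supp xa; set D := (d + d)%N.
have [|m hm] := growth (ltW q0) q2 (c := (D + D).+1%:R); first by [].
have sm : supp (D * 2 ^ m) (sqs Theta a m) by exact: sqs_supp.
have xm := sqs_xalg hT m xa.
set e := q ^+ (2 ^ m.+1) in hm.
have e0 : 0 < e by rewrite exprn_gt0.
have : \forall z \near y, forall k, k \in win (D * 2 ^ m) ->
    forall h, p h = z -> ~ [set x | e <= cn (sqs Theta a m k x)] h.
  apply: near_seq => k _; apply: near_avoid_compact.
    exact: (C0_compact (xalg_C0 k xm) e0).1.
  move=> h hy /=; apply/negP; rewrite -ltNge.
  apply: le_lt_trans (nred_entry k xm (hy : (p @^-1` [set y]) h)) _.
  by rewrite nred_sqs // ltr_pXn2r ?expn_gt0 ?nnegrE ?nred_ge0 ?(ltW q0).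
apply: filterS => z hz.
have : fnred z (sqs Theta a m) <= (D * 2 ^ m + D * 2 ^ m).+1%:R * e.
  have oc : orbit_closed Theta (p @^-1` [set z]) by exact: (fiber_orbit_closed p_Theta).
  apply: (nred_sup_le sm (ltW e0) oc) => k h hz'.
  have [km|km] := boolP (k \in win (D * 2 ^ m)).
    by have /negP := hz k km h hz'; rewrite -ltNge => /ltW.
  by rewrite sm ?cn0 ?ltW //; move: km; rewrite mem_win -ltnNge.
rewrite /fnred nred_sqs // => h1.
rewrite ltNge; apply/negP => h2.
have : r ^+ (2 ^ m.+1) <= nred Theta (p @^-1` [set z]) a ^+ (2 ^ m.+1).
  by rewrite ler_pXn2r ?expn_gt0 ?nnegrE ?nred_ge0 ?(ltW r0).
move=> /le_trans/(_ h1); apply/negP; rewrite -ltNge; apply: le_lt_trans hm.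
rewrite ler_wpM2r ?(ltW e0) // -natrM ler_nat expnS.
by have := expn_gt0 2 m; move: (2 ^ m)%N => N; nia.
Qed.

Lemma cts_ext_at (f g : T -> Cplx R) h : (forall x, f x = g x) ->
  {for h, continuous g} -> {for h, continuous f}.
Proof. by move=> fg; have -> : f = g by apply/funext. Qed.

Lemma cts_sum_at (I : Type) (s : seq I) (F : I -> T -> Cplx R) h :
  (forall i, {for h, continuous (F i)}) ->
  {for h, continuous (fun x => \sum_(i <- s) F i x : Cplx R)}.
Proof.
move=> cF; elim: s => [|i s IH].
  apply: (@cts_ext_at _ (fun=> 0)) => [x|]; first by rewrite big_nil.
  exact: cts_cst.
apply: (@cts_ext_at _ (fun x => 1 * F i x + \sum_(i <- s) F i x)) => [x|].
  by rewrite big_cons mul1r.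
exact (cts_lin_at (cF i) IH).
Qed.

(* Only indices l with h in the domain of theta^l matter at h; truncating v to
   them makes x |-> |regmx_x(a) v|^2 continuous at h. *)
Lemma nred_lsc a (S : set T) (r : R) : xalg a -> 0 <= r -> r < nred Theta S a ->
  exists2 h, S h & \forall x \near h, forall S' : set T, S' x -> r < nred Theta S' a.
Proof.
move=> xa r0 rn.
have [h [Sh [v [fv hv]]]] : exists h, S h /\ exists v, vfin v /\
    r ^+ 2 * vsq v < vsq (mact (rmx h a) v).
  apply: contrapT => nex; move: rn; rewrite ltNge => /negP; apply.
  apply: nred_le; split=> // h Sh v fv; rewrite leNgt; apply/negP => hv.
  by apply: nex; exists h; split=> //; exists v.
have [d sa] := xalg_supp xa; have [e sv] := fv.
pose w : int -> C := fun l => if `[< Hdom Theta l h >] then v l else 0.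
have sw : supp e w by move=> l /sv vl; rewrite /w vl; case: ifP.
have wv : vsq w <= vsq v.
  rewrite (vsqE sw) (vsqE sv); apply: ler_sum => l _; rewrite /w.
  by case: ifP => // _; rewrite cn0 expr0n sqr_ge0.
have Ew : mact (rmx h a) w = mact (rmx h a) v.
  apply/funext => n; rewrite (mactE _ _ sw) (mactE _ _ sv); apply: eq_bigr => l _.
  rewrite /w; case: asboolP => // nl; rewrite /regmx.
  case E : (ppow Theta l h) => [z|]; last by rewrite pull_none // !mul0r.
  by case: nl; apply/HdomP; exists z.
have hw : r ^+ 2 * vsq w < vsq (mact (rmx h a) w).
  by rewrite Ew; apply: le_lt_trans hv; rewrite ler_wpM2l ?sqr_ge0.
have scts n : {for h, continuous (fun x => mact (rmx x a) w n : Cplx R)}.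
  apply: (@cts_ext_at _ (fun x => \sum_(l <- win e) rmx x a n l * w l)) => [x|].
    exact: mactE.
  apply: cts_sum_at => l; rewrite /w; case: asboolP => [/HdomP[z hz]|_].
    apply: cts_mul_at; last exact: cts_cst.
    exact: pull_cts_at (C0_cts (xalg_C0 _ xa)) hz.
  apply: (@cts_ext_at _ (fun=> 0)) => [x|]; first by rewrite mulr0.
  exact: cts_cst.
have sN x : supp (d + e) (mact (rmx x a) w) := mact_supp (regmx_band Theta x sa) sw.
have vcts : {for h, continuous (fun x => vip (mact (rmx x a) w) (mact (rmx x a) w) : Cplx R)}.
  apply: (@cts_ext_at _ (fun x => \sum_(n <- win (d + e))
    Num.conj (mact (rmx x a) w n) * mact (rmx x a) w n)) => [x|].
    exact: vipE.
  apply: cts_sum_at => n; by apply: cts_mul_at; [exact: cts_conj_at|].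
have fw : vfin w by exists e.
have fN x : vfin (mact (rmx x a) w) by exists (d + e)%N.
exists h => //.
have /cts_atP/(_ (vsq (mact (rmx h a) w) - r ^+ 2 * vsq w)) := vcts.
rewrite subr_gt0 => /(_ hw); apply: filterS => x.
rewrite !vip_vsq // -rmorphB cn_real => hx S' S'x.
rewrite ltNge; apply/negP => nr.
have [n0 hn] := nredP S' xa.
have := hn x S'x w fw.
have : nred Theta S' a ^+ 2 * vsq w <= r ^+ 2 * vsq w.
  by rewrite ler_wpM2r ?vsq_ge0 // ler_pXn2r.
move: hx; rewrite ltr_norml => /andP[hx _]; move: hx; lra.
Qed.

Hypothesis p_open : forall U : set T, open U -> open (p @` U).

Lemma fnred_lsc a y (r : R) : xalg a -> r < fnred y a ->
  \forall z \near y, r < fnred z a.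
Proof.
move=> xa ry; have [r0|r0] := ltP r 0.
  by near=> z; apply: lt_le_trans r0 (nred_ge0 _ _ _).
have [h hy hn] := nred_lsc xa r0 ry.
(* Any set through a point of B has norm above r; by openness of p the fibres meeting the interior
   of B fill a neighbourhood of y. *)
pose B := [set x | forall S' : set T, S' x -> r < nred Theta S' a].
have Bh : B° h by exact: hn.
have : nbhs y (p @` B°).
  by apply: open_nbhs_nbhs; split; [apply: p_open; exact: open_interior|exists h].
by apply: filterS => z [x Bx xz]; exact: (interior_subset Bx).
Unshelve. all: by end_near. Qed.

Lemma fnred_cts a : xalg a -> continuous (fun y => fnred y a).
Proof.
move=> xa y; apply/cvgrPdist_lt => e e0; near=> z.
have h1 : fnred z a < fnred y a + e.
  by near: z; apply: fnred_usc => //; rewrite ltrDl.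
have h2 : fnred y a - e < fnred z a.
  by near: z; apply: fnred_lsc => //; rewrite gtrBl.
by rewrite ltr_norml; apply/andP; split; lra.
Unshelve. all: by end_near. Qed.
End Semicontinuity.

(** * The structure over the base *)

Section ContinuousField.
Variables (R : realType) (Y T : topologicalType) (p : T -> Y).
Variable Theta : partial_aut T.
Hypothesis p_Theta : forall x, pdom Theta x -> p (pfun Theta x) = p x.
Hypothesis p_cts : continuous p.
Hypothesis p_open : forall U : set T, open U -> open (p @` U).
Hypothesis p_surj : forall y, exists x, p x = y.
Hypotheses (hT : hausdorff_space T) (lcT : locally_compact [set: T]).
Hypotheses (hY : hausdorff_space Y) (lcY : locally_compact [set: Y]).
Local Notation C := (complex R).
Local Notation xel := (int -> T -> Cplx R).
Local Notation xalg := (xalg R Theta).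
Local Notation "x %:C" := (real_complex R x).
Variables (A : cstarAlgType R) (iota : xel -> A).
Hypothesis hA : is_crossed_product Theta iota.
Implicit Types (x w : xel) (a b : A) (f g : Y -> Cplx R).

Definition bmul : (Y -> Cplx R) -> A -> A := base_mult p_Theta p_cts hT hA.
Definition base_action f : (A -> A) * (A -> A) := (bmul f, bmul f).
Local Notation phi := base_action.

Lemma bmul_iota (U : set Y) f x : C0 R U f -> xalg x -> bmul f (iota x) = iota (mulf p f x).
Proof. by move=> /C0_bcts bf xx; apply: base_mult_iota. Qed.

Lemma iotaB x w : xalg x -> xalg w -> iota (x - w) = iota x - iota w.
Proof.
move=> xx xw; rewrite addrC -scaleN1r (iota_lin hA) // scaleN1r addrC //.
Qed.

Lemma xalgB x w : xalg x -> xalg w -> xalg (x - w).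
Proof. by move=> xx xw; rewrite addrC -scaleN1r; apply: xalg_lin. Qed.

Lemma base_action_star_hom : star_hom (C0 R [set: Y]) (fun f g y => f y * g y)
  (fun f y => cconj (f y)) (@mmul R A) (@mstar R A) phi.
Proof.
split=> [c f g fC gC|f g fC gC|f fC].
- have bf := C0_bcts fC; have bg := C0_bcts gC.
  have bfg := C0_bcts (C0_lin c fC gC).
  have E : bmul (c *: f + g) = c *: bmul f + bmul g.
    by apply/funext => a; apply: base_mult_lin.
  by rewrite /base_action E.
- have bf := C0_bcts fC; have bg := C0_bcts gC.
  have bfg := C0_bcts (C0_mul fC gC).
  congr pair; apply/funext => a; first exact: base_mult_comp.
  have -> : (fun y => f y * g y) = (fun y => g y * f y).
    by apply/funext => y; rewrite mulrC.
  by apply: base_mult_comp => //; apply: C0_bcts (C0_mul gC fC).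
- have bf := C0_bcts fC.
  have E a : bmul (fun y => cconj (f y)) a = cstar (bmul f (cstar a)).
    by rewrite /bmul base_mult_star // cstarK.
  by congr pair; apply/funext => a; apply: E.
Qed.

Lemma bmulMl f a b : bcts f -> bmul f (cmul a b) = cmul (bmul f a) b.
Proof. exact: base_mult_mull. Qed.

Lemma bmulMr f a b : bcts f -> bmul f (cmul a b) = cmul a (bmul f b).
Proof. exact: base_mult_mulr. Qed.

Lemma base_action_center f : C0 R [set: Y] f -> mcenter (phi f).
Proof.
move=> /C0_bcts bf; split=> [a b|n hn] /=.
  by rewrite -bmulMr // bmulMl.
have comm1 a : bmul f (n.1 a) = n.1 (bmul f a).
  by apply: cmul_nondeg => c; rewrite -bmulMr // !hn bmulMr.
have comm2 a : bmul f (n.2 a) = n.2 (bmul f a).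
  (* [cmul_nondeg] tests by multiplication on the left only; adjoints turn the right multiplication
     suited to [n.2] into that form. *)
  suff E : cstar (bmul f (n.2 a)) = cstar (n.2 (bmul f a)).
    by rewrite -[LHS]cstarK E cstarK.
  apply: cmul_nondeg => c; rewrite -[c]cstarK -!cstarM; congr cstar.
  by rewrite -bmulMl // -!hn bmulMl.
by congr pair; apply/funext => a /=; rewrite ?comm1 ?comm2.
Qed.

(** Surjectivity of p provides a point h over y. A bump equal to 1 at h, placed in degree 0, reads
    off f(y) - g(y) as a coefficient, which the norm controls. *)
Lemma base_action_inj f g : C0 R [set: Y] f -> C0 R [set: Y] g -> phi f = phi g -> f = g.
Proof.
move=> fC gC fg; apply/funext => y; have [h hy] := p_surj y.
have [u [cu _ uh uC]] := point_bump R hT lcT openT (I : [set: T] h).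
pose x : xel := smono 0 (fun t => (u t)%:C).
have xx : xalg x by apply: xalg_mono; rewrite Hdom0.
have bf := C0_bcts fC; have bg := C0_bcts gC.
have xf := xalg_mulf p_cts bf xx; have xg := xalg_mulf p_cts bg xx.
have e : iota (mulf p f x - mulf p g x) = 0.
  rewrite iotaB // -(bmul_iota fC) // -(bmul_iota gC) //.
  have -> : bmul f = bmul g by have := congr1 fst fg.
  by rewrite subrr.
have xfg := xalgB xf xg.
have := nred_entry 0 xfg (I : [set: T] h).
rewrite -(cp_norm hT hA) // e rnorm0 => le0.
have /eqP : cn ((mulf p f x - mulf p g x) 0 h) == 0 by rewrite eq_le le0 cn_ge0.
move=> /eqP; rewrite cn_eq0 => /eqP.
change (mulf p f x 0 h - mulf p g x 0 h = 0 -> f y = g y).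
by rewrite /mulf /x /smono eqxx hy uh !mulr1 => /eqP; rewrite subr_eq0 => /eqP.
Qed.

(** An approximate unit from the base: f equals 1 on the projection of the points where some
    coefficient is at least e1. With U = Y it gives non-degeneracy, with U the complement of a point
    it describes the fibre ideal. *)
Lemma base_cut (U : set Y) x (e : R) : open U -> xalg x ->
  (forall k h, x k h <> 0 -> U (p h)) -> 0 < e ->
  exists2 f, C0 R U f & rnorm (bmul f (iota x) - iota x) < e.
Proof.
move=> oU xx xU e0; have [d sx] := xalg_supp xx.
pose e1 := e / 2 / (d + d).+1%:R.
have e10 : 0 < e1 by rewrite !divr_gt0.
pose Kk k := [set h | e1 <= cn (x k h)].
pose K := p @` \big[setU/set0]_(k <- win d) Kk k.
have cK : compact K.
  apply: continuous_compact; first exact: continuous_subspaceT.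
  apply: bigsetU_compact => k _; exact: (C0_compact (xalg_C0 k xx) e10).1.
have KU : K `<=` U.
  move=> _ [h + <-]; rewrite -bigcup_seq => -[k _ /= xk]; apply: (xU k) => x0.
  by move: xk; rewrite /Kk /= x0 cn0 leNgt e10.
have [f [cf f01 fK fU]] := bump R hY lcY cK oU KU.
exists (fun y => (f y)%:C) => //.
have bf := C0_bcts fU; have xf := xalg_mulf p_cts bf xx.
rewrite (bmul_iota fU) // -iotaB // (cp_norm hT hA); last exact: xalgB.
have sf : supp d (mulf p (fun y => (f y)%:C) x - x).
  move=> k kd; change (mulf p (fun y => (f y)%:C) x k - x k = 0).
  by rewrite (supp_mulf p _ sx) // sx // subrr.
apply: (@le_lt_trans _ _ ((d + d).+1%:R * e1)); last first.
  by rewrite /e1 mulrC mulfVK ?pnatr_eq0 // gtr_pMr // invf_lt1 // ltr1n.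
apply: (nred_sup_le sf (ltW e10)) => // k h _.
change (cn (mulf p (fun y => (f y)%:C) x k h - x k h) <= e1).
rewrite /mulf -[X in _ - X]mul1r -mulrBl cnM.
have [h1|h1] := leP e1 (cn (x k h)).
  rewrite fK ?subrr ?cn0 ?mul0r ?(ltW e10) //; exists h => //.
  rewrite -bigcup_seq; exists k => //=.
  have [//|] := boolP (k \in win d); rewrite mem_win -ltnNge => /sx xk0.
  by move: h1; rewrite xk0 cn0 leNgt e10.
apply: le_trans (ltW h1); rewrite ler_piMl ?cn_ge0 //.
have /andP[a b] := f01 (p h).
by rewrite -(rmorph1 (real_complex R)) -rmorphB cn_real ler_norml; apply/andP; split; lra.
Qed.

Lemma base_action_structure : C0_structure phi.
Proof.
split.
- exact: base_action_star_hom.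
- exact: base_action_center.
- exact: base_action_inj.
apply/seteqP; split=> // a _ J [[cJ J0 JL] gJ].
apply: ((rnorm_closed J).1 cJ) => e e0.
have e2 : 0 < e / 2 by rewrite divr_gt0.
have [_ [x xx <-] ax] := cp_dense hT hA a e2.
have [f fC fx] := @base_cut setT x _ openT xx (fun _ _ _ => I) e2.
exists (bmul f (iota x)).
  by apply: gJ; exists f => //; exists (iota x).
apply: le_lt_trans (rnormBB _ (iota x) _) _.
by rewrite [ltRHS]splitr ltrD.
Qed.

(** * The quotient norm on a fibre as the reduced norm over it *)

Section FiberNorm.
Variable y : Y.
Local Notation I_y := (fiber_ideal phi y).

Lemma fiber_idealP a : a \in I_y <->
  smallest (@closed_ideal R A)
    [set (phi f).1 b | f in C0 R (~` [set y]) & b in [set: A]] a.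
Proof. by split=> [/asboolP|h]; [|apply/asboolP]. Qed.

Lemma fiber_ideal_closed a :
  (forall e : R, 0 < e -> exists2 b, b \in I_y & rnorm (b - a) < e) -> a \in I_y.
Proof.
move=> h; apply/fiber_idealP => J [Jid gJ].
have [[cJ _ _] _] := Jid.
apply: ((rnorm_closed J).1 cJ) => e /h[b /fiber_idealP bI ba].
by exists b => //; apply: bI.
Qed.

Lemma iota_fiber_ideal x : xalg x -> (forall k h, p h = y -> x k h = 0) -> iota x \in I_y.
Proof.
move=> xx x0; apply: fiber_ideal_closed => e e0.
have oU : open (~` [set y]).
  apply: closed_openC; apply: accessible_closed_set1.
  exact: hausdorff_accessible.
have xU k h : x k h <> 0 -> (~` [set y]) (p h) by move=> xkh /x0.
have [f fC fx] := base_cut oU xx xU e0.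
exists (bmul f (iota x)) => //; apply/fiber_idealP => J [_ gJ].
by apply: gJ; exists f => //; exists (iota x).
Qed.

Variables (B : cstarAlgType R) (psi : A -> B).
Hypothesis hpsi : star_hom [set: A] (@cmul R A) (@cstar R A) (@cmul R B) (@cstar R B) psi.
Hypothesis psi_norm : forall x, xalg x -> rnorm (psi (iota x)) = fnred p Theta y x.

Let psiB a b : psi (a - b) = psi a - psi b.
Proof. exact: (star_hom_badd hpsi).1. Qed.

(** The kernel of [psi] is a closed ideal. It contains the generators since f(y) = 0 makes f act by
    zero in the regular representations over y. *)
Lemma fiber_ideal_ker a : a \in I_y -> psi a = 0.
Proof.
move=> /fiber_idealP/(_ [set b | psi b = 0]); apply; split; last first.
  move=> _ [f fC [b _ <-]] /=.
  have oy : f y = 0 by apply: (C0_out fC) => /=; apply.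
  have bf := C0_bcts fC.
  have -> : psi (bmul f b) = (fun=> 0) b.
    refine (@badd_eqP R A B _ (fun b => psi (bmul f b)) (fun=> 0) b (cp_dense hT hA) _ _ _).
    - exact: (badd_comp (star_hom_badd hpsi) (badd_base_mult p_Theta p_cts hT hA bf)).
    - by split=> [u v|]; [rewrite subrr|exists 0 => u; rewrite mul0r rnorm0].
    move=> _ [x xx <-]; rewrite (bmul_iota fC) //; apply: rnorm_eq0.
    have xf := xalg_mulf p_cts bf xx.
    apply/eqP; rewrite psi_norm // eq_le nred_ge0 andbT.
    by apply: nred_mulf_le => // h /= ->; rewrite oy cn0 mul0r.
  by [].
have psi0 : psi 0 = 0 by have := psiB 0 0; rewrite !subrr.
have [L M _] := hpsi.
split; first split.
- apply/rnorm_closed => b hb; apply: rnorm_eq0; apply/eqP.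
  rewrite eq_le rnorm_ge0 andbT; apply/ler_addgt0Pr => e /hb[s /= s0 sb].
  rewrite add0r -[psi b]subr0 -s0 -psiB; apply: le_trans (star_hom_contraction hpsi _) _.
  by rewrite rnormBC ltW.
- by [].
- by move=> c u v /= u0 v0; rewrite L // u0 v0 scaler0 addr0.
by move=> u v /= u0; rewrite !M // u0 cmul0l cmul0r.
Qed.

Lemma fnorm_ge a : rnorm (psi a) <= fnorm (to_fiber phi y a).
Proof.
apply: lb_le_inf; first by exists (rnorm a), a.
move=> _ [b /= /to_fiberE ba <-]; have := fiber_ideal_ker ba.
rewrite psiB => /eqP; rewrite subr_eq0 => /eqP <-.
exact: star_hom_contraction.
Qed.

Lemma fnorm_le_rep a b : b - a \in I_y -> fnorm (to_fiber phi y a) <= rnorm b.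
Proof.
move=> ba; apply: ge_inf; first by exists 0 => _ [c _ <-]; exact: rnorm_ge0.
by exists b => //=; apply/to_fiberE.
Qed.

(** Upper semicontinuity supplies the nontrivial inequality. Approximate a by [iota x] and cut x by
    a bump g with g(y) = 1, supported where [fnred z x] is nearly at most [fnred y x]. Then x - g x
    vanishes over y, so it lies in the fibre ideal, while g x has small global norm. *)
Lemma fnorm_psi a : fnorm (to_fiber phi y a) = rnorm (psi a).
Proof.
apply/eqP; rewrite eq_le fnorm_ge andbT; apply/ler_addgt0Pr => e e0.
have e4 : 0 < e / 4 by rewrite divr_gt0.
have [_ [x xx <-] ax] := cp_dense hT hA a e4.
have hx : rnorm (psi (iota x)) <= rnorm (psi a) + e / 4.
  apply: le_trans (rnorm_le_dist _ (psi a)) _; rewrite lerD2l -psiB.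
  exact: le_trans (star_hom_contraction hpsi _) (ltW ax).
have near_y : \forall z \near y, fnred p Theta z x < fnred p Theta y x + e / 4.
  by apply: fnred_usc => //; rewrite ltrDl.
pose W := [set z | fnred p Theta z x < fnred p Theta y x + e / 4].
have Wy : W° y by exact: near_y.
have [g [cg g01 gy gW]] := point_bump R hY lcY (@open_interior _ W) Wy.
pose gc z : Cplx R := (g z)%:C.
have bg := C0_bcts gW.
have xg := xalg_mulf p_cts bg xx.
have wI : iota (x - mulf p gc x) \in I_y.
  apply: iota_fiber_ideal => [|k h hy]; first exact: xalgB.
  change (x k h - mulf p gc x k h = 0).
  by rewrite /mulf /gc hy gy rmorph1 mul1r subrr.
(* This representative of the class of a has norm at most |a - iota x| + |iota (g x)|, and the three
   errors of e/4 fit in e. *)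
apply: (@le_trans _ _ (rnorm (a - iota (x - mulf p gc x)))).
  apply: fnorm_le_rep; rewrite addrAC subrr add0r -scaleN1r -[_ *: _]addr0.
  by apply: fiber_ideal_lin => //; case: (fiber_ideal_zmod_closed phi y).
rewrite iotaB // opprB addrA addrAC.
apply: le_trans (rnormD _ _) _; rewrite rnormBC.
have gn : rnorm (iota (mulf p gc x)) <= fnred p Theta y x + e / 4.
  rewrite (cp_norm hT hA) //; apply: nred_mulf_le => //.
    by rewrite addr_ge0 ?nred_ge0 // ltW.
  move=> h _; have [hW|hW] := pselect (W° (p h)).
    have /andP[g0 g1] := g01 (p h).
    apply: le_trans (ltW (interior_subset hW : W (p h))).
    apply: (@le_trans _ _ (1 * nred Theta [set h] x)).
      by rewrite ler_wpM2r ?nred_ge0 // cn_real ger0_norm.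
    by rewrite mul1r; apply: nred_sub => // _ ->.
  by rewrite /gc (C0_out gW hW) cn0 mul0r addr_ge0 ?nred_ge0 // ltW.
by rewrite -psi_norm // in gn; lra.
Qed.

Lemma psi_ker a : psi a = 0 -> a \in I_y.
Proof.
move=> a0; apply: fiber_ideal_closed => e e0.
have : fnorm (to_fiber phi y a) < e by rewrite fnorm_psi a0 rnorm0.
move=> /inf_lt; case.
  by exists (rnorm a), a.
move=> _ [b /= /to_fiberE ba <-] be; exists (a - b); last by rewrite addrAC subrr add0r rnormN.
rewrite -opprB -scaleN1r -[_ *: _]addr0.
by apply: fiber_ideal_lin => //; case: (fiber_ideal_zmod_closed phi y).
Qed.
End FiberNorm.

(** Elements of [iota] of [xalg] have continuous fibre norms, and approximation in [A] is uniform
    over all fibres because each fibre homomorphism is contractive. *)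
Lemma fnorm_cts a : continuous (fun y => fnorm (to_fiber phi y a) : R).
Proof.
move=> y; apply/cvgrPdist_lt => e e0.
have e3 : 0 < e / 3 by rewrite divr_gt0.
have [_ [x xx <-] ax] := cp_dense hT hA a e3.
have hd z : `|fnorm (to_fiber phi z a) - fnred p Theta z x| < e / 3.
  have [B [psi [hpsi pn]]] := cp_hom hT hA (p @^-1` [set z]).
  rewrite (fnorm_psi hpsi pn) /fnred -pn //.
  have psiB := (star_hom_badd hpsi).1.
  have h1 := star_hom_contraction hpsi (iota x - a); rewrite psiB in h1.
  have h2 := rnorm_le_dist (psi a) (psi (iota x)).
  have h3 := rnorm_le_dist (psi (iota x)) (psi a).
  rewrite (rnormBC (psi a)) in h2.
  by rewrite ltr_norml; apply/andP; split; lra.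
have cx := fnred_cts p_Theta p_cts hT hY p_open xx (x := y).
have /cvgrPdist_lt/(_ _ e3) := cx; apply: filterS => z.
have := hd z; have := hd y; rewrite !ltr_norml.
by move=> /andP[a1 a2] /andP[b1 b2] /andP[c1 c2]; apply/andP; split; lra.
Qed.
End ContinuousField.

(** * Separability *)

Section Separability.
Variables (R : realType) (T : topologicalType) (Theta : partial_aut T).
Hypothesis hT : hausdorff_space T.
Local Notation C := (complex R).
Local Notation xel := (int -> T -> Cplx R).
Local Notation xalg := (xalg R Theta).
Variables (A : cstarAlgType R) (iota : xel -> A).
Hypothesis hA : is_crossed_product Theta iota.

Definition qcplx (q : rat * rat) : C := Complex (ratr q.1 : R) (ratr q.2 : R).

Lemma qcplx_dense (z : C) (e : R) : 0 < e -> exists q, cn (z - qcplx q) < e.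
Proof.
move=> e0; case: z => a b; have e2 : 0 < e / 2 by rewrite divr_gt0.
have rd (c : R) : exists q : rat, `|c - ratr q| < e / 2.
  have [|q] := @rat_in_itvoo R (c - e / 2) (c + e / 2); first by lra.
  rewrite in_itv /= => /andP[h1 h2]; exists q.
  by rewrite ltr_norml; apply/andP; split; lra.
have [q1 h1] := rd a; have [q2 h2] := rd b; exists (q1, q2).
have -> : Complex a b - qcplx (q1, q2) =
   real_complex R (a - ratr q1) + 'i * real_complex R (b - ratr q2).
  by rewrite -complexiE; apply/eqP; rewrite eq_complex /=; apply/andP; split;
    apply/eqP; ring.
apply: le_lt_trans (cnD _ _) _.
rewrite cnM !cn_real {1}/cn normCi /= mul1r.
by rewrite [ltRHS]splitr ltrD.
Qed.

(* A code (d, n, L) describes x up to e := 1 / ((n + 1)(2d + 1)): x is supported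
   in [-d, d], and for (k, i, q) in L the function x k is within e of q on the
   i-th basic open set, these sets covering all points where |x k| >= e. *)
Definition code := (nat * nat * seq (int * nat * (rat * rat)))%type.

Definition code_eps (c : code) : R := c.1.2.+1%:R^-1 / (c.1.1 + c.1.1).+1%:R.

Lemma code_eps_gt0 c : 0 < code_eps c.
Proof. by rewrite divr_gt0 // invr_gt0. Qed.

Variables (Bs : set (set T)) (num : set T -> nat).

Definition coded (c : code) (x : xel) : Prop :=
  [/\ supp c.1.1 x,
      forall k i q b h, (k, i, q) \in c.2 -> Bs b -> num b = i -> b h ->
        cn (x k h - qcplx q) < code_eps c &
      forall k h, k \in win c.1.1 -> cn (x k h) < code_eps c \/
        exists i q b, [/\ (k, i, q) \in c.2, Bs b, num b = i & b h]].

(** At each point either both coefficients are small, or an entry of the code applies and puts both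
    near the same rational value. The number of diagonals cancels the denominator in [code_eps]. *)
Lemma coded_dist c x w : xalg x -> xalg w -> coded c x -> coded c w ->
  rnorm (iota x - iota w) <= c.1.2.+1%:R^-1 * 2.
Proof.
move=> xx xw [sx bx cx] [sw bw cw].
have xxw : xalg (x - w) by exact: xalgB.
rewrite -(iotaB hA) // (cp_norm hT hA) //.
have s : supp c.1.1 (x - w).
  by move=> k kd; change (x k - w k = 0); rewrite sx // sw // subrr.
have e0 : 0 <= code_eps c * 2 by rewrite mulr_ge0 // ltW // code_eps_gt0.
have oc : orbit_closed Theta [set: T] by [].
have -> : c.1.2.+1%:R^-1 * 2 = (c.1.1 + c.1.1).+1%:R * (code_eps c * 2) :> R.
  by rewrite /code_eps mulrA; congr (_ * _); rewrite mulrC mulfVK // pnatr_eq0.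
apply: (nred_sup_le s e0 oc) => k h _; change (cn (x k h - w k h) <= code_eps c * 2).
have [km|km] := boolP (k \in win c.1.1); last first.
  have kd : (c.1.1 < `|k|)%N by move: km; rewrite mem_win -ltnNge.
  by rewrite sx // sw // subrr cn0.
have tri q : cn (x k h - q) < code_eps c -> cn (w k h - q) < code_eps c ->
    cn (x k h - w k h) <= code_eps c * 2.
  move=> h1 h2; have -> : x k h - w k h = (x k h - q) - (w k h - q).
    by rewrite opprB addrA subrK.
  by apply: le_trans (cnD _ _) _; rewrite cnN mulr2n mulrDr !mulr1; lra.
case: (cx k h km) => [xk|[i [q [b [inL Bb nb bh]]]]]; last first.
  by apply: (tri (qcplx q)); [exact: bx inL Bb nb bh|exact: bw inL Bb nb bh].
case: (cw k h km) => [wk|[i [q [b [inL Bb nb bh]]]]]; last first.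
  by apply: (tri (qcplx q)); [exact: bx inL Bb nb bh|exact: bw inL Bb nb bh].
by apply: (tri 0); rewrite subr0.
Qed.

Hypothesis Bs_basis : basis Bs.
Hypothesis num_inj : forall b b', Bs b -> Bs b' -> num b = num b' -> b = b'.

Lemma coded_ex x n : xalg x -> exists2 c : code, c.1.2 = n & coded c x.
Proof.
move=> xx; have [d sx] := xalg_supp xx.
pose e := code_eps (d, n, [::]); have e0 : 0 < e by exact: code_eps_gt0.
have e2 : 0 < e / 2 by rewrite divr_gt0.
have L_ex k : exists s : seq (nat * (rat * rat)),
   (forall i q b h, (i, q) \in s -> Bs b -> num b = i -> b h ->
        cn (x k h - qcplx q) < e) /\
   forall h, cn (x k h) < e \/
        exists i q b, [/\ (i, q) \in s, Bs b, num b = i & b h].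
  have [cK _] := C0_compact (xalg_C0 k xx) e0.
  pose good (iq : nat * (rat * rat)) b := Bs b /\ num b = iq.1 /\
    forall h, b h -> cn (x k h - qcplx iq.2) < e.
  have [s Ks] : exists s : seq (nat * (rat * rat)), forall h, e <= cn (x k h) ->
      exists2 iq, iq \in s & exists2 b, good iq b & b h.
    apply: (compact_subcover (f := fun iq => [set h | exists2 b, good iq b & b h]) cK).
    move=> h _; have [q hq] := qcplx_dense (x k h) e2.
    have cx := C0_cts (xalg_C0 k xx).
    have /cts_atP/(_ _ e2) near_h := cx h.
    have [b [Bb bh] bsub] := Bs_basis.2 h _ near_h.
    exists (num b, q); have ob : open b by exact: Bs_basis.1.
    apply: (@filterS _ _ _ b); last exact: open_nbhs_nbhs.
    move=> t bt; exists b => //; split=> //; split=> // u bu.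
    have -> : x k u - qcplx q = (x k u - x k h) + (x k h - qcplx q).
      by rewrite addrA subrK.
    apply: le_lt_trans (cnD _ _) _; rewrite [ltRHS]splitr; apply: ltrD => //.
    exact: bsub.
  (* Entries of the subcover without a suitable basic set are dropped, so that the first clause
     holds for every entry kept; injectivity of [num] recovers the set from its number. *)
  exists [seq iq <- s | `[< exists b, good iq b >]]; split.
    move=> i q b h; rewrite mem_filter => /andP[/asboolP[b' [Bb' [nb' hb']]] _].
    by move=> Bb nb bh; apply: hb'; rewrite (num_inj Bb' Bb) // nb' nb.
  move=> h; have [h1|h1] := ltP (cn (x k h)) e; [by left|right].
  have [[i q] iqs [b gb bh]] := Ks h h1; exists i, q, b; split=> //.
  - by rewrite mem_filter iqs andbT; apply/asboolP; exists b.
  - by case: gb.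
  - by case: gb => _ [].
have [L LP] := choice L_ex.
pose LL := flatten [seq [seq (k, iq.1, iq.2) | iq <- L k] | k <- win d].
have mem_LL k i q : (k, i, q) \in LL -> (i, q) \in L k.
  by move=> /flattenP[_ /mapP[k' _ ->] /mapP[[i' q'] h [-> -> ->]]].
exists (d, n, LL) => //; split=> // [k i q b h /mem_LL|k h kd].
  exact: (LP k).1.
case: ((LP k).2 h) => [h1|[i [q [b [iq Bb nb bh]]]]]; [by left|right].
exists i, q, b; split=> //; apply/flattenP.
exists [seq (k, iq.1, iq.2) | iq <- L k]; first by apply/mapP; exists k.
by apply/mapP; exists (i, q).
Qed.

(** Codes are countable, and one element is chosen for each code that is realised; the chosen images
    are dense because elements with the same code are close. *)
Lemma cp_separable_aux : separable A.
Proof.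
have pick_ex (c : code) : exists x : xel, (exists2 w, xalg w & coded c w) ->
    xalg x /\ coded c x.
  have [[w xw cw]|nw] := pselect (exists2 w, xalg w & coded c w); last by exists 0.
  by exists w.
have [pick pickP] := choice pick_ex.
exists (range (fun c => iota (pick c))).
  by apply: (sub_countable (card_image_le _ _)); exact: countableP.
apply: rnorm_dense => a e e0; have e2 : 0 < e / 2 by rewrite divr_gt0.
have e4 : 0 < e / 4 by rewrite divr_gt0.
have [_ [x xx <-] ax] := cp_dense hT hA a e2.
have [n /(_ n (leqnn _)) hn] := invS_small e4.
have [c cn_ cx] := coded_ex n xx.
have [xp cp] := pickP c (ex_intro2 _ _ x xx cx).
exists (iota (pick c)); first by exists c.
apply: le_lt_trans (rnormBB _ (iota x) _) _; rewrite [ltRHS]splitr.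
apply: ler_ltD ax; apply: le_trans (coded_dist xp xx cp cx) _.
by rewrite cn_; move: (n.+1%:R^-1) hn => t; lra.
Qed.
End Separability.

Lemma cp_separable (R : realType) (T : topologicalType) (Theta : partial_aut T)
    (A : cstarAlgType R) (iota : (int -> T -> Cplx R) -> A) :
  hausdorff_space T -> @second_countable T -> is_crossed_product Theta iota ->
  separable A.
Proof.
move=> hT [Bs cB bB] hA; have /countable_injP[num numP] := cB.
apply: (cp_separable_aux hT hA bB (num := num)) => b b' Bb Bb'.
by apply: numP; exact: mem_set.
Qed.

(** * Restriction to an invariant closed subset *)

Section Subspace.
Variables (R : realType) (T : topologicalType) (S : set T).
Hypothesis cS : closed S.

Lemma set_val_cts : continuous (set_val : S -> T).
Proof. exact: initial_continuous. Qed.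

Lemma subspace_nbhs (x : S) (U : set S) : nbhs x U ->
  exists2 V : set T, nbhs (set_val x) V & forall z : S, V (set_val z) -> U z.
Proof.
move=> [/= _ [[W oW <-] /= Wx WU]]; exists W; first exact: open_nbhs_nbhs.
by move=> z Wz; apply: WU.
Qed.

(** A cluster point in T of the pushed filter lies in [S] because [S] is closed, and it clusters in
    [S] because the topology there is the initial one. *)
Lemma subspace_compact (K : set T) : compact K ->
  compact (set_val @^-1` K : set S).
Proof.
move=> cK F PF FK.
have FS : (set_val @ F) (K `&` S).
  apply: (@filterS _ F _ (set_val @^-1` K)) => // x Kx.
  by split=> //; exact: Defs.S_val.
have FK' : (set_val @ F) K by [].
have [x [Kx clx]] := cK _ _ FK'.
have Sx : S x.
  apply: cS => U xU; have [z [[_ Sz] Uz]] := clx _ _ FS xU.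
  by exists z.
pose xs : S := exist _ x (mem_set Sx).
exists xs; split=> // A B FA /subspace_nbhs[V xV VB].
have FA' : (set_val @ F) (set_val @` A).
  by apply: (@filterS _ F _ A) => // z Az; exists z.
have [_ [[z Az <-] Vz]] := clx _ _ FA' xV.
by exists z; split=> //; apply: VB.
Qed.

Lemma subspace_hausdorff : hausdorff_space T -> hausdorff_space S.
Proof.
move=> hT x z clxz; apply: val_inj; apply: hT => U V xU zV.
have cx : nbhs x (set_val @^-1` U) by exact: set_val_cts.
have cz : nbhs z (set_val @^-1` V) by exact: set_val_cts.
by have [w [Uw Vw]] := clxz _ _ cx cz; exists (set_val w).
Qed.

Lemma C0_subspace (U : set T) (f : T -> Cplx R) : C0 R U f ->
  C0 R (set_val @^-1` U : set S) (fun x => f (set_val x)).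
Proof.
move=> fU; apply: C0_intro.
- move=> x; apply: continuous_comp; [exact: set_val_cts|exact: (C0_cts fU)].
- by move=> x nU; apply: (C0_out fU).
move=> e e0; have [K [cK KU] h] := C0_small fU e0.
by exists (set_val @^-1` K); [exact: subspace_compact|move=> x nK; apply: h].
Qed.

Variable Theta : partial_aut T.
Hypothesis S_inv : forall x, pdom Theta x -> (S (pfun Theta x) <-> S x).
Local Notation ThS := (restriction S_inv).

Lemma ppow_restriction k (x : S) :
  omap set_val (ppow ThS k x) = ppow Theta k (set_val x).
Proof.
have stepF (z : S) : omap set_val (pstep (pdom ThS) (pfun ThS) z) =
    pstep (pdom Theta) (pfun Theta) (set_val z).
  rewrite /pstep; case: asboolP => h1 //.
  exact: congr1 (rfunE S_inv h1).
have stepG (z : S) : omap set_val (pstep (pran ThS) (Defs.pinv ThS) z) =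
    pstep (pran Theta) (Defs.pinv Theta) (set_val z).
  rewrite /pstep; case: asboolP => h1 //.
  exact: congr1 (rinvE S_inv h1).
have it (F : S -> option S) (G : T -> option T) n :
    (forall z, omap set_val (F z) = G (set_val z)) ->
    omap set_val (iter n (obind F) (Some x)) = iter n (obind G) (Some (set_val x)).
  move=> FG; elim: n => //= n <-; by case: (iter n _ _).
by case: k => n; apply: it.
Qed.

Lemma Hdom_restriction k : Hdom ThS k = set_val @^-1` Hdom Theta k.
Proof.
apply/seteqP; split=> x; rewrite /Hdom /preimage /= -ppow_restriction;
  by case: (ppow ThS k x).
Qed.

Lemma pull_restriction k (f : T -> Cplx R) (x : S) :
  pull ThS k (fun z => f (set_val z)) x = pull Theta k f (set_val x).
Proof. by rewrite /pull -ppow_restriction; case: (ppow ThS k x). Qed.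

Definition xres (a : int -> T -> Cplx R) : int -> S -> Cplx R :=
  fun k x => a k (set_val x).

Lemma supp_xres d a : supp d a -> supp d (xres a).
Proof. by move=> sa k kd; apply/funext => x; rewrite /xres sa. Qed.

Lemma xalg_xres a : xalg R Theta a -> xalg R ThS (xres a).
Proof.
move=> xa; split=> [k|]; first by rewrite Hdom_restriction; apply/C0_subspace/xalg_C0.
have [d sa] := xalg_supp xa; apply/finite_suppP; exists d; exact: supp_xres.
Qed.

Lemma regmx_xres a (x : S) : regmx ThS x (xres a) = regmx Theta (set_val x) a.
Proof.
by apply/funext => n; apply/funext => l; rewrite /regmx /xres pull_restriction.
Qed.

(** The orbit of a point of [S] stays in [S], so its regular representation is the same for the
    restricted system. *)
Lemma nred_xres a : nred ThS [set: S] (xres a) = nred Theta S a.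
Proof.
rewrite /nred; congr inf; apply/seteqP; split=> b [b0 hb]; split=> // h.
  move=> Sh; have := hb (exist _ h (mem_set Sh)) I.
  by rewrite regmx_xres.
by move=> _; rewrite regmx_xres; apply: hb; exact: (Defs.S_val h).
Qed.

Lemma xres_xmul a b : xalg R Theta a -> xalg R Theta b ->
  xres (xmul Theta a b) = xmul ThS (xres a) (xres b).
Proof.
move=> /xalg_supp[d sa] /xalg_supp[e sb].
apply/funext => n; apply/funext => x; rewrite [LHS]/xres.
by rewrite (xmul_mact _ _ _ _ sb) (xmul_mact _ _ _ _ (supp_xres sb)) regmx_xres.
Qed.

Lemma xres_xstar a : xres (xstar Theta a) = xstar ThS (xres a).
Proof.
apply/funext => n; apply/funext => x.
by rewrite /xres /xstar -pull_restriction.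
Qed.

Lemma xrep_xres (B : cstarAlgType R) (j : (int -> S -> Cplx R) -> B) :
  xrep ThS j -> xrep Theta (fun a => j (xres a)).
Proof.
move=> [L M St]; split=> [c a b xa xb|a b xa xb|a xa].
- by rewrite -L //; exact: xalg_xres.
- by rewrite xres_xmul // M //; exact: xalg_xres.
- by rewrite xres_xstar // St //; exact: xalg_xres.
Qed.

Hypotheses (hT : hausdorff_space T) (lcT : locally_compact [set: T]).
Local Notation "x %:C" := (real_complex R x).

(* Approximate Tietze extension: g = (sum_i q_i u_i) / (delta + sum_i u_i), with
   bumps u_i supported where f oscillates little around q_i. *)
Lemma C0_extend (U : set T) (f : S -> Cplx R) (e : R) : open U ->
  C0 R (set_val @^-1` U : set S) f -> 0 < e ->
  exists2 g : T -> Cplx R, C0 R U g & forall x : S, cn (g (set_val x) - f x) <= e.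
Proof.
move=> oU fU e0; have e3 : 0 < e / 3 by rewrite divr_gt0.
have [cK KU] := C0_compact fU e3.
have u_ex (x : S) : exists u : T -> R, (set_val @^-1` U) x ->
    [/\ continuous u /\ (forall t, 0 <= u t <= 1), u (set_val x) = 1, C0 R U (fun t => (u t)%:C) &
      forall z : S, u (set_val z) <> 0 -> cn (f z - f x) < e / 3].
  have [Ux|nU] := pselect ((set_val @^-1` U) x); last by exists (fun=> 0).
  have cf := C0_cts fU.
  have /cts_atP/(_ _ e3) /subspace_nbhs[V xV VB] := cf x.
  have oW : open (U `&` V°) by apply: openI => //; exact: open_interior.
  have [u [cu u01 ux uW]] := point_bump R hT lcT oW (conj Ux (xV : V° (set_val x))).
  exists u => _; split=> //; first by apply: C0_subset uW => t [].
  move=> z uz; apply: VB; apply: interior_subset.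
  have [//|nW] := pselect ((U `&` V°) (set_val z)); first by case.
  by have /(@complexI R) := C0_out uW nW.
have [u uP] := choice u_ex.
have [s0 Ks0] : exists s : seq S, forall x, e / 3 <= cn (f x) ->
    exists2 i, i \in s & (fun i z => (set_val @^-1` U) i /\ 2^-1 < u i (set_val z)) i x.
  apply: (compact_subcover (f := fun i z => (set_val @^-1` U) i /\ 2^-1 < u i (set_val z)) cK).
  move=> x xK; have Ux := KU x xK; exists x; have [[cu _] ux _ _] := uP x Ux.
  have h : \forall z \near x, 2^-1 < u x (set_val z).
    have cux : (fun z : S => u x (set_val z)) @ x --> u x (set_val x).
      by apply: continuous_comp; [exact: set_val_cts|exact: cu].
    by apply: (cvgr_gt (u x (set_val x)) cux); rewrite ux invf_lt1 // ltr1n.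
  by apply: filterS h => z hz; split.
pose s := undup [seq x <- s0 | `[< (set_val @^-1` U) x >]].
have sU x : x \in s -> (set_val @^-1` U) x.
  by rewrite mem_undup mem_filter => /andP[/asboolP].
have Ks z : e / 3 <= cn (f z) -> exists2 x, x \in s & 2^-1 < u x (set_val z).
  move=> /Ks0[x xs [Ux uxt]]; exists x => //.
  by rewrite mem_undup mem_filter xs andbT; apply/asboolP.
have [M M0 fM] := C0_bound fU.
(* The term d makes the denominator positive everywhere. Where |f| >= e/3 the sum F is at least 1/2,
   and d |f| <= e/6 is then at most (e/3) F; this fixes 6 and M. *)
pose d := e / 6 / M; have d0 : 0 < d by rewrite !divr_gt0.
pose F t := \sum_(i <- s) u i t.
pose G t := \sum_(i <- s) f i * (u i t)%:C.
have u0 i t : i \in s -> 0 <= u i t.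
  by move=> /sU Ui; have [[_ /(_ t)/andP[]]] := uP i Ui.
have F0 t : 0 <= F t by rewrite /F big_seq; apply: sumr_ge0 => i /u0.
have dF t : 0 < d + F t by rewrite ltr_pwDl.
have cF : continuous F.
  by apply: cts_sum_real => i /sU Ui; have [[]] := uP i Ui.
have GC : C0 R U G.
  have -> : G = \sum_(i <- s) (fun t => f i * (u i t)%:C : Cplx R).
    by apply/funext => t; rewrite sum_pt.
  rewrite big_seq; apply: C0_sum => i /sU Ui; have [_ _ uC _] := uP i Ui.
  by have := C0_lin (f i) uC (C0_zero R U); under eq_fun do rewrite addr0.
have cV : continuous (fun t => (d + F t)^-1).
  move=> t; apply: cvgV; first by rewrite gt_eqF.
  by apply: cvgD; [exact: cvg_cst|exact: cF].
exists (fun t => ((d + F t)^-1)%:C * G t).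
  apply: (C0_mulb (M := d^-1) (cts_real cV) _ GC) => t.
  rewrite cn_real ger0_norm ?invr_ge0 ?(ltW (dF t)) //.
  by rewrite lef_pV2 ?posrE // lerDl.
move=> z; set t := set_val z.
(* The error splits into the oscillation of f on the supports of the bumps and the contribution of
   d. Each is at most e/3 times d + F. *)
have -> : ((d + F t)^-1)%:C * G t - f z =
    ((d + F t)^-1)%:C * (\sum_(i <- s) (f i - f z) * (u i t)%:C - d%:C * f z).
  have -> : \sum_(i <- s) (f i - f z) * (u i t)%:C = G t - f z * (F t)%:C.
    rewrite /G /F rmorph_sum mulr_sumr -sumrB.
    by apply: eq_bigr => i _; rewrite mulrBl.
  have h : ((d + F t)^-1)%:C * (d + F t)%:C = 1 :> complex R.
    by rewrite -rmorphM mulVf ?rmorph1 // gt_eqF.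
  rewrite rmorphD /= in h.
  have alg (v g w a b : complex R) : v * (a + b) = 1 ->
      v * g - w = v * (g - w * b - a * w).
    by move=> e1; rewrite -[w in LHS]mulr1 -e1; ring.
  exact: alg h.
rewrite cnM cn_real ger0_norm ?invr_ge0 ?(ltW (dF t)) //.
rewrite ler_pdivrMl //; apply: le_trans (cnD _ _) _; rewrite cnN cnM cn_real gtr0_norm //.
have sum_le : cn (\sum_(i <- s) (f i - f z) * (u i t)%:C) <= e / 3 * F t.
  apply: le_trans (cn_sum _ _ _) _; rewrite /F mulr_sumr big_seq [leRHS]big_seq.
  apply: ler_sum => i si; rewrite cnM cn_real ger0_norm ?u0 //.
  have [uz|uz] := eqVneq (u i t) 0; first by rewrite uz !mulr0.
  rewrite ler_wpM2r ?u0 // cnB; have [_ _ _ h] := uP i (sU i si).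
  by apply/ltW/h/eqP.
have dM : d * M = e / 6 by rewrite /d mulfVK // gt_eqF.
have d_le : d * cn (f z) <= e / 3 * (d + F t).
  have [h|h] := leP (e / 3) (cn (f z)); last first.
    rewrite mulrC ler_pM ?cn_ge0 ?(ltW d0) ?(ltW h) //.
    by rewrite lerDl.
  have [i si hi] := Ks z h.
  have : 2^-1 <= F t.
    apply: le_trans (ltW hi) _; rewrite /F (bigD1_seq i) ?undup_uniq //= lerDl.
    by rewrite big_seq_cond; apply: sumr_ge0 => k /andP[/u0].
  have := ler_wpM2l (ltW d0) (fM z); rewrite dM => h1 h2.
  have : e / 3 * 2^-1 <= e / 3 * (d + F t).
    by rewrite ler_wpM2l ?(ltW e3) //; apply: le_trans h2 _; rewrite lerDr ltW.
  by move=> h3; apply: le_trans h1 _; apply: le_trans h3; lra.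
have h4 : e / 3 * F t <= e / 3 * (d + F t).
  by rewrite ler_wpM2l ?(ltW e3) // lerDr ltW.
have h5 : 0 <= e / 3 * (d + F t) by rewrite mulr_ge0 // ltW.
have : e / 3 * (d + F t) + e / 3 * (d + F t) <= (d + F t) * e.
  by move: h5; lra.
by move: sum_le d_le h4; lra.
Qed.
End Subspace.

(** * Identification of the fibres *)

Section Surjectivity.
Variables (R : realType) (A B : cstarAlgType R).

(** Dense range alone does not give surjectivity. With lifts of nearly the same norm, a sequence of
    approximations of b is lifted increment by increment to a convergent sequence in [A]. *)
Lemma open_mapping_surj (psi : A -> B) : badd psi ->
  (forall a (e : R), 0 < e -> exists2 a', psi a' = psi a & rnorm a' < rnorm (psi a) + e) ->
  rdense (range psi) -> forall b, exists a, psi a = b.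
Proof.
move=> bpsi lift dpsi b.
have h0 n : 0 < (2^-1 : R) ^+ n by rewrite exprn_gt0.
have c_ex n : exists c, rnorm (psi c - b) < 2^-1 ^+ n.
  by have [_ [c _ <-] cb] := dpsi b _ (h0 n); exists c.
have [c cP] := choice c_ex.
have d_ex n : exists d, psi d = psi (c n.+1 - c n) /\
    rnorm d < rnorm (psi (c n.+1 - c n)) + 2^-1 ^+ n.
  by have [d d1 d2] := lift (c n.+1 - c n) _ (h0 n); exists d.
have [d dP] := choice d_ex.
pose s := fix s n := if n is n'.+1 then s n' + d n' else c 0%N.
have psis n : psi (s n) = psi (c n).
  elim: n => //= n IH; have -> : s n + d n = s n - (- d n) by rewrite opprK.
  have psiN a : psi (- a) = - psi a.
    by rewrite -[- a]sub0r bpsi.1 -{1}(subrr a) bpsi.1 subrr sub0r.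
  by rewrite bpsi.1 psiN opprK (dP n).1 bpsi.1 IH addrC subrK.
have [a sa] : exists a, rcvg s a.
  (* The image increment is below (1 + 1/2) 2^-n and its lift may exceed it by 2^-n, so 3 is large
     enough. *)
  apply: (@rcvg_geometric _ _ s 2^-1 3) => // [|n]; first by rewrite invf_lt1 // ltr1n.
  rewrite /= addrAC subrr add0r.
  apply: le_trans (ltW (dP n).2) _; rewrite bpsi.1.
  have := rnormBB (psi (c n.+1)) b (psi (c n)).
  have := cP n; rewrite rnormBC; have := cP n.+1; rewrite exprS.
  have := h0 n; move: (2^-1 ^+ n) => t; lra.
exists a; apply: (rcvg_uniq (badd_cvg bpsi sa)) => e e0.
have [n0 hn] := invS_small e0; exists n0 => n n0n; rewrite psis.
apply: lt_trans (cP n) _; apply: le_lt_trans (hn n n0n).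
rewrite exprVn lef_pV2 ?posrE ?exprn_gt0 ?ltr0n // -natrX ler_nat.
exact: ltn_expl.
Qed.
End Surjectivity.

Section FiberIsomorphism.
Variables (R : realType) (Y T : topologicalType) (p : T -> Y).
Variable Theta : partial_aut T.
Hypothesis p_Theta : forall x, pdom Theta x -> p (pfun Theta x) = p x.
Hypothesis p_cts : continuous p.
Hypotheses (hT : hausdorff_space T) (lcT : locally_compact [set: T]).
Hypotheses (hY : hausdorff_space Y) (lcY : locally_compact [set: Y]).
Variables (A : cstarAlgType R) (iota : (int -> T -> Cplx R) -> A).
Hypothesis hA : is_crossed_product Theta iota.
Variable y : Y.
Local Notation S := (p @^-1` [set y]).
Local Notation ThS := (restriction (fiber_invariant y p_Theta)).
Variables (B : cstarAlgType R) (j : (int -> S -> Cplx R) -> B).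
Hypothesis hB : is_crossed_product ThS j.
Local Notation phi := (base_action p_Theta p_cts hT hA).

Lemma fiber_closed : closed S.
Proof.
apply: preimage_closed; first by move=> x _; exact: p_cts.
apply: accessible_closed_set1; exact: hausdorff_accessible.
Qed.

Lemma xalg_extend x' (e : R) : xalg R ThS x' -> 0 < e ->
  exists2 x, xalg R Theta x & nred ThS [set: S] (xres (S := S) x - x') < e.
Proof.
move=> xx' e0; have [d sx'] := xalg_supp xx'.
pose e1 := e / 2 / (d + d).+1%:R; have e10 : 0 < e1 by rewrite !divr_gt0.
have g_ex k : exists g : T -> Cplx R, C0 R (Hdom Theta k) g /\
    forall z : S, cn (g (set_val z) - x' k z) <= e1.
  have [|g gC hg] := C0_extend hT lcT (f := x' k) (Hdom_open Theta k) _ e10.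
    by rewrite -(Hdom_restriction (fiber_invariant y p_Theta)); apply: xalg_C0.
  by exists g.
have [g gP] := choice g_ex.
(* For |k| > d the extension of the zero coefficient is only approximately zero, so it is cut off to
   keep the support finite. *)
pose x : int -> T -> Cplx R := fun k => if (`|k| <= d)%N then g k else 0.
have sx : supp d x by move=> k kd; rewrite /x leqNgt kd.
have xx : xalg R Theta x.
  split=> [k|]; last by apply/finite_suppP; exists d.
  by rewrite /x; case: ifP => _; [exact: (gP k).1|exact: C0_zero].
exists x => //.
have s2 : supp d (xres (S := S) x - x').
  move=> k kd; change (xres (S := S) x k - x' k = 0).
  by rewrite (supp_xres _ sx) // sx' // subrr.
apply: (@le_lt_trans _ _ ((d + d).+1%:R * e1)); last first.
  by rewrite /e1 mulrC mulfVK ?pnatr_eq0 // gtr_pMr // invf_lt1 // ltr1n.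
apply: (nred_sup_le s2 (ltW e10)) => // k h _.
change (cn (x k (set_val h) - x' k h) <= e1); rewrite /x.
case: leqP => kd; first exact: (gP k).2.
by rewrite sx' // subrr cn0 ltW.
Qed.

(** Restriction to the fibre followed by [j] represents [xalg], so it induces [psi] from [A] to [B].
    On [iota x] its norm is [fnred], hence [fnorm_psi] makes the map on the fibre isometric. *)
Lemma fiber_iso_exists : exists Psi : fiber phi y -> B, fiber_isomorphism Psi /\
  forall a, xalg R Theta a -> Psi (to_fiber phi y (iota a)) = j (xres (S := S) a).
Proof.
have cS := fiber_closed.
have hS : hausdorff_space S by exact: subspace_hausdorff.
have [psi [hpsi psi_iota] _] := hA.2 B _ (xrep_xres cS hB.1).
have psi_norm x : xalg R Theta x -> rnorm (psi (iota x)) = fnred p Theta y x.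
  move=> xx; rewrite psi_iota // (cp_norm hS hB); last exact: xalg_xres.
  exact: nred_xres.
have bpsi := star_hom_badd hpsi.
have psi_fiber a : psi (repr (to_fiber phi y a)) = psi a.
  have /to_fiberE h := to_fiber_repr (to_fiber phi y a).
  have := fiber_ideal_ker hpsi psi_norm h.
  by rewrite bpsi.1 => /eqP; rewrite subr_eq0 => /eqP.
have psi_surj : forall b, exists a, psi a = b.
  apply: open_mapping_surj => //.
    move=> a e e0.
    (* The fibre norm is an infimum over representatives, so some representative has nearly the norm
       of its image: this is the lifting that surjectivity needs. *)
    have : fnorm (to_fiber phi y a) < rnorm (psi a) + e.
      by rewrite (fnorm_psi p_Theta p_cts hT hY lcY hA hpsi psi_norm) ltrDl.
    move=> /inf_lt; case; first by exists (rnorm a), a.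
    move=> _ [a' /= aa' <-] a'e; exists a' => //.
    by rewrite -psi_fiber -[in RHS]psi_fiber aa'.
  move=> b e e0; have e2 : 0 < e / 2 by rewrite divr_gt0.
  have [_ [x' xx' <-] bx'] := cp_dense hS hB b e2.
  have [x xx xx'e] := xalg_extend xx' e2.
  exists (psi (iota x)); first by exists (iota x).
  apply: le_lt_trans (rnormBB _ (j x') _) _; rewrite [ltRHS]splitr; apply: ltrD => //.
  have xxr := xalg_xres cS (fiber_invariant y p_Theta) xx.
  by rewrite psi_iota // -(iotaB hB) // (cp_norm hS hB) //; exact: xalgB.
have [pre preP] := choice psi_surj.
exists (fun u => psi (repr u)); split; last first.
  by move=> a xa; rewrite psi_fiber psi_iota.
have [L M St] := hpsi; split.
- exists (fun b => to_fiber phi y (pre b)) => [u|b]; last by rewrite psi_fiber.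
  rewrite -[RHS]to_fiber_repr; apply/to_fiberE.
  by apply: (psi_ker p_Theta p_cts hT hY lcY hA hpsi psi_norm); rewrite bpsi.1 preP subrr.
- split=> [c u v _ _|u v _ _|u _].
  + have -> : c *: u + v = to_fiber phi y (c *: repr u + repr v).
      by rewrite to_fiberD to_fiberZ !to_fiber_repr.
    by rewrite psi_fiber L.
  + by rewrite /fmul psi_fiber M.
  + by rewrite /fstar psi_fiber St.
- move=> u; rewrite -(fnorm_psi p_Theta p_cts hT hY lcY hA hpsi psi_norm).
  by rewrite to_fiber_repr.
Qed.
End FiberIsomorphism.

Theorem proposition1p12 (R : realType) (Y H : topologicalType)
    (hY : lc_space Y) (hH : lc_space H) (p : H -> Y)
    (p_cts : continuous p)
    (p_open : forall U : set H, open U -> open (p @` U))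
    (p_surj : forall y : Y, exists x : H, p x = y)
    (Theta : partial_aut H)
    (p_Theta : forall x, pdom Theta x -> p (pfun Theta x) = p x)
    (A : cstarAlgType R) (iota : (int -> H -> Cplx R) -> A)
    (hA : is_crossed_product Theta iota) :
  exists phi : (Y -> Cplx R) -> (A -> A) * (A -> A),
    [/\ forall f k g, C0 R [set: Y] f -> C0 R (Hdom Theta k) g ->
          (phi f).1 (iota (smono k g)) =
          iota (smono k (fun x => f (p x) * g x)),
        continuous_field phi &
        forall (y : Y) (B : cstarAlgType R)
          (j : (int -> p @^-1` [set y] -> Cplx R) -> B),
          is_crossed_product
            (restriction (fiber_invariant y p_Theta)) j ->
          exists Psi : fiber phi y -> B,
            fiber_isomorphism Psi /\
            forall a, xalg R Theta a ->
              Psi (to_fiber phi y (iota a)) = j (fun k x => a k (set_val x))].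
Proof.
have [hsY lcY _] := hY; have [hsH lcH scH] := hH.
exists (base_action p_Theta p_cts hsH hA); split.
- move=> f k g fC gC; rewrite -mulf_smono; apply: (bmul_iota _ _ _ _ fC).
  exact: xalg_mono.
- split.
  + exact: cp_separable hsH scH hA.
  + exact: base_action_structure.
  + by move=> a; exact: fnorm_cts.
- by move=> y B j hB; exact: fiber_iso_exists.
Qed.
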